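(* The variety of complex $3$-dimensional derived Jordan algebras has dimension $12$ and it has exactly $7$ irreducible components, namely $$\mathcal{C}_1=\overline{\mathcal{O}(\mathrm{J}_{07})},\ \mathcal{C}_2=\overline{\mathcal{O}(\mathrm{J}_{12})},\ \mathcal{C}_3=\overline{\mathcal{O}(\mathrm{J}_{14})},\ \mathcal{C}_4=\overline{\mathcal{O}(\mathrm{J}_{16})},\ \mathcal{C}_5=\overline{\mathcal{O}(\mathrm{J}_{19})},\ \mathcal{C}_6=\overline{\mathcal{O}(\mathcal{J}_{01}^{\alpha})},\ \mathcal{C}_7=\overline{\mathcal{O}(\mathrm{A}_{01}^{\alpha,\beta,\gamma})},$$ where the following are commutative algebras with basis $e_1,e_2,e_3$ (and $\alpha,\beta,\gamma\in\mathbb{C}$): - $\mathrm{J}_{07}$: $e_1e_1=e_1$, $e_2e_2=e_2$, $e_3e_3=e_3$; - $\mathrm{J}_{12}$: $e_1e_1=e_1$, $e_2e_2=e_2$, $e_3e_3=e_1+e_2$, $e_1e_3=\frac12e_3$, $e_2e_3=\frac12e_3$; - $\mathrm{J}_{14}$: $e_1e_1=e_1$, $e_1e_2=\frac12e_2$, $e_1e_3=\frac12e_3$; - $\mathrm{J}_{16}$: $e_1e_1=e_1$, $e_2e_2=e_3$, $e_1e_2=\frac12e_2$, $e_1e_3=e_3$; - $\mathrm{J}_{19}$: $e_1e_1=e_1$, $e_2e_2=e_2$, $e_1e_3=\frac12e_3$; - $\mathcal{J}_{01}^{\alpha}$: $e_1e_1=e_1$, $e_1e_2=\frac12e_2$,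 $e_2e_3=e_1$, $e_3e_3=e_1+\alpha e_2$; - $\mathrm{A}_{01}^{\alpha,\beta,\gamma}$: $e_1e_1=e_1$, $e_2e_2=e_2$, $e_1e_3=\alpha e_2$, $e_2e_3=\beta e_1$, $e_3e_3=e_1+\gamma e_2$. In particular, there are exactly $5$ rigid algebras (up to isomorphism) in this variety.
   Context: Let $\mathbb{V}$ be a $3$-dimensional complex vector space with fixed basis $e_1,e_2,e_3$. Algebra structures on $\mathbb{V}$ (bilinear multiplications) are identified with points of the affine space $\mathrm{Hom}(\mathbb{V}\otimes\mathbb{V},\mathbb{V})\cong\mathbb{C}^{27}$ via structure constants. The variety of complex $3$-dimensional algebras of a class defined by polynomial identities is the Zariski-closed subset $\mathbb{L}$ of structures satisfying these identities (including the zero structure). A commutative algebra is a Jordan algebra if it satisfies $(x^2y)x=x^2(yx)$. Here the class is that of derived Jordan algebras: commutative algebras $\mathrm{A}$ such that $\mathrm{A}^2$ (the span of all products) is a Jordan algebra. The group $\mathrm{GL}(\mathbb{V})$ acts on $\mathbb{L}$ by $(g*\mu)(x\otimes y)=g\mu(g^{-1}x\otimes g^{-1}y)$; $\mathcal{O}(\mathrm{A})$ is the orbit of a structure representing $\mathrm{A}$, and the bar is Zariski closure. For a parametrized family, the closure of $\mathcal{O}$ of the family denotes the Zariski closure of the union of the orbits of all members of the family. An algebra is rigid in $\mathbb{L}$ if its orbit is an open subset of $\mathbb{L}$. In multiplication tables, products of basis elements that are zero or follow by commutativity are omitted. *)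

(* Defs.v *)
From HB Require Import structures.
From mathcomp Require Import all_boot all_algebra.
From mathcomp Require Import mpoly.
From mathcomp Require Import boolp classical_sets cardinality topology.

Set Implicit Arguments.
Unset Strict Implicit.
Unset Printing Implicit Defensive.

Import GRing.Theory.
Local Open Scope classical_set_scope.
Local Open Scope ring_scope.

Section TopologicalNotions.
Variable T : topologicalType.
Implicit Types A Z W : set T.

Definition irreducible_set Z :=
  Z !=set0 /\ forall F G : set T, closed F -> closed G ->
    Z `<=` F `|` G -> Z `<=` F \/ Z `<=` G.

Definition irreducible_components A : set (set T) :=
  [set Z | [/\ Z `<=` A, irreducible_set Z &
    forall W, W `<=` A -> irreducible_set W -> Z `<=` W -> W = Z]].

Definition irreducible_chain A (m : nat) (Z : nat -> set T) :=
  (forall i, (i <= m)%N -> [/\ Z i `<=` A, irreducible_set (Z i) &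
      closed (Z i : set (subspace A))]) /\
  (forall i, (i < m)%N -> Z i `<` Z i.+1).

Definition has_krull_dim A (d : nat) :=
  (exists Z : nat -> set T, irreducible_chain A d Z) /\
  (forall m (Z : nat -> set T), irreducible_chain A m Z -> (m <= d)%N).

End TopologicalNotions.

(* Algebra structures on F^n: mu (i, j, k) is the coefficient of e_k in the
   product e_i e_j.  The alias carries the Zariski topology. *)
Definition algstr (F : fieldType) (n : nat) :=
  {ffun 'I_n * 'I_n * 'I_n -> F}.
HB.instance Definition _ (F : fieldType) (n : nat) := Choice.on (algstr F n).

Section Zariski.
Variables (F : fieldType) (n : nat).

Definition ncoord := #|{: 'I_n * 'I_n * 'I_n}|.

Definition coords (mu : algstr F n) (t : 'I_ncoord) : F :=
  (mu : {ffun _ -> F}) (enum_val t).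

Definition zero_locus (S : set {mpoly F[ncoord]}) : set (algstr F n) :=
  [set mu | forall p, S p -> p.@[coords mu] = 0].

Definition zariski_open : set_system (algstr F n) :=
  [set U | exists S, ~` U = zero_locus S].

Lemma zariski_openT : zariski_open setT.
Proof.
exists [set 1]; rewrite setCT; apply/seteqP; split=> // mu /(_ 1 erefl).
by rewrite meval1 => /eqP; rewrite oner_eq0.
Qed.

Lemma zariski_openI : setI_closed zariski_open.
Proof.
move=> U V [S US] [S' VS'].
exists [set p | exists2 q, S q & exists2 r, S' r & p = q * r].
rewrite setCI US VS'; apply/seteqP; split=> mu.
- case=> [Smu | S'mu] _ [q Sq [r Sr ->]]; rewrite mevalM.
  + by rewrite (Smu q) // mul0r.
  + by rewrite (S'mu r) // mulr0.
- move=> SS'mu; case: (pselect (zero_locus S mu)) => [|/existsNP[q]]; first by left.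
  move=> /not_implyP[Sq /eqP q0]; right=> r Sr.
  have /SS'mu : exists2 q0, S q0 & exists2 r0, S' r0 & q * r = q0 * r0.
    by exists q => //; exists r.
  by rewrite mevalM => /eqP; rewrite mulf_eq0 (negbTE q0) => /eqP.
Qed.

Lemma zariski_open_bigU (I : Type) (f : I -> set (algstr F n)) :
  (forall i, zariski_open (f i)) -> zariski_open (\bigcup_i f i).
Proof.
move=> /choice[S fS]; exists [set p | exists i, S i p].
rewrite setC_bigcup; apply/seteqP; split=> mu.
- by move=> fmu p [i Sp]; have := fmu i Logic.I; rewrite fS; apply.
- by move=> Smu i _; rewrite fS => p Sp; apply: Smu; exists i.
Qed.

HB.instance Definition _ := @isOpenTopological.Build (algstr F n)
  zariski_open zariski_openT zariski_openI zariski_open_bigU.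

Lemma zariski_closedP (A : set (algstr F n)) :
  closed A <-> exists S, A = zero_locus S.
Proof.
rewrite -openC; split=> [[S]|[S AS]]; last by exists S; rewrite setCK.
by rewrite setCK; exists S.
Qed.

End Zariski.

Section Algebras.
Variables (F : fieldType) (n : nat).
Implicit Types (mu : algstr F n) (x y : 'cV[F]_n).

Definition amul mu x y : 'cV[F]_n :=
  \col_k \sum_i \sum_j x i 0 * y j 0 * (mu : {ffun _ -> F}) (i, j, k).

Definition acommutative mu := forall x y, amul mu x y = amul mu y x.

(* (x^2 y) x = x^2 (y x) for all x, y in B *)
Definition jordan_identity_on mu (B : set 'cV[F]_n) :=
  forall x y, B x -> B y ->
    amul mu (amul mu (amul mu x x) y) x = amul mu (amul mu x x) (amul mu y x).

(* A^2, the linear span of all products *)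
Definition asquare mu : set 'cV[F]_n :=
  [set z | exists (m : nat) (c : 'I_m -> F) (u v : 'I_m -> 'cV[F]_n),
     z = \sum_t c t *: amul mu (u t) (v t)].

(* A^2 is closed under the product and inherits commutativity, so that it is
   a Jordan algebra as soon as the Jordan identity holds on it. *)
Definition derived_jordan : set (algstr F n) :=
  [set mu | acommutative mu /\ jordan_identity_on mu (asquare mu)].

(* (g * mu)(x, y) = g mu(g^-1 x, g^-1 y), on structure constants *)
Definition gact (g : 'M[F]_n) mu : algstr F n :=
  [ffun t : 'I_n * 'I_n * 'I_n =>
    (g *m amul mu (invmx g *m delta_mx t.1.1 0) (invmx g *m delta_mx t.1.2 0))
      t.2 0].

Definition GLorbit mu : set (algstr F n) :=
  [set gact g mu | g in [set g | g \in unitmx]].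

Definition rigid_in (L : set (algstr F n)) : set (algstr F n) :=
  [set mu | L mu /\ open (GLorbit mu : set (subspace L))].

End Algebras.

Section Tables.
Variable F : fieldType.

Definition e1 : 'cV[F]_3 := delta_mx (@Ordinal 3 0 isT) 0.
Definition e2 : 'cV[F]_3 := delta_mx (@Ordinal 3 1 isT) 0.
Definition e3 : 'cV[F]_3 := delta_mx (@Ordinal 3 2 isT) 0.

(* The commutative algebra with e_i e_j = pij for i <= j. *)
Definition commalg3 (p11 p22 p33 p12 p13 p23 : 'cV[F]_3) : algstr F 3 :=
  [ffun t : 'I_3 * 'I_3 * 'I_3 =>
    match minn t.1.1 t.1.2, maxn t.1.1 t.1.2 with
    | 0, 0 => p11
    | 1, 1 => p22
    | 2, 2 => p33
    | 0, 1 => p12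
    | 0, 2 => p13
    | 1, 2 => p23
    | _, _ => 0%R
    end%N t.2 0].

Local Notation half := (2%:R^-1 : F).

(* Arguments of commalg3:     e1e1 e2e2 e3e3 e1e2 e1e3 e2e3 *)
Definition J07 := commalg3 e1 e2 e3 0 0 0.
Definition J12 := commalg3 e1 e2 (e1 + e2) 0 (half *: e3) (half *: e3).
Definition J14 := commalg3 e1 0 0 (half *: e2) (half *: e3) 0.
Definition J16 := commalg3 e1 e3 0 (half *: e2) e3 0.
Definition J19 := commalg3 e1 e2 0 0 (half *: e3) 0.
Definition calJ01 (a : F) := commalg3 e1 0 (e1 + a *: e2) (half *: e2) 0 e1.
Definition A01 (a b c : F) := commalg3 e1 e2 (e1 + c *: e2) 0 (a *: e2) (b *: e1).

End Tables.

Arguments derived_jordan F n : clear implicits.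

(* Main.v *)
(** An algebra A of the variety either satisfies A^2 <> A, and then all its
    products lie in a plane W, or A^2 = A is itself a Jordan algebra.

    In the first case, W can be chosen to be either an associative algebra or an
    algebra with x^2 proportional to x, and the products with a third basis
    vector are arbitrary elements of W; after a generic perturbation and a change
    of basis this gives the families A01 and calJ01.  In the second case, either
    A is generated by one element and deforms to F^3, or the Peirce decomposition
    with respect to an idempotent leaves finitely many tables, all of which are
    degenerations of J07, J12, J14, J16 and J19.

    Multiplying h^-1 mu(h x, h y) by det h stays in the orbit of mu, so orbits of
    polynomial families are polynomial images of open subsets of affine spaces.
    Two points of such an image are joined by a polynomial curve, whence
    irreducibility; and if Z_0 < ... < Z_m is a chain in the closure of the image
    of F^d, with g_i vanishing on Z_(i-1) but not on Z_i, then the k^m monomials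
    in the g_i with exponents below k are linearly independent on Z_m although
    they live in a space of dimension O(k^d), whence m <= d.

    For each J the nonvanishing of one polynomial, built from traces,
    determinants and associators, cuts out the orbit of J inside the variety.
    This gives at once the rigidity of the five J and most of the
    non-inclusions.  Along the two families the isomorphism type is not
    constant, so that they contain no rigid algebra. *)

(* The tables of the case analysis are complete but redundant: they keep parameters, and their
   special values are handled by perturbation. No limit is taken: a closed set containing all but
   finitely many points of a polynomial curve contains the whole curve. The number 12 is 9 + 3, nine
   matrix entries and at most three parameters. This bounds the dimension above. The lower bound
   needs an explicit chain of parametrized sets, which need not be unions of orbits, each cut off
   from the next by one polynomial. The two families are told apart from the five algebras J by the
   condition A^2 = A and by the Jordan identity. They are told apart from each other by what holds
   on A^2: associativity throughout [A01], and x^2 proportional to x throughout [calJ01]. The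
   constants 2, 5/2 and 3 in the isolating polynomials are ratios of the trace of a multiplication
   operator L_x to one of its eigenvalues. The vanishing of det (tr L_x - c L_x) for all x thus
   detects Peirce spectra without any idempotent being chosen. *)
Require Import Defs.
From mathcomp Require Import all_boot all_algebra.
From mathcomp Require Import mpoly complex ring.
From mathcomp Require Import boolp classical_sets cardinality reals topology.

Set Implicit Arguments.
Unset Strict Implicit.
Unset Printing Implicit Defensive.

Import GRing.Theory Num.Theory.
Local Open Scope classical_set_scope.
Local Open Scope card_scope.
Local Open Scope ring_scope.

(** * Algebras of polynomial functions *)

Section FunctionAlgebras.
Variables (F : fieldType) (T : Type).

(** One abstract notion serves polynomial functions of the structure constants, of a list of
    parameters and of a curve parameter; determinants, adjugates and algebra products are then
    treated once for all three. *)
Record fun_subalg (P : (T -> F) -> Prop) : Prop := FunSubalg {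
  fsC : forall c, P (fun _ => c);
  fsD : forall f g, P f -> P g -> P (fun x => f x + g x);
  fsM : forall f g, P f -> P g -> P (fun x => f x * g x) }.

Variables (P : (T -> F) -> Prop) (HP : fun_subalg P).

Lemma fsN f : P f -> P (fun x => - f x).
Proof.
move=> Pf; have := fsM HP (fsC HP (-1)) Pf.
by under eq_fun do rewrite mulN1r.
Qed.

Lemma fsB f g : P f -> P g -> P (fun x => f x - g x).
Proof. by move=> Pf Pg; apply: (fsD HP) => //; apply: fsN. Qed.

Lemma fs_sum I (r : seq I) (Q : pred I) (f : I -> T -> F) :
  (forall i, P (f i)) -> P (fun x => \sum_(i <- r | Q i) f i x).
Proof.
move=> Pf; elim: r => [|i r IH].
  by under eq_fun do rewrite big_nil; exact: (fsC HP).
under eq_fun do rewrite big_cons.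
by case: (Q i) => //; apply: (fsD HP).
Qed.

Lemma fs_prod I (r : seq I) (Q : pred I) (f : I -> T -> F) :
  (forall i, P (f i)) -> P (fun x => \prod_(i <- r | Q i) f i x).
Proof.
move=> Pf; elim: r => [|i r IH].
  by under eq_fun do rewrite big_nil; exact: (fsC HP).
under eq_fun do rewrite big_cons.
by case: (Q i) => //; apply: (fsM HP).
Qed.

Lemma fsX n f : P f -> P (fun x => f x ^+ n).
Proof.
move=> Pf; elim: n => [|n IH].
  by under eq_fun do rewrite expr0; exact: (fsC HP).
by under eq_fun do rewrite exprS; apply: (fsM HP).
Qed.

Lemma fs_meval n (v : T -> 'I_n -> F) (p : {mpoly F[n]}) :
  (forall i, P (v^~ i)) -> P (fun x => p.@[v x]).
Proof.
move=> Pv; under eq_fun do rewrite mevalE.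
apply: fs_sum => m; apply: (fsM HP); first exact: (fsC HP).
by apply: fs_prod => i; apply: fsX.
Qed.

Lemma fs_det n (M : T -> 'M[F]_n) :
  (forall i j, P (fun x => M x i j)) -> P (fun x => \det (M x)).
Proof.
move=> PM; rewrite /determinant; apply: fs_sum => s.
by apply: (fsM HP); [exact: (fsC HP) | apply: fs_prod => i].
Qed.

Lemma fs_mulmx m n p (A : T -> 'M[F]_(m, n)) (B : T -> 'M[F]_(n, p)) i j :
  (forall i j, P (fun x => A x i j)) -> (forall i j, P (fun x => B x i j)) ->
  P (fun x => (A x *m B x) i j).
Proof.
move=> PA PB; under eq_fun do rewrite mxE.
by apply: fs_sum => k; apply: (fsM HP).
Qed.

Lemma fs_adj n (M : T -> 'M[F]_n) i j :
  (forall i j, P (fun x => M x i j)) -> P (fun x => (\adj (M x)) i j).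
Proof.
move=> PM; under eq_fun do rewrite mxE /cofactor.
apply: (fsM HP); first exact: (fsC HP).
by apply: fs_det => k l; under eq_fun do rewrite !mxE.
Qed.

Lemma fs_amul n (mu : T -> algstr F n) (x y : T -> 'cV[F]_n) k l :
  (forall t, P (fun s => (mu s : {ffun _ -> F}) t)) ->
  (forall i j, P (fun s => x s i j)) -> (forall i j, P (fun s => y s i j)) ->
  P (fun s => amul (mu s) (x s) (y s) k l).
Proof.
move=> Pmu Px Py; under eq_fun do rewrite mxE.
apply: fs_sum => i; apply: fs_sum => j.
by apply: (fsM HP); [apply: (fsM HP) |].
Qed.

End FunctionAlgebras.

(** The coordinate map [v] is arbitrary, so that both the space of structures and a space of
    parameters are covered. *)
Definition polyfun (F : fieldType) n T (v : T -> 'I_n -> F) (f : T -> F) :=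
  exists p : {mpoly F[n]}, forall x, f x = p.@[v x].

Definition upolyfun (F : fieldType) (f : F -> F) :=
  exists p : {poly F}, forall t, f t = p.[t].

Lemma polyfun_subalg (F : fieldType) n T (v : T -> 'I_n -> F) :
  fun_subalg (polyfun v).
Proof.
split=> [c|f g [p pE] [q qE]|f g [p pE] [q qE]].
- by exists c%:MP => x; rewrite mevalC.
- by exists (p + q) => x; rewrite mevalD pE qE.
- by exists (p * q) => x; rewrite mevalM pE qE.
Qed.

Lemma polyfun_var (F : fieldType) n T (v : T -> 'I_n -> F) i : polyfun v (v^~ i).
Proof. by exists 'X_i => x; rewrite mevalXU. Qed.

Lemma upolyfun_subalg (F : fieldType) : fun_subalg (@upolyfun F).
Proof.
split=> [c|f g [p pE] [q qE]|f g [p pE] [q qE]].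
- by exists c%:P => x; rewrite hornerC.
- by exists (p + q) => x; rewrite hornerD pE qE.
- by exists (p * q) => x; rewrite hornerM pE qE.
Qed.

Lemma upolyfun_id (F : fieldType) : @upolyfun F id.
Proof. by exists 'X => x; rewrite hornerX. Qed.

Section InfiniteField.
Variable F : numClosedFieldType.

Lemma poly_nonroot (p : {poly F}) : p != 0 -> exists t, p.[t] != 0.
Proof.
move=> p0; apply: contrapT => /forallNP H.
have /(max_poly_roots p0) : all (root p) [seq i%:R | i <- iota 0 (size p)].
  by apply/allP => _ /mapP[i _ ->]; apply/eqP; have /negP/negPn/eqP := H i%:R.
rewrite map_inj_uniq ?iota_uniq; last by move=> i j /eqP; rewrite eqr_nat => /eqP.
by rewrite size_map size_iota ltnn => /(_ isT).
Qed.

(** F[t] is a domain and F is infinite. This is the form in which the density of nonempty open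
    subsets of a line is used. *)
Lemma upolyfun_mul_neq0 (f g : F -> F) a b :
  upolyfun f -> upolyfun g -> f a != 0 -> g b != 0 ->
  exists t, f t * g t != 0.
Proof.
move=> [p pE] [q qE]; rewrite pE qE => pa qb.
have /poly_nonroot[t] : p * q != 0.
  by apply: mulf_neq0; [move: pa | move: qb]; apply: contraNneq => ->;
    rewrite horner0.
by exists t; rewrite pE qE -hornerM.
Qed.

End InfiniteField.

(** * Closed and irreducible sets of structures *)

Section ZariskiTopology.
Variables (F : numClosedFieldType) (n : nat).
Implicit Types (S Z C : set (algstr F n)) (mu nu : algstr F n).

Definition afun := @polyfun F (ncoord n) (algstr F n) (@coords F n).

Lemma afun_subalg : fun_subalg afun.
Proof. exact: polyfun_subalg. Qed.

Lemma afun_coord t : afun (fun mu => (mu : {ffun _ -> F}) t).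
Proof.
by have := polyfun_var (@coords F n) (enum_rank t);
  under eq_fun do rewrite /coords enum_rankK.
Qed.

Lemma closed_zeros (I : Type) (f : I -> algstr F n -> F) :
  (forall i, afun (f i)) -> closed [set mu | forall i, f i mu = 0].
Proof.
move=> /choice[p pE]; apply/zariski_closedP; exists (range p).
apply/seteqP; split=> [mu /= H _ [i _ <-]|mu H i]; first by rewrite -pE.
by rewrite pE; apply: H; exists i.
Qed.

Lemma in_closureP S mu :
  closure S mu <-> forall f, afun f -> (forall nu, S nu -> f nu = 0) -> f mu = 0.
Proof.
split=> [clS f fa fS|H].
  have cl : closed [set nu | f nu = 0].
    have := @closed_zeros unit (fun=> f) (fun=> fa).
    congr closed; apply/seteqP; split=> nu /=; first by apply.
    by move=> ->.
  have : closure [set nu | f nu = 0] mu by apply: closureS clS => nu /fS.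
  by move/closure_id: cl => <-.
have /zariski_closedP[T TE] := @closed_closure _ S.
rewrite TE => p Tp; apply: (H (fun nu => p.@[coords nu])); first by exists p.
by move=> nu /(@subset_closure _ S); rewrite TE; apply.
Qed.

Lemma closed_sub S C : closed C -> S `<=` C -> closure S `<=` C.
Proof. by move=> /closure_id {2}-> SC; apply: closureS. Qed.

Lemma open_afun f : afun f -> open [set mu | f mu != 0].
Proof.
move=> fa; rewrite -[X in open X]setCK openC.
have := @closed_zeros unit (fun=> f) (fun=> fa); congr closed.
apply/seteqP; split=> nu /=; first by move=> /(_ tt) ->; rewrite eqxx.
by move=> /negP/negPn/eqP.
Qed.

Lemma open_nbhs_afun (U : set (algstr F n)) mu : open U -> U mu ->
  exists f, [/\ afun f, f mu != 0 & forall nu, f nu != 0 -> U nu].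
Proof.
move=> oU Umu; have /zariski_closedP[T TE] : closed (~` U) by rewrite closedC.
have : ~ zero_locus T mu by rewrite -TE /=.
move=> /existsNP[p /not_implyP[Tp /eqP p0]].
exists (fun nu => p.@[coords nu]); split=> //; first by exists p.
move=> nu pnu; have : ~ (~` U) nu by rewrite TE => /(_ p Tp) /eqP; rewrite (negbTE pnu).
by rewrite /setC /= notK.
Qed.

Definition acurve (g : F -> algstr F n) :=
  forall t, upolyfun (fun s => (g s : {ffun _ -> F}) t).

Lemma acurve_comp f g : afun f -> acurve g -> upolyfun (fun t => f (g t)).
Proof.
move=> [p pE] gc; under eq_fun do rewrite pE.
by apply: (fs_meval (upolyfun_subalg F)) => i; apply: gc.
Qed.

(** This replaces limits. An equation of [C] violated somewhere on the curve gives a nonzero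
    polynomial in t, and its product with [q] would be nonzero at a point which is known to lie in
    [C]. *)
Lemma closed_curve C g q : closed C -> acurve g -> upolyfun q ->
  (exists t, q t != 0) -> (forall t, q t != 0 -> C (g t)) -> forall t, C (g t).
Proof.
move=> cC gc qu [t1 qt1] H t; have /zariski_closedP[T TE] := cC.
rewrite TE => p Tp; apply/eqP; apply: contraT => pt.
have pu : upolyfun (fun s => p.@[coords (g s)]).
  by apply: (acurve_comp (f := fun nu => p.@[coords nu])) => //; exists p.
have [s] := upolyfun_mul_neq0 pu qu pt qt1.
rewrite mulf_eq0 negb_or => /andP[ps qs].
by have := H s qs; rewrite TE => /(_ p Tp) /eqP; rewrite (negbTE ps).
Qed.

(** The factor [q] excludes the parameters at which the curve may leave [S], for instance where a
    segment of matrices meets a singular one. *)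
Definition curve_connected S := S !=set0 /\
  forall x y, S x -> S y -> exists g q, [/\ acurve g, upolyfun q,
    [/\ g 0 = x, g 1 = y & q 0 != 0] & forall t, q t != 0 -> S (g t)].

(* If polynomials f and h do not vanish at two points x and y of S, then f h q
   is a nonzero polynomial in one variable along the curve joining x and y. *)
Lemma curve_irreducible S : curve_connected S -> irreducible_set S.
Proof.
move=> [S0 Sc]; split=> // A B cA cB SAB.
apply/or_asboolP; apply/negPn; rewrite negb_or; apply/negP.
move=> /andP[/asboolPn /existsNP[x /not_implyP[Sx nAx]]].
move=> /asboolPn /existsNP[y /not_implyP[Sy nBy]].
have [f [fa fx fA]] := open_nbhs_afun (closed_openC cA) nAx.
have [h [ha hy hB]] := open_nbhs_afun (closed_openC cB) nBy.
have [g [q [gc qu [g0 g1 q0] gS]]] := Sc _ _ Sx Sy.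
rewrite -g0 in fx; rewrite -g1 in hy.
have fu := acurve_comp fa gc; have hu := acurve_comp ha gc.
have [s fs] := upolyfun_mul_neq0 fu qu fx q0.
have [t] := upolyfun_mul_neq0 (fsM (upolyfun_subalg F) fu qu) hu fs hy.
rewrite !mulf_eq0 !negb_or => /andP[/andP[ft qt] ht].
by case: (SAB (g t) (gS t qt)) => [|]; [apply: fA | apply: hB].
Qed.

Lemma closure_irreducible S : irreducible_set S -> irreducible_set (closure S).
Proof.
move=> [[x Sx] Si]; split; first by exists x; apply: subset_closure.
move=> A B cA cB SAB; have [] := Si A B cA cB.
- exact: subset_trans (@subset_closure _ S) SAB.
- by move=> SA; left; apply: closed_sub.
- by move=> SB; right; apply: closed_sub.
Qed.

End ZariskiTopology.

(** * Change of basis *)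

Section Orbits.
Variables (F : fieldType) (n : nat).
Implicit Types (mu nu : algstr F n) (x y z : 'cV[F]_n) (g h : 'M[F]_n).

Lemma amulDl mu x y z : amul mu (x + y) z = amul mu x z + amul mu y z.
Proof.
apply/colP => k; rewrite !mxE -big_split; apply: eq_bigr => i _ /=.
by rewrite -big_split; apply: eq_bigr => j _ /=; rewrite !mxE !mulrDl.
Qed.

Lemma amulDr mu x y z : amul mu x (y + z) = amul mu x y + amul mu x z.
Proof.
apply/colP => k; rewrite !mxE -big_split; apply: eq_bigr => i _ /=.
by rewrite -big_split; apply: eq_bigr => j _ /=; rewrite !mxE mulrDr mulrDl.
Qed.

Lemma amulZl mu c x y : amul mu (c *: x) y = c *: amul mu x y.
Proof.
apply/colP => k; rewrite !mxE mulr_sumr; apply: eq_bigr => i _ /=.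
by rewrite mulr_sumr; apply: eq_bigr => j _ /=; rewrite !mxE !mulrA.
Qed.

Lemma amulZr mu c x y : amul mu x (c *: y) = c *: amul mu x y.
Proof.
apply/colP => k; rewrite !mxE mulr_sumr; apply: eq_bigr => i _ /=.
rewrite mulr_sumr; apply: eq_bigr => j _ /=.
by rewrite !mxE !mulrA (mulrC c).
Qed.

Lemma amul0l mu x : amul mu 0 x = 0.
Proof. by have := amulZl mu 0 0 x; rewrite !scale0r. Qed.

Lemma amul0r mu x : amul mu x 0 = 0.
Proof. by have := amulZr mu 0 x 0; rewrite !scale0r. Qed.

Lemma amulNl mu x y : amul mu (- x) y = - amul mu x y.
Proof. by rewrite -scaleN1r amulZl scaleN1r. Qed.

Lemma amulNr mu x y : amul mu x (- y) = - amul mu x y.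
Proof. by rewrite -scaleN1r amulZr scaleN1r. Qed.

Lemma amul_suml mu I (r : seq I) (P : pred I) (f : I -> 'cV[F]_n) y :
  amul mu (\sum_(i <- r | P i) f i) y = \sum_(i <- r | P i) amul mu (f i) y.
Proof.
by apply: (big_morph (fun x => amul mu x y)) => [u v|];
  rewrite ?amulDl ?amul0l.
Qed.

Lemma amul_sumr mu I (r : seq I) (P : pred I) (f : I -> 'cV[F]_n) x :
  amul mu x (\sum_(i <- r | P i) f i) = \sum_(i <- r | P i) amul mu x (f i).
Proof.
by apply: (big_morph (fun y => amul mu x y)) => [u v|];
  rewrite ?amulDr ?amul0r.
Qed.

Lemma amul_delta mu i j k :
  amul mu (delta_mx i 0) (delta_mx j 0) k 0 = (mu : {ffun _ -> F}) (i, j, k).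
Proof.
rewrite mxE (bigD1 i) //= (bigD1 j) //= !mxE !eqxx !mul1r big1 ?addr0.
  rewrite big1 ?addr0 // => i' /negbTE i'i.
  by apply: big1 => j' _; rewrite !mxE i'i !mul0r.
by move=> j' /negbTE j'j; rewrite !mxE j'j mulr0 mul0r.
Qed.

Lemma col_delta x : x = \sum_i x i 0 *: delta_mx i 0.
Proof.
by rewrite {1}(matrix_sum_delta x); apply: eq_bigr => i _; rewrite big_ord1.
Qed.

Lemma amul_ext mu nu :
  (forall i j, amul mu (delta_mx i 0) (delta_mx j 0) =
               amul nu (delta_mx i 0) (delta_mx j 0)) -> mu = nu.
Proof.
move=> H; apply/ffunP => -[[i j] k].
by rewrite -!amul_delta H.
Qed.

Lemma amul_gact g mu x y : amul (gact g mu) x y =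
  g *m amul mu (invmx g *m x) (invmx g *m y).
Proof.
rewrite {1}(col_delta x) {1}(col_delta y) amul_suml.
rewrite [in RHS](col_delta x) [in RHS](col_delta y) !mulmx_sumr amul_suml mulmx_sumr.
apply: eq_bigr => i _; rewrite amul_sumr amul_sumr mulmx_sumr.
apply: eq_bigr => j _; rewrite !amulZl !amulZr -!scalemxAr !amulZl !amulZr -!scalemxAr.
congr (_ *: (_ *: _)); apply/colP => k.
by rewrite amul_delta ffunE /=.
Qed.

Lemma amul_gactK g mu x y : g \in unitmx ->
  amul (gact g mu) (g *m x) (g *m y) = g *m amul mu x y.
Proof. by move=> gu; rewrite amul_gact !mulKmx. Qed.

Lemma gact1 mu : gact 1%:M mu = mu.
Proof. by apply: amul_ext => i j; rewrite amul_gact invmx1 !mul1mx. Qed.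

Lemma invmx_mulmx g h : g \in unitmx -> h \in unitmx ->
  invmx (g *m h) = invmx h *m invmx g.
Proof.
move=> gu hu; apply: (can_inj (mulKmx (_ : g *m h \in unitmx))).
  by rewrite unitmx_mul gu.
by rewrite mulmxV ?unitmx_mul ?gu // mulmxA mulmxK // mulmxV.
Qed.

Lemma gactM g h mu : g \in unitmx -> h \in unitmx ->
  gact g (gact h mu) = gact (g *m h) mu.
Proof.
by move=> gu hu; apply: amul_ext => i j; rewrite !amul_gact invmx_mulmx // !mulmxA.
Qed.

Lemma gactK g mu : g \in unitmx -> gact (invmx g) (gact g mu) = mu.
Proof. by move=> gu; rewrite gactM ?unitmx_inv // mulVmx // gact1. Qed.

Lemma gact_basis g mu nu : g \in unitmx ->
  (forall i j, amul mu (g *m delta_mx i 0) (g *m delta_mx j 0) =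
     g *m amul nu (delta_mx i 0) (delta_mx j 0)) -> mu = gact g nu.
Proof.
move=> gu H; rewrite -(gact1 mu) -(mulmxV gu) -gactM ?unitmx_inv //.
congr gact; apply: amul_ext => i j.
by rewrite amul_gact invmxK H mulKmx.
Qed.

Lemma GLorbit_refl mu : GLorbit mu mu.
Proof. by exists 1%:M => /=; rewrite ?unitmx1 ?gact1. Qed.

Lemma GLorbit_gact g mu nu : g \in unitmx -> GLorbit mu nu -> GLorbit mu (gact g nu).
Proof.
by move=> gu [h hu <-]; exists (g *m h); rewrite ?gactM //= unitmx_mul gu.
Qed.

Lemma GLorbit_sym mu nu : GLorbit mu nu -> GLorbit nu mu.
Proof.
by move=> [g gu <-]; exists (invmx g); rewrite ?gactK //= unitmx_inv.
Qed.

Lemma GLorbit_trans mu nu rho : GLorbit mu nu -> GLorbit nu rho -> GLorbit mu rho.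
Proof. by move=> munu [g gu <-]; apply: GLorbit_gact. Qed.

Lemma GLorbit_eq mu nu : GLorbit mu nu -> GLorbit nu = GLorbit mu.
Proof.
move=> munu; apply/seteqP; split=> rho; first exact: GLorbit_trans.
exact: GLorbit_trans (GLorbit_sym munu).
Qed.

Definition GLstable (S : set (algstr F n)) :=
  forall g mu, g \in unitmx -> S mu -> S (gact g mu).

Lemma GLstable_orbit S mu nu : GLstable S -> S mu -> GLorbit mu nu -> S nu.
Proof. by move=> HS Smu [g gu <-]; apply: HS. Qed.

End Orbits.

Section OrbitClosures.
Variables (F : numClosedFieldType) (n : nat).
Implicit Types (mu nu : algstr F n) (S : set (algstr F n)) (g h : 'M[F]_n).

Lemma afun_gact g f : afun f -> afun (fun mu : algstr F n => f (gact g mu)).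
Proof.
move=> [p pE]; under eq_fun do rewrite pE.
apply: (fs_meval (afun_subalg F n)) => i; rewrite /coords.
under eq_fun do rewrite ffunE.
apply: (fs_mulmx (afun_subalg F n)) => k l; first exact: (fsC (afun_subalg F n)).
apply: (fs_amul (afun_subalg F n)) => [t|u v|u v]; first exact: afun_coord.
  exact: (fsC (afun_subalg F n)).
exact: (fsC (afun_subalg F n)).
Qed.

Lemma closure_GLstable S : GLstable S -> GLstable (closure S).
Proof.
move=> HS g mu gu /in_closureP Smu; apply/in_closureP => f fa fS.
apply: (Smu (fun nu => f (gact g nu))); first exact: afun_gact.
by move=> nu Snu; apply/fS/HS.
Qed.

(* h^-1 mu(h x, h y) multiplied by det h, hence polynomial in h; as scalar
   matrices act by scaling, it still lies in the orbit of mu. *)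
Definition adjact h mu : algstr F n :=
  [ffun t : 'I_n * 'I_n * 'I_n =>
    (\adj h *m amul mu (h *m delta_mx t.1.1 0) (h *m delta_mx t.1.2 0)) t.2 0].

Lemma invmx_scaled (c : F) h : c != 0 -> h \in unitmx ->
  c *: h \in unitmx /\ invmx (c *: h) = c^-1 *: invmx h.
Proof.
move=> c0 hu; have u : c *: h \in unitmx.
  by rewrite unitmxE detZ unitrM -unitmxE hu andbT unitrX ?unitfE.
by rewrite u invmxZ.
Qed.

Lemma adj_unitmx h : h \in unitmx -> \adj h = \det h *: invmx h.
Proof.
move=> hu; rewrite /invmx hu scalerA mulfV ?scale1r //.
by move: hu; rewrite unitmxE unitfE.
Qed.

Lemma adjact_orbit h mu : h \in unitmx -> GLorbit mu (adjact h mu).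
Proof.
move=> hu; have d0 : \det h != 0 by move: hu; rewrite unitmxE unitfE.
have hvu : invmx h \in unitmx by rewrite unitmx_inv.
have [gu gE] := invmx_scaled (invr_neq0 d0) hvu.
exists ((\det h)^-1 *: invmx h) => //; apply: amul_ext => i j; apply/colP => k.
rewrite amul_gact [RHS]amul_delta ffunE /= gE !invmxK.
rewrite invrK -!scalemxAl amulZl amulZr -!scalemxAr !scalerA mulrA mulVf // mul1r.
by rewrite adj_unitmx -?scalemxAl.
Qed.

Lemma orbit_adjact mu nu : GLorbit mu nu ->
  exists2 h, h \in unitmx & nu = adjact h mu.
Proof.
case=> g /= gu <-; have d0 : \det g != 0 by move: gu; rewrite unitmxE unitfE.
(* For h = c g^-1 the factor det h contributes c^n / det g, h^-1 contributes c^-1 and the two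
   arguments contribute c^2. The total c^(n+1) / det g has to be 1. *)
set c := n.+1.-root (\det g); have cn : c ^+ n.+1 = \det g by rewrite rootCK.
have c0 : c != 0 by apply: contraNneq d0 => c0; rewrite -cn c0 expr0n.
have gvu : invmx g \in unitmx by rewrite unitmx_inv.
have [hu hE] := invmx_scaled c0 gvu; exists (c *: invmx g) => //.
apply: amul_ext => i j; apply/colP => k.
rewrite amul_gact [RHS]amul_delta ffunE /= -!scalemxAl amulZl amulZr scalerA.
rewrite adj_unitmx // hE invmxK detZ det_inv -!scalemxAl -!scalemxAr !scalerA.
suff -> : c ^+ n / \det g * c^-1 * (c * c) = 1 by rewrite scale1r.
rewrite mulrA mulfVK // mulrAC -exprSr cn divff //.
Qed.

End OrbitClosures.

(** * Parametrized families and dimension *)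

Section Families.
Variables (F : numClosedFieldType) (n : nat).
Implicit Types (mu nu : algstr F n) (S Z A : set (algstr F n)).

Definition polymap d (K : ('I_d -> F) -> algstr F n) :=
  forall t, polyfun id (fun x => (K x : {ffun _ -> F}) t).

Definition line d (x y : 'I_d -> F) (t : F) : 'I_d -> F :=
  fun i => x i + t * (y i - x i).

Lemma line0 d (x y : 'I_d -> F) : line x y 0 = x.
Proof. by apply/funext => i; rewrite /line mul0r addr0. Qed.

Lemma line1 d (x y : 'I_d -> F) : line x y 1 = y.
Proof. by apply/funext => i; rewrite /line mul1r addrC subrK. Qed.

Lemma line_upolyfun d (x y : 'I_d -> F) i : upolyfun ((line x y)^~ i).
Proof.
have H := upolyfun_subalg F.
by apply: (fsD H); [exact: (fsC H)|];
  apply: (fsM H); [exact: upolyfun_id | exact: (fsC H)].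
Qed.

Lemma acurve_line d (K : ('I_d -> F) -> algstr F n) x y :
  polymap K -> acurve (fun t => K (line x y t)).
Proof.
move=> Kp t; have [p pE] := Kp t; under eq_fun do rewrite pE.
by apply: (fs_meval (upolyfun_subalg F)) => i; apply: line_upolyfun.
Qed.

Lemma range_irreducible d (K : ('I_d -> F) -> algstr F n) :
  polymap K -> irreducible_set (range K).
Proof.
move=> Kp; apply: curve_irreducible; split.
  by exists (K (fun=> 0)); exists (fun=> 0).
move=> _ _ [x _ <-] [y _ <-]; exists (fun t => K (line x y t)), (fun=> 1).
split; first exact: acurve_line.
- exact: (fsC (upolyfun_subalg F)).
- by rewrite line0 line1 oner_eq0.
- by move=> t _; exists (line x y t).
Qed.

Section OrbitFamily.
Variables (m : nat) (K : ('I_m -> F) -> algstr F n).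
Hypothesis Kpoly : polymap K.

Definition GLfamily : set (algstr F n) := [set mu | exists x, GLorbit (K x) mu].

Lemma GLfamily_stable : GLstable GLfamily.
Proof. by move=> g mu gu [x Kx]; exists x; apply: GLorbit_gact. Qed.

Lemma adjact_fun_subalg T (P : (T -> F) -> Prop) (h : T -> 'M[F]_n)
    (k : T -> algstr F n) t : fun_subalg P ->
  (forall i j, P (fun s => h s i j)) ->
  (forall t, P (fun s => (k s : {ffun _ -> F}) t)) ->
  P (fun s => (adjact (h s) (k s) : {ffun _ -> F}) t).
Proof.
move=> HP Ph Pk; under eq_fun do rewrite ffunE.
apply: (fs_mulmx HP) => i j; first by apply: (fs_adj HP).
by apply: (fs_amul HP) => // u v; apply: (fs_mulmx HP) => // *; apply: (fsC HP).
Qed.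

(** Parameters and matrices are both joined by segments. The determinant along the segment of
    matrices is the factor outside whose zeros the curve stays in the family. *)
Lemma GLfamily_irreducible : irreducible_set GLfamily.
Proof.
have H := upolyfun_subalg F.
apply: curve_irreducible; split.
  by exists (K (fun=> 0)), (fun=> 0); apply: GLorbit_refl.
move=> _ _ [x /orbit_adjact[h hu ->]] [y /orbit_adjact[h' hu' ->]].
pose ht t := h + t *: (h' - h); pose q t := \det (ht t).
have htP i j : upolyfun (fun t => ht t i j).
  under eq_fun do rewrite !mxE.
  apply: (fsD H); first exact: (fsC H).
  by apply: (fsM H); [exact: upolyfun_id | exact: (fsC H)].
exists (fun t => adjact (ht t) (K (line x y t))), q; split.
- move=> t; apply: adjact_fun_subalg => // s.
  exact: (acurve_line x y Kpoly).
- exact: fs_det.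
- rewrite /q /ht line0 line1 scale0r addr0 scale1r addrC subrK.
  by split=> //; move: hu; rewrite unitmxE unitfE.
- move=> t qt; exists (line x y t); apply: adjact_orbit.
  by rewrite unitmxE unitfE.
Qed.

(** The coordinates are the entries of h and the parameters. Singular h are allowed, so [Psi] may
    leave the family; an inclusion is enough for an upper bound on the dimension. *)
Lemma GLfamily_param : exists (Psi : ('I_(n * n + m) -> F) -> algstr F n),
  polymap Psi /\ GLfamily `<=` range Psi.
Proof.
have H := polyfun_subalg (@id ('I_(n * n + m) -> F)).
pose hh (z : 'I_(n * n + m) -> F) : 'M[F]_n :=
  \matrix_(i, j) z (lshift m (mxvec_index i j)).
have hhE z i j : hh z i j = z (lshift m (mxvec_index i j)) by rewrite mxE.
pose xx (z : 'I_(n * n + m) -> F) : 'I_m -> F := fun i => z (rshift (n * n) i).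
exists (fun z => adjact (hh z) (K (xx z))); split.
- move=> t; apply: adjact_fun_subalg => // [i j|s].
    rewrite (funext (fun z => hhE z i j)).
    exact: (polyfun_var (@id ('I_(n * n + m) -> F))).
  have [p pE] := Kpoly s; rewrite (funext (fun z => pE (xx z))).
  by apply: (fs_meval H) => i; exact: (polyfun_var (@id ('I_(n * n + m) -> F))).
- move=> mu [x /orbit_adjact[h hu ->]].
  pose z i := match split i with inl k => mxvec h 0 k | inr k => x k end.
  exists z => //; congr adjact.
    by apply/matrixP => i j; rewrite hhE /z (unsplitK (inl _)) mxvecE.
  by congr K; apply/funext => i; rewrite /xx /z (unsplitK (inr _)).
Qed.

End OrbitFamily.

(** The ideal of an irreducible set is prime. *)
Lemma irreducible_afunM Z f g : irreducible_set Z -> afun f -> afun g ->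
  (forall mu, Z mu -> f mu * g mu = 0) ->
  (forall mu, Z mu -> f mu = 0) \/ (forall mu, Z mu -> g mu = 0).
Proof.
move=> [_ Zi] fa ga fg.
have cl (h : algstr F n -> F) : afun h -> closed [set mu | h mu = 0].
  move=> ha; have := @closed_zeros F n unit (fun=> h) (fun=> ha); congr closed.
  by apply/seteqP; split=> nu /=; [apply | move=> ->].
apply: (Zi _ _ (cl f fa) (cl g ga)) => mu Zmu.
by have /eqP := fg mu Zmu; rewrite mulf_eq0 => /orP[] /eqP; [left | right].
Qed.

Definition indep_on (Z : set (algstr F n)) (S : finType) (u : S -> {mpoly F[ncoord n]}) :=
  forall c : S -> F,
  (forall mu, Z mu -> \sum_s c s * (u s).@[coords mu] = 0) -> forall s, c s = 0.

(* If g vanishes on Z but not on the irreducible set Z', a relation between the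
   u_s g^j on Z' can be divided by its lowest power of g, and then restricts to
   a relation between the u_s on Z. *)
Lemma indep_on_powers Z Z' (S : finType) (u : S -> {mpoly F[ncoord n]}) g k :
  irreducible_set Z' -> Z `<=` Z' -> indep_on Z u ->
  (forall mu, Z mu -> g.@[coords mu] = 0) ->
  (exists2 mu, Z' mu & g.@[coords mu] != 0) ->
  indep_on Z' (fun sj : S * 'I_k => u sj.1 * g ^+ sj.2).
Proof.
move=> Zi ZZ' uZ gZ [mu0 Zmu0 gmu0] c c0.
suff H N : forall s (j : 'I_k), (j < N)%N -> c (s, j) = 0.
  by case=> s j; apply: (H k).
elim: N => // N IH s j; rewrite ltnS leq_eqVlt => /orP[/eqP jN|]; last exact: IH.
(* The subtraction in the exponent is truncated, but the terms with [sj.2 < N] have coefficient zero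
   by [IH]. *)
have meval_sum mu : \sum_sj c sj * (u sj.1 * g ^+ sj.2).@[coords mu] =
    g.@[coords mu] ^+ N * \sum_sj c sj * (u sj.1 * g ^+ (sj.2 - N)).@[coords mu].
  rewrite mulr_sumr; apply: eq_bigr => -[s' j'] _ /=.
  have [j'N|Nj'] := ltnP j' N; first by rewrite IH // !mul0r mulr0.
  by rewrite !mevalM !rmorphXn /= -{1}(subnK Nj') exprD; ring.
pose fN mu := g.@[coords mu] ^+ N.
pose fR mu := \sum_(sj : S * 'I_k) c sj * (u sj.1 * g ^+ (sj.2 - N)).@[coords mu].
have fNa : afun fN.
  exists (g ^+ N) => mu; by rewrite rmorphXn.
have fRa : afun fR.
  apply: (fs_sum (afun_subalg F n)) => sj; apply: (fsM (afun_subalg F n)).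
    exact: (fsC (afun_subalg F n)).
  by exists (u sj.1 * g ^+ (sj.2 - N)).
have [|fN0|fR0] := irreducible_afunM Zi fNa fRa.
- by move=> mu Zmu; rewrite -meval_sum c0.
- by have /eqP := fN0 _ Zmu0; rewrite expf_eq0 (negbTE gmu0) andbF.
move: s; apply: uZ => mu Zmu; have := fR0 mu (ZZ' _ Zmu).
have -> : fR mu = \sum_s \sum_(j' < k) c (s, j') * (u s * g ^+ (j' - N)).@[coords mu].
  by rewrite /fR pair_bigA; apply: eq_bigr => -[].
move=> R0; rewrite -[RHS]R0; apply: eq_bigr => s _; rewrite (bigD1 j) //= jN subnn mulr1 big1 ?addr0 //.
move=> j' j'j; have [j'N|] := ltnP j' N; first by rewrite IH // mul0r.
rewrite leq_eqVlt => /orP[/eqP Nj'|Nj'].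
  by case/negP: j'j; apply/eqP/val_inj; rewrite /= jN.
rewrite mevalM rmorphXn /= gZ // expr0n subn_eq0 leqNgt Nj' /=.
by rewrite !mulr0.
Qed.

Lemma msizeM_leS d (p q : {mpoly F[d]}) a b :
  (msize p <= a.+1)%N -> (msize q <= b.+1)%N -> (msize (p * q) <= (a + b).+1)%N.
Proof.
move=> pa qb; have [->|p0] := eqVneq p 0; first by rewrite mul0r msize0.
have [->|q0] := eqVneq q 0; first by rewrite mulr0 msize0.
rewrite msizeM //; apply: (@leq_trans (a.+1 + b.+1).-1).
  by rewrite -!subn1 leq_sub2r // leq_add.
by rewrite addnS addSn.
Qed.

Lemma leq_expn2r a b e : (a <= b)%N -> (a ^ e <= b ^ e)%N.
Proof. by move=> ab; case: e => // e; rewrite leq_exp2r. Qed.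

(** It matters that [D] does not depend on [k]: after substitution of the parametrization the
    degrees grow linearly in [k], whereas the number of functions is [k ^ m]. *)
Lemma indep_on_chain d (lq : (ncoord n).-tuple {mpoly F[d]}) (Z : nat -> set (algstr F n)) m :
  (forall i, (i <= m)%N -> irreducible_set (Z i)) ->
  (forall i, (i < m)%N -> Z i `<=` Z i.+1 /\ exists g : {mpoly F[ncoord n]},
     (forall mu, Z i mu -> g.@[coords mu] = 0) /\
     exists2 mu, Z i.+1 mu & g.@[coords mu] != 0) ->
  exists D, forall k, exists (S : finType) (u : S -> {mpoly F[ncoord n]}),
    [/\ #|S| = (k ^ m)%N, indep_on (Z m) u
      & forall s, (msize (u s \mPo lq) <= (k * D).+1)%N].
Proof.
elim: m => [|m IH] Zi Zg.
  exists 0%N => k; exists unit, (fun=> 1); split; first by rewrite card_unit.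
    have [[mu Zmu] _] := Zi 0%N isT.
    move=> c /(_ mu Zmu) H [].
    by have := H; rewrite (big_pred1 tt) ?meval1 ?mulr1 // => -[].
  by move=> _; rewrite rmorph1 msize1.
have [|i im|D HD] := IH.
- by move=> i im; apply: Zi; apply: leqW.
- by apply: Zg; apply: leqW.
have [ZZ' [g [gZ gZ']]] := Zg m (leqnn _).
exists (D + msize (g \mPo lq))%N => k; have [S [u [Sk uZ uD]]] := HD k.
exists (S * 'I_k)%type, (fun sj : S * 'I_k => u sj.1 * g ^+ sj.2); split.
- by rewrite card_prod card_ord Sk expnSr.
- by apply: (indep_on_powers (Z := Z m)) => //; apply: Zi.
case=> s [j jk] /=; rewrite rmorphM rmorphXn /=.
set G := g \mPo lq; have Gj i : (msize (G ^+ i) <= (i * msize G).+1)%N.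
  elim: i => [|i IHi]; first by rewrite expr0 msize1.
  by rewrite exprS mulSn; apply: msizeM_leS.
apply: leq_trans (msizeM_leS (uD s) (Gj j)) _.
by rewrite ltnS mulnDr leq_add2l leq_mul2r (ltnW jk) orbT.
Qed.

(** There are N^d monomials with all exponents below N. With more functions than that, a nontrivial
    combination would vanish identically after substitution, hence on the range of [Psi] and on its
    closure. *)
Lemma indep_card_le d (Psi : ('I_d -> F) -> algstr F n)
    (lq : (ncoord n).-tuple {mpoly F[d]}) (Z : set (algstr F n)) (S : finType)
    (u : S -> {mpoly F[ncoord n]}) N :
  (forall x t, coords (Psi x) t = (tnth lq t).@[x]) ->
  Z `<=` closure (range Psi) -> indep_on Z u ->
  (forall s, (msize (u s \mPo lq) <= N)%N) -> (#|S| <= N ^ d)%N.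
Proof.
move=> lqE ZPsi uZ uN; rewrite leqNgt; apply/negP => SN.
pose B := {ffun 'I_d -> 'I_N}.
have cB : #|B| = (N ^ d)%N by rewrite card_ffun !card_ord.
pose mn (b : B) : 'X_{1..d} := [multinom (b i : nat) | i < d].
pose M : 'M[F]_(#|S|, #|B|) :=
  \matrix_(s, b) (u (enum_val s) \mPo lq)@_(mn (enum_val b)).
have /rowV0Pn[r /sub_kermxP rM r0] : kermx M != 0.
  rewrite -mxrank_eq0 mxrank_ker subn_eq0 -ltnNge.
  by apply: leq_ltn_trans (rank_leq_col M) _; rewrite cB.
have rE (P : \sum_(s : S) r 0 (enum_rank s) *: (u s \mPo lq) = 0) : False.
  case/negP: r0; apply/eqP/rowP => i; rewrite mxE.
  rewrite -(enum_valK i); apply: (uZ (fun s => r 0 (enum_rank s))) => mu Zmu.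
  have /in_closureP/(_ (fun nu => \sum_s r 0 (enum_rank s) * (u s).@[coords nu])) :=
    ZPsi _ Zmu.
  apply=> [|_ [x _ <-]].
    apply: (fs_sum (afun_subalg F n)) => s; apply: (fsM (afun_subalg F n)).
      exact: (fsC (afun_subalg F n)).
    by exists (u s).
  have := congr1 (meval x) P; rewrite meval0 raddf_sum /= => P0; rewrite -[RHS]P0.
  apply: eq_bigr => s _; rewrite mevalZ comp_mpoly_meval.
  by congr (_ * _); apply: meval_eq => t; rewrite lqE.
apply: rE; apply/mpolyP => m; rewrite mcoeff0 raddf_sum /=.
have [mN|Nm] := ltnP (mdeg m) N; last first.
  apply: big1 => s _; rewrite mcoeffZ memN_msupp_eq0 ?mulr0 //.
  by apply: msize_mdeg_ge; apply: leq_trans Nm.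
have miN i : (m i < N)%N.
  by apply: leq_ltn_trans mN; rewrite mdegE (bigD1 i) //= leq_addr.
pose b : B := [ffun i => Ordinal (miN i)].
have mE : m = mn b by apply/mnmP => i; rewrite mnmE ffunE.
have := congr1 (fun A : 'rV_ _ => A 0 (enum_rank b)) rM; rewrite !mxE => rM0; rewrite -[RHS]rM0.
rewrite (reindex (@enum_val S predT)) /=; last exact/onW_bij/enum_val_bij.
by apply: eq_bigr => i _; rewrite enum_valK mcoeffZ mE !mxE enum_rankK.
Qed.

(* If m > d, then k ^ m independent functions would live in a space of
   dimension at most (k D + 1) ^ d, which is impossible for large k. *)
Lemma chain_length_le d (Psi : ('I_d -> F) -> algstr F n) A m (Z : nat -> set _) :
  polymap Psi -> irreducible_chain A m Z -> Z m `<=` closure (range Psi) ->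
  (m <= d)%N.
Proof.
move=> Psip [ZA Zlt] Zm.
have /choice[q qE] : forall t, exists p : {mpoly F[d]}, forall x, coords (Psi x) t = p.@[x].
  by move=> t; apply: Psip.
pose lq := [tuple q i | i < ncoord n].
have lqE x t : coords (Psi x) t = (tnth lq t).@[x] by rewrite tnth_mktuple.
have [|i im|D HD] := indep_on_chain lq (Z := Z) (m := m).
- by move=> i /ZA[].
(* [Z i] is closed only relative to [A]. The separating polynomial is taken from a closed set [V] of
   the whole space with the same trace on [A]. *)
- have [sub nsub] := Zlt i im; split=> //.
  have [ZiA _ /closed_subspaceP[V cV VA]] := ZA i (ltnW im).
  have [ZSA _ _] := ZA i.+1 im.
  have ZiV nu : Z i nu -> V nu.
    by move=> Zn; have [] // : (V `&` A) nu by rewrite VA; split=> //; apply: ZiA.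
  have /existsNP[mu /not_implyP[Zmu nZmu]] := nsub.
  have nV : (~` V) mu.
    move=> Vmu; apply: nZmu.
    by have [] // : (Z i `&` A) mu by rewrite -VA; split=> //; apply: ZSA.
  have [f [[p pE] fmu fV]] := open_nbhs_afun (closed_openC cV) nV.
  exists p; split=> [nu /ZiV Vnu|]; last by exists mu; rewrite -?pE.
  by apply/eqP; apply: contraT; rewrite -pE => /fV.
rewrite leqNgt; apply/negP => dm.
(* As k exceeds (D+1)^d, one gets (k D + 1)^d <= k^d (D+1)^d < k^(d+1) <= k^m. *)
set k := (D.+1 ^ d).+1; have [S [u [Sk uZ uD]]] := HD k.
have := indep_card_le lqE Zm uZ uD; rewrite Sk.
have k0 : (0 < k)%N by [].
apply/negP; rewrite -ltnNge.
have kD : ((k * D).+1 <= k * D.+1)%N by rewrite mulnS -add1n leq_add2r.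
apply: leq_ltn_trans (leq_expn2r d kD) _.
rewrite expnMn; apply: leq_trans (leq_pexp2l k0 dm).
by rewrite expnSr ltn_pmul2l ?expn_gt0.
Qed.



End Families.

(** * Three-dimensional tables *)

Definition scal01 (R : nzRingType) := (@mul0r R, @mulr0 R, @mul1r R, @mulr1 R,
  @subr0 R, @addr0 R, @sub0r R, @add0r R, @oppr0 R).

(** Used to deduce an equation from a hypothesis: once the hypothesis is scaled by the right
    constant, only a ring identity is left. *)
Lemma eq_via_sub (V : zmodType) (l r x y : V) : l = r -> x - y = l - r -> x = y.
Proof. by move=> ->; rewrite subrr => /eqP; rewrite subr_eq0 => /eqP. Qed.

Section Coordinates.
Variable F : fieldType.
Implicit Types (x y : 'cV[F]_3).

Definition o0 : 'I_3 := @Ordinal 3 0 isT.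
Definition o1 : 'I_3 := @Ordinal 3 1 isT.
Definition o2 : 'I_3 := @Ordinal 3 2 isT.

Lemma ord3P (P : 'I_3 -> Prop) : P o0 -> P o1 -> P o2 -> forall i, P i.
Proof.
by move=> P0 P1 P2 [[|[|[|i]]] Hi] //;
  [move: P0 | move: P1 | move: P2]; congr P; apply: val_inj.
Qed.

Lemma cvDE x y k : (x + y) k 0 = x k 0 + y k 0. Proof. by rewrite mxE. Qed.
Lemma cvNE x k : (- x) k 0 = - x k 0. Proof. by rewrite mxE. Qed.
Lemma cvZE c x k : (c *: x) k 0 = c * x k 0. Proof. by rewrite mxE. Qed.
Lemma cv0E k : (0 : 'cV[F]_3) k 0 = 0. Proof. by rewrite mxE. Qed.
Lemma cv1E k : (e1 F) k 0 = (k == o0)%:R. Proof. by rewrite mxE andbT. Qed.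
Lemma cv2E k : (e2 F) k 0 = (k == o1)%:R. Proof. by rewrite mxE andbT. Qed.
Lemma cv3E k : (e3 F) k 0 = (k == o2)%:R. Proof. by rewrite mxE andbT. Qed.
Definition cvE := (cvDE, cvNE, cvZE, cv0E, cv1E, cv2E, cv3E).

End Coordinates.

Ltac vring := let k := fresh "k" in apply/colP => k; rewrite ?cvE; ring.
Ltac vfield := let k := fresh "k" in apply/colP => k; rewrite ?cvE; field.

Section Dim3.
Variable F : fieldType.
Implicit Types (u v w x y z : 'cV[F]_3) (mu : algstr F 3).

Lemma colP3 x y : x o0 0 = y o0 0 -> x o1 0 = y o1 0 -> x o2 0 = y o2 0 -> x = y.
Proof. by move=> *; apply/colP; apply: ord3P. Qed.

Lemma vecE x : x = x o0 0 *: e1 F + x o1 0 *: e2 F + x o2 0 *: e3 F.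
Proof. by apply: colP3; rewrite !cvE /=; ring. Qed.

Definition frame u v w : 'M[F]_3 :=
  \matrix_(i, j) (match (j : nat) with 0%N => u | 1%N => v | _ => w end) i 0.

Lemma frameE u v w x :
  frame u v w *m x = x o0 0 *: u + x o1 0 *: v + x o2 0 *: w.
Proof.
apply/colP => k; rewrite mxE !big_ord_recl big_ord0 addr0 !mxE /= !addrA.
have -> : ord0 = o0 by apply: val_inj.
have -> : lift o0 (ord0 : 'I_2) = o1 by apply: val_inj.
have -> : lift o0 (lift ord0 (ord0 : 'I_1)) = o2 by apply: val_inj.
by ring.
Qed.

Definition free2 u v := forall a b : F, a *: u + b *: v = 0 -> a = 0 /\ b = 0.
Definition free3 u v w := frame u v w \in unitmx.

Lemma free3P u v w : free3 u v w <->
  forall a b c : F, a *: u + b *: v + c *: w = 0 -> [/\ a = 0, b = 0 & c = 0].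
Proof.
split=> [uvw a b c abc|H].
  pose x := a *: e1 F + b *: e2 F + c *: e3 F.
  have x0 : x = 0.
    rewrite -(mulKmx uvw x) frameE /x !cvE /=.
    rewrite !(mulr1, mulr0, addr0, add0r) abc mulmx0 //.
  have xE k : x k 0 = 0 by rewrite x0 mxE.
  by split; [rewrite -(xE o0) | rewrite -(xE o1) | rewrite -(xE o2)];
    rewrite /x !cvE /=; ring.
rewrite /free3 -unitmx_tr -row_free_unit; apply: inj_row_free => r.
move=> /(congr1 trmx); rewrite trmx_mul trmxK trmx0 frameE => /H[r0 r1 r2].
by apply: trmx_inj; apply: colP3; rewrite ?trmx0 !cv0E.
Qed.

Lemma free3_span u v w x : free3 u v w ->
  exists a b c, x = a *: u + b *: v + c *: w.
Proof.
move=> uvw; rewrite -(mulKVmx uvw x) frameE.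
by do 3!eexists.
Qed.

Lemma free3_coord u v w a b c a' b' c' : free3 u v w ->
  a *: u + b *: v + c *: w = a' *: u + b' *: v + c' *: w ->
  [/\ a = a', b = b' & c = c'].
Proof.
move=> /free3P H E; have [|a0 b0 c0] := H (a - a') (b - b') (c - c').
  by apply: (eq_via_sub E); vring.
by split; apply/eqP; rewrite -subr_eq0; apply/eqP.
Qed.


Lemma e1_neq0 : e1 F != 0.
Proof. by apply/eqP => /colP/(_ o0); rewrite !cvE /= => /eqP; rewrite oner_eq0. Qed.

Lemma nfree2 u v : u != 0 -> ~ free2 u v -> exists a, v = a *: u.
Proof.
move=> u0 /existsNP[a /existsNP[b /not_implyP[ab nab]]].
have [b0|b0] := eqVneq b 0.
  case: nab; split=> //; move/eqP: ab.
  by rewrite b0 scale0r addr0 scaler_eq0 (negbTE u0) orbF => /eqP.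
exists (- a / b); apply: (eq_via_sub (congr1 (fun x => b^-1 *: x) ab)).
by apply/colP => k; rewrite !cvE; field.
Qed.

Lemma nfree3 u v w : free2 u v -> ~ free3 u v w -> exists a b, w = a *: u + b *: v.
Proof.
move=> uv /free3P /existsNP[a /existsNP[b /existsNP[c /not_implyP[abc nabc]]]].
have [c0|c0] := eqVneq c 0.
  have [|a0 b0] := uv a b; last by case: nabc.
  by move: abc; rewrite c0 scale0r addr0.
exists (- a / c), (- b / c); apply: (eq_via_sub (congr1 (fun x => c^-1 *: x) abc)).
by apply/colP => k; rewrite !cvE; field.
Qed.

Lemma free2_neq0 u v : free2 u v -> u != 0 /\ v != 0.
Proof.
move=> uv; split; apply/eqP => E.
  by have [|/eqP] := uv 1 0; rewrite ?oner_eq0 // E scaler0 scale0r addr0.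
by have [|_ /eqP] := uv 0 1; rewrite ?oner_eq0 // E scaler0 scale0r addr0.
Qed.

Lemma rank_span k (f : 'I_k -> 'cV[F]_3) : (k < 3)%N ->
  (forall x, exists c : 'I_k -> F, x = \sum_i c i *: f i) -> False.
Proof.
move=> k3 H; pose M : 'M[F]_(k, 3) := \matrix_(i, j) f i j 0.
have : (1%:M <= M)%MS.
  apply/row_subP => i; have [c cE] := H (delta_mx i 0).
  apply/submxP; exists (\row_j c j); apply/rowP => j.
  have := congr1 (fun x : 'cV_3 => x j 0) cE; rewrite !mxE summxE andbT eq_sym => ->.
  by apply: eq_bigr => l _; rewrite !mxE.
by move/mxrankS; rewrite mxrank1 leqNgt (leq_ltn_trans (rank_leq_row _) k3).
Qed.

Lemma free2_ext u : u != 0 -> exists v, free2 u v.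
Proof.
move=> u0; apply: contrapT => /forallNP H.
apply: (@rank_span 1 (fun=> u)) => // x.
by have [a ->] := nfree2 u0 (H x); exists (fun=> a); rewrite big_ord1.
Qed.

Lemma free3_ext u v : free2 u v -> exists w, free3 u v w.
Proof.
move=> uv; apply: contrapT => /forallNP H.
apply: (@rank_span 2 (fun i => if i == ord0 then u else v)) => // x.
have [a [b ->]] := nfree3 uv (H x).
by exists (fun i => if i == ord0 then a else b); rewrite !big_ord_recl big_ord0 addr0.
Qed.

Lemma free3_swap12 u v w : free3 u v w -> free3 v u w.
Proof.
move=> /free3P H; apply/free3P => a b c E.
by have [|-> -> ->] := H b a c; first by rewrite -E [_ + b *: u]addrC.
Qed.

Lemma free3_swap23 u v w : free3 u v w -> free3 u w v.
Proof.
move=> /free3P H; apply/free3P => a b c E.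
by have [|-> -> ->] := H a c b; first by rewrite -E addrAC.
Qed.

Lemma free3_free2 u v w : free3 u v w -> free2 u v.
Proof.
move=> /free3P H a b E; have [|-> -> //] := H a b 0.
by rewrite E scale0r addr0.
Qed.

Lemma frame_e1 u v w : frame u v w *m e1 F = u.
Proof. by rewrite frameE !cvE /= scale1r !scale0r !addr0. Qed.
Lemma frame_e2 u v w : frame u v w *m e2 F = v.
Proof. by rewrite frameE !cvE /= scale1r !scale0r add0r addr0. Qed.
Lemma frame_e3 u v w : frame u v w *m e3 F = w.
Proof. by rewrite frameE !cvE /= scale1r !scale0r !add0r. Qed.

Definition frame_simp := (frame_e1, frame_e2, frame_e3, @mulmxDr F, @mulmx0 F).

Section Table.
Variables p11 p22 p33 p12 p13 p23 : 'cV[F]_3.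
Local Notation K := (commalg3 p11 p22 p33 p12 p13 p23).

Lemma commalg3E :
  [/\ amul K (e1 F) (e1 F) = p11, amul K (e2 F) (e2 F) = p22,
      amul K (e3 F) (e3 F) = p33 &
  [/\ amul K (e1 F) (e2 F) = p12, amul K (e1 F) (e3 F) = p13 & 
      amul K (e2 F) (e3 F) = p23] /\
  [/\ amul K (e2 F) (e1 F) = p12, amul K (e3 F) (e1 F) = p13 & 
      amul K (e3 F) (e2 F) = p23]].
Proof. by do !split; apply/colP => k; rewrite amul_delta ffunE. Qed.

Lemma amul_commalg3 x y : amul K x y =
  (x o0 0 * y o0 0) *: p11 + (x o1 0 * y o1 0) *: p22 + (x o2 0 * y o2 0) *: p33 +
  (x o0 0 * y o1 0 + x o1 0 * y o0 0) *: p12 +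
  (x o0 0 * y o2 0 + x o2 0 * y o0 0) *: p13 +
  (x o1 0 * y o2 0 + x o2 0 * y o1 0) *: p23.
Proof.
have [E11 E22 E33 [[E12 E13 E23] [E21 E31 E32]]] := commalg3E.
rewrite {1}(vecE x) {1}(vecE y) !(amulDl, amulDr, amulZl, amulZr).
rewrite E11 E22 E33 E12 E13 E23 E21 E31 E32.
by vring.
Qed.

Lemma commalg3_comm : acommutative K.
Proof. by move=> x y; rewrite !amul_commalg3; vring. Qed.

(** A basis in which [mu] has a given table is the same thing as an isomorphism. Orbit statements
    about tables are reduced to exhibiting such a basis. *)
Lemma table_orbit mu u v w : acommutative mu -> free3 u v w ->
  amul mu u u = frame u v w *m p11 -> amul mu v v = frame u v w *m p22 ->
  amul mu w w = frame u v w *m p33 -> amul mu u v = frame u v w *m p12 ->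
  amul mu u w = frame u v w *m p13 -> amul mu v w = frame u v w *m p23 ->
  GLorbit K mu.
Proof.
move=> muC uvw E11 E22 E33 E12 E13 E23; exists (frame u v w) => //.
have [D11 D22 D33 [[D12 D13 D23] [D21 D31 D32]]] := commalg3E.
symmetry; apply: gact_basis => //.
by apply: ord3P; apply: ord3P; rewrite -/(e1 F) -/(e2 F) -/(e3 F)
  !frame_simp ?(D11, D22, D33, D12, D13, D23, D21, D31, D32)
  ?(muC v u) ?(muC w u) ?(muC w v).
Qed.

End Table.

Lemma commalg3_orbit u v w p11 p22 p33 p12 p13 p23 q11 q22 q33 q12 q13 q23 :
  let K := commalg3 p11 p22 p33 p12 p13 p23 in let f := frame u v w in free3 u v w ->
  amul K u u = f *m q11 -> amul K v v = f *m q22 -> amul K w w = f *m q33 ->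
  amul K u v = f *m q12 -> amul K u w = f *m q13 -> amul K v w = f *m q23 ->
  GLorbit (commalg3 q11 q22 q33 q12 q13 q23) K.
Proof. exact/table_orbit/commalg3_comm. Qed.

End Dim3.

(** * Jordan algebras of dimension three *)

Section Determinant.
Variable F : fieldType.

Lemma det3 (M : 'M[F]_3) : \det M =
  M o0 o0 * (M o1 o1 * M o2 o2 - M o1 o2 * M o2 o1) -
  M o0 o1 * (M o1 o0 * M o2 o2 - M o1 o2 * M o2 o0) +
  M o0 o2 * (M o1 o0 * M o2 o1 - M o1 o1 * M o2 o0).
Proof.
have L i j : lift i j = match (i : nat), (j : nat) with
    | 0, 0 => o1 | 0, _ => o2 | 1, 0 => o0 | 1, _ => o2 | _, 0 => o0 | _, _ => o1
    end%N :> 'I_3.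
  by case: i => [[|[|[|i]]] //= Hi]; case: j => [[|[|j]] //= Hj]; apply: val_inj.
rewrite (expand_det_row _ o0) !big_ord_recl big_ord0 addr0.
rewrite /cofactor !(expand_det_row _ ord0) !big_ord_recl !big_ord0 !addr0.
rewrite /cofactor !det_mx11 !mxE !L /=.
have -> : ord0 = o0 by apply: val_inj.
by rewrite /bump /=; ring.
Qed.

Lemma free3_det (u v w u' v' w' : 'cV[F]_3) a1 b1 c1 a2 b2 c2 a3 b3 c3 :
  free3 u v w -> u' = a1 *: u + b1 *: v + c1 *: w ->
  v' = a2 *: u + b2 *: v + c2 *: w -> w' = a3 *: u + b3 *: v + c3 *: w ->
  a1 * (b2 * c3 - b3 * c2) - b1 * (a2 * c3 - a3 * c2) + c1 * (a2 * b3 - a3 * b2) != 0 ->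
  free3 u' v' w'.
Proof.
move=> uvw E1 E2 E3 d0.
pose C := frame (a1 *: e1 F + b1 *: e2 F + c1 *: e3 F)
  (a2 *: e1 F + b2 *: e2 F + c2 *: e3 F) (a3 *: e1 F + b3 *: e2 F + c3 *: e3 F).
have CE : frame u' v' w' = frame u v w *m C.
  apply/matrixP => i j.
  have entE (M : 'M[F]_3) : M i j = (M *m (delta_mx j 0 : 'cV_3)) i 0.
    by rewrite -colE mxE.
  rewrite !entE -mulmxA; elim/ord3P: j {entE};
    rewrite -/(e1 F) -/(e2 F) -/(e3 F) !frame_simp ?(E1, E2, E3) -?scalemxAr ?frame_simp //.
rewrite /free3 CE unitmx_mul [X in X && _]uvw unitmxE unitfE det3 !mxE /=.
move: d0; apply: contraNN => /eqP d0; apply/eqP; rewrite -[RHS]d0; ring.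
Qed.

End Determinant.

Section JordanAlgebra.
Variables (F : numClosedFieldType) (mu : algstr F 3).
Local Notation "x ** y" := (amul mu x y) (at level 40, left associativity).
Local Notation half := (2%:R^-1 : F).
Implicit Types (x y z u v w e : 'cV[F]_3).

(** The condition A^2 = A in dual form. It follows at once from a nonzero determinant of three
    products, and its failure directly provides a plane containing all products. *)
Definition full := forall l : 'rV[F]_3, (forall x y, l *m (x ** y) = 0) -> l = 0.
Definition jordan := forall x y, ((x ** x) ** y) ** x = (x ** x) ** (y ** x).

Hypotheses (muC : acommutative mu) (muJ : jordan).

Definition bilE := (@amulDl F 3, @amulDr F 3, @amulZl F 3, @amulZr F 3,
  @amulNl F 3, @amulNr F 3, @amul0l F 3, @amul0r F 3).

Lemma two_neq0 : 2%:R != 0 :> F. Proof. by rewrite pnatr_eq0. Qed.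

(** The part of the Jordan identity of degree two in x and one in y: half the difference of the
    identities at x + y and x - y, minus the identity at y. *)
Lemma jordan_lin x y z :
  2%:R *: (((x ** y) ** z) ** x) + ((x ** x) ** z) ** y =
  2%:R *: ((x ** y) ** (z ** x)) + (x ** x) ** (z ** y).
Proof.
have E1 := muJ (x + y) z; have E2 := muJ (x - y) z; have E3 := muJ y z.
have E : half *: ((((x + y) ** (x + y)) ** z) ** (x + y) -
   (((x - y) ** (x - y)) ** z) ** (x - y)) - ((y ** y) ** z) ** y =
  half *: (((x + y) ** (x + y)) ** (z ** (x + y)) -
   ((x - y) ** (x - y)) ** (z ** (x - y))) - (y ** y) ** (z ** y).
  by rewrite E1 E2 E3.
apply: (eq_via_sub E); rewrite !bilE (muC y x).
by vfield.
Qed.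

(** Multiplication by an idempotent is annihilated by t (2 t - 1) (t - 1). *)
Lemma peirce_poly e y : e ** e = e ->
  2%:R *: (e ** (e ** (e ** y))) + e ** y = 3%:R *: (e ** (e ** y)).
Proof.
move=> ee; have E := jordan_lin e y e.
rewrite !ee !(muC _ e) in E.
by apply: (eq_via_sub E); vring.
Qed.

Lemma peirce_eigenvalue e y c : e ** e = e -> y != 0 -> e ** y = c *: y ->
  [\/ c = 0, c = half | c = 1].
Proof.
move=> ee y0 ey; have := peirce_poly y ee.
rewrite !(ey, amulZr) => E.
have /eqP : (c * (2%:R * c - 1) * (c - 1)) *: y = 0.
  by apply: (eq_via_sub E); vring.
rewrite scaler_eq0 (negbTE y0) orbF !mulf_eq0 !subr_eq0 => /orP[/orP[]|] /eqP cE.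
- by constructor 1.
- by constructor 2; rewrite -(mulKf two_neq0 c) cE mulr1.
- by constructor 3.
Qed.

(** The linearized identity yields this multiplied by 2 i - 1, which is invertible for i = 0 and i =
    1. Applied in both orders it shows that the Peirce components for 0 and 1 annihilate each
    other. *)
Lemma peirce_mul e y z i j : e ** e = e -> e ** y = i *: y -> e ** z = j *: z ->
  i != half -> e ** (y ** z) = j *: (y ** z).
Proof.
move=> ee ey ez iN; have E := jordan_lin e y z.
rewrite ee ez ey (muC z e) ez !bilE (muC (y ** z)) (muC z) in E.
have i0 : 2%:R * i - 1 != 0.
  rewrite subr_eq0; apply: contraNneq iN => iE.
  by rewrite -(mulKf two_neq0 i) iE mulr1.
apply: (eq_via_sub (congr1 (fun x => (2%:R * i - 1)^-1 *: x) E)).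
by vfield.
Qed.

(** Hence y^2 has no Peirce component for 1/2, as 1/4 differs from 1/2. *)
Lemma peirce_half_sq e y : e ** e = e -> e ** y = half *: y ->
  e ** (e ** (y ** y)) = e ** (y ** y).
Proof.
move=> ee ey; have E := jordan_lin y e e.
rewrite (muC y e) ey ee !bilE ?ey ?(muC y) ?(muC _ e) ?ey !bilE in E.
by apply: (eq_via_sub E); vfield.
Qed.

Lemma peirce_half_cube e y : e ** y = half *: y ->
  ((y ** y) ** e) ** y = half *: ((y ** y) ** y).
Proof. by move=> ey; rewrite muJ ey amulZr. Qed.

Lemma nil_square w c v : w ** w = 0 -> v != 0 -> w ** v = c *: v -> c = 0.
Proof.
move=> ww v0 wv; have E := jordan_lin w v w.
rewrite ww wv !bilE (muC v) wv !bilE (muC v) wv in E.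
have /eqP : c ^+ 3 *: v = 0 by apply: (eq_via_sub (congr1 (fun x => half *: x) E)); vfield.
by rewrite scaler_eq0 (negbTE v0) orbF expf_eq0 => /eqP.
Qed.

Lemma not_full u v w : free3 u v w ->
  (forall x y, exists a b, x ** y = a *: u + b *: v) -> ~ full.
Proof.
move=> uvw H fl.
pose l : 'rV[F]_3 := delta_mx 0 o2 *m invmx (frame u v w).
have lE k : l *m (frame u v w *m k) = (k o2 0)%:M.
  by rewrite /l mulmxA mulmxKV // -rowE; apply/rowP => i; rewrite !ord1 !mxE eqxx.
have l0 : l = 0.
  apply: fl => x y; have [a [b ->]] := H x y.
  have -> : a *: u + b *: v = frame u v w *m (a *: e1 F + b *: e2 F).
    by rewrite !frame_simp -!scalemxAr !frame_simp.
  by rewrite lE !cvE /= !mulr0 addr0; apply/rowP => i; rewrite !ord1 !mxE mul0rn.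
have := lE (e3 F); rewrite l0 mul0mx cv3E eqxx => /rowP/(_ 0).
by rewrite !mxE eqxx => /esym/eqP; rewrite oner_eq0.
Qed.

Lemma not_full_table u v w : free3 u v w ->
  (exists a b, u ** u = a *: u + b *: v) -> (exists a b, v ** v = a *: u + b *: v) ->
  (exists a b, w ** w = a *: u + b *: v) -> (exists a b, u ** v = a *: u + b *: v) ->
  (exists a b, u ** w = a *: u + b *: v) -> (exists a b, v ** w = a *: u + b *: v) ->
  ~ full.
Proof.
move=> uvw [a1 [b1 E1]] [a2 [b2 E2]] [a3 [b3 E3]] [a4 [b4 E4]] [a5 [b5 E5]] [a6 [b6 E6]].
apply: (not_full uvw) => x y.
have [x1 [x2 [x3 ->]]] := free3_span x uvw.
have [y1 [y2 [y3 ->]]] := free3_span y uvw.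
rewrite !bilE (muC v u) (muC w u) (muC w v) E1 E2 E3 E4 E5 E6.
exists (x1 * y1 * a1 + x2 * y2 * a2 + x3 * y3 * a3 + (x1 * y2 + x2 * y1) * a4 +
  (x1 * y3 + x3 * y1) * a5 + (x2 * y3 + x3 * y2) * a6).
exists (x1 * y1 * b1 + x2 * y2 * b2 + x3 * y3 * b3 + (x1 * y2 + x2 * y1) * b4 +
  (x1 * y3 + x3 * y1) * b5 + (x2 * y3 + x3 * y2) * b6).
by vring.
Qed.

End JordanAlgebra.

(** * Normal forms of the Jordan algebras with A^2 = A *)

Section MoreTables.
Variable F : fieldType.
Local Notation half := (2%:R^-1 : F).
Local Notation vec a b c := (a *: e1 F + b *: e2 F + c *: e3 F).

(* Basis x, x^2, x^3 with x^4 = s1 x^3 - s2 x^2 + s3 x, where the s_i are the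
   elementary symmetric functions of a, b, c. *)
Definition tabpow (a b c : F) : algstr F 3 :=
  let s1 := a + b + c in let s2 := a * b + a * c + b * c in let s3 := a * b * c in
  let x4 := s3 *: e1 F - s2 *: e2 F + s1 *: e3 F in
  let x5 := s3 *: e2 F - s2 *: e3 F + s1 *: x4 in
  commalg3 (e2 F) x4 (s3 *: e3 F - s2 *: x4 + s1 *: x5) (e3 F) x4 x5.

(** The Jordan algebra of a symmetric bilinear form on the span of e2 and e3: e1 is the unit, and n,
    m, p are the entries of the Gram matrix. *)
Definition tabquad (n m p : F) : algstr F 3 :=
  commalg3 (e1 F) (n *: e1 F) (m *: e1 F) (e2 F) (e3 F) (p *: e1 F).

Definition tabhalf : algstr F 3 :=
  commalg3 (e1 F) (e3 F) 0 (half *: e2 F) 0 0.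

Definition tab16 (b : F) : algstr F 3 :=
  commalg3 (e1 F) (b *: e3 F) 0 (half *: e2 F) (e3 F) 0.

Definition jordan_type (mu : algstr F 3) :=
  [\/ exists a b c, GLorbit (tabpow a b c) mu,
      exists n m p, GLorbit (tabquad n m p) mu,
      GLorbit tabhalf mu |
  [\/ GLorbit (J14 F) mu, exists b, GLorbit (tab16 b) mu | GLorbit (J19 F) mu]].

End MoreTables.

(** * Algebras generated by one element, and unital algebras *)

Section Classification.
Variables (F : numClosedFieldType) (mu : algstr F 3).
Local Notation "x ** y" := (amul mu x y) (at level 40, left associativity).
Local Notation half := (2%:R^-1 : F).
Implicit Types (x y z u v w e : 'cV[F]_3).

Hypotheses (muC : acommutative mu) (muJ : jordan mu) (muF : full mu).

Lemma jordan_cyclic x : free3 x (x ** x) (x ** (x ** x)) ->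
  exists a b c, GLorbit (tabpow a b c) mu.
Proof.
set x2 := x ** x; set x3 := x ** x2 => fr.
have [al [be [ga x4E]]] := free3_span (x ** x3) fr.
(* a, b and ga - a - b will be the roots of T^3 - ga T^2 - be T - al. *)
have [a aE] : exists a : F, a ^+ 3 = ga * a ^+ 2 + be * a + al.
  have [a aE] := @solve_monicpoly F 3 (fun i => nth 0 [:: al; be; ga] i) isT.
  by exists a; rewrite aE !big_ord_recl big_ord0 /= /bump /=; ring.
have [b bE] : exists b : F, b ^+ 2 = (ga - a) * b - (a ^+ 2 - ga * a - be).
  have [b bE] := @solve_monicpoly F 2 (fun i => nth 0 [:: ga * a + be - a ^+ 2; ga - a] i) isT.
  by exists b; rewrite bE !big_ord_recl big_ord0 /= /bump /=; ring.
exists a, b, (ga - a - b).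
have gaE : ga = a + b + (ga - a - b) by ring.
have beE : be = - (a * b + a * (ga - a - b) + b * (ga - a - b)).
  by apply: (eq_via_sub (esym bE)); ring.
have alE : al = a * b * (ga - a - b).
  have E : a ^+ 3 - a * b ^+ 2 = ga * a ^+ 2 + be * a + al -
      a * ((ga - a) * b - (a ^+ 2 - ga * a - be)) by rewrite aE bE.
  by apply: (eq_via_sub (esym E)); ring.
(* Power associativity in the degrees that occur in the table: 4, 5 and 6. *)
have x22 : x2 ** x2 = x ** x3.
  by have := muJ x x; rewrite -/x2 (muC x2 x) -/x3 (muC x3 x) => <-.
have x23 : x2 ** x3 = x ** (x ** x3).
  by have := muJ x x2; rewrite -/x2 x22 (muC x2 x) -/x3 (muC (x ** x3) x) => <-.
have x33 : x3 ** x3 = x ** (x ** (x ** x3)).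
  have E := jordan_lin muC muJ x x2 x2.
  rewrite -/x2 -/x3 (muC x2 x) -/x3 x22 (muC x3 x2) x23 (muC (x ** x3) x2) (muC _ x) in E.
  apply: (eq_via_sub (congr1 (fun z => half *: z) (esym E))).
  by vfield.
set s3 := a * b * _ in alE *; set s1 := a + b + _ in gaE *.
set s2 := a * b + _ + _ in beE *.
have x4 : x ** x3 = s3 *: x - s2 *: x2 + s1 *: x3.
  by rewrite x4E {1}alE beE {1}gaE; vring.
apply: (table_orbit muC fr); rewrite ?x22 ?x23 ?x33 ?x4 !frame_simp -?scalemxAr
   ?frame_simp ?mulmxN -?scalemxAr ?frame_simp ?mulmxN -?scalemxAr ?frame_simp //.
- by rewrite !bilE -/x2 -/x3 x4 !bilE -/x2 -/x3 x4; vring.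
- by rewrite !bilE -/x2 -/x3 x4; vring.
Qed.

Definition noncyclic := forall x, ~ free3 x (x ** x) (x ** (x ** x)).

Hypothesis muN : noncyclic.

(** If u, x, x^2 were free, some x + s u would generate the algebra; so every x satisfies a
    quadratic equation over u. Completing the square makes v^2 and w^2 multiples of u, and the
    quadratic equations of v + w and v - w then force v w to be one too. *)
Lemma unital_quadratic u : u != 0 -> (forall x, u ** x = x) ->
  exists n m p, GLorbit (tabquad n m p) mu.
Proof.
move=> u0 uE; have uE' x : x ** u = x by rewrite muC.
have sq x : free2 u x -> exists a b, x ** x = a *: u + b *: x.
  move=> ux; apply: nfree3 => // fr.
  have [a [b [c x3]]] := free3_span (x ** (x ** x)) fr.
  (* This is the determinant of y, y^2, y^3 in the basis u, x, x^2, for y = x + s u. *)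
  have [s s0] : exists s : F, s ^+ 3 + c * s ^+ 2 - b * s + a != 0.
    have [|s] := @poly_nonroot F ('X^3 + c *: 'X^2 - b *: 'X + a%:P).
      apply/negP => /eqP/polyP/(_ 3); rewrite !(coefD, coefN, coefZ, coefXn, coefX, coefC) /=.
      by rewrite !mulr0 oppr0 !addr0 => /eqP; rewrite oner_eq0.
    by rewrite !hornerE => s0; exists s; rewrite !exprSr expr0 !mul1r in s0 *; rewrite !mulrA in s0 *.
  pose y := x + s *: u.
  have y2 : y ** y = s ^+ 2 *: u + (2%:R * s) *: x + 1 *: (x ** x).
    by rewrite /y !bilE !(uE, uE'); vring.
  have y3 : y ** (y ** y) = (s ^+ 3 + a) *: u + (3%:R * s ^+ 2 + b) *: x +
     (3%:R * s + c) *: (x ** x).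
    by rewrite y2 /y !bilE !(uE, uE') x3; vring.
  apply: (muN (x := y)); apply: (free3_det fr (a1 := s) (b1 := 1) (c1 := 0) _ y2 y3).
    by rewrite /y; vring.
  by move: s0; apply: contraNN => /eqP E; apply/eqP; rewrite -[RHS]E; ring.
have [v0 uv0] := free2_ext u0; have [w0 uvw0] := free3_ext uv0.
have shift x : free2 u x -> exists k n, (x + k *: u) ** (x + k *: u) = n *: u.
  move=> ux; have [a [b xx]] := sq x ux.
  exists (- b / 2%:R), (a + b ^+ 2 / 4%:R).
  by rewrite !bilE !uE !uE' xx; vfield.
have uw0 : free2 u w0 by apply: free3_free2 (free3_swap23 uvw0).
have [kv [n vv]] := shift v0 uv0; have [kw [m ww]] := shift w0 uw0.
set v := v0 + _ in vv; set w := w0 + _ in ww.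
have uvw : free3 u v w.
  apply: (free3_det uvw0 (a1 := 1) (b1 := 0) (c1 := 0) (a2 := kv) (b2 := 1) (c2 := 0)
    (a3 := kw) (b3 := 0) (c3 := 1)); rewrite /v /w; try vring.
  by rewrite !(mul1r, mulr0, mul0r, subr0, addr0, mulr1) oner_eq0.
clearbody v w; have [p [q [r vw]]] := free3_span (v ** w) uvw.
have frc s : s != 0 -> free2 u (v + s *: w).
  move=> s0 a b E; have [|a0 b0 _] := (free3P _ _ _).1 uvw a b (b * s); last by [].
  by rewrite -[RHS]E; vring.
have N1 : (-1 : F) != 0 by rewrite oppr_eq0 oner_eq0.
have [a [b E1]] := sq _ (frc 1 (oner_neq0 F)).
have [a' [b' E2]] := sq _ (frc (-1) N1).
rewrite !bilE (muC w v) vv ww vw in E1 E2.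
have [_ q1 r1] : [/\ n + m + 2%:R * p = a, 2%:R * q = b & 2%:R * r = b].
  by apply: (free3_coord uvw); apply: (eq_via_sub E1); vring.
have [_ q2 r2] : [/\ n + m - 2%:R * p = a', - (2%:R * q) = b' & - (2%:R * r) = - b'].
  by apply: (free3_coord uvw); apply: (eq_via_sub E2); vring.
have q0 : q = 0.
  have E3 : 2%:R * q = 2%:R * r by rewrite q1 r1.
  have E4 : 2%:R * q = - (2%:R * r).
    by rewrite r2 -q2 opprK.
  have /eqP : 4%:R * q = 0.
    by apply: (eq_via_sub (f_equal2 +%R E3 E4)); ring.
  by rewrite mulf_eq0 pnatr_eq0 => /eqP.
have r0 : r = 0.
  have /eqP : 2%:R * r = 0 by rewrite r1 -q1 q0 mulr0.
  by rewrite mulf_eq0 pnatr_eq0 => /eqP.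
exists n, m, p; apply: (table_orbit muC uvw);
  rewrite ?frame_simp -?scalemxAr ?frame_simp ?uE //.
by rewrite vw q0 r0; vring.
Qed.

End Classification.

(** * Idempotents and the Peirce decomposition *)

Section Peirce.
Variables (F : numClosedFieldType) (mu : algstr F 3).
Local Notation "x ** y" := (amul mu x y) (at level 40, left associativity).
Local Notation half := (2%:R^-1 : F).
Implicit Types (x y z u v w e : 'cV[F]_3).

Hypotheses (muC : acommutative mu) (muJ : jordan mu) (muF : full mu).
Hypothesis muN : noncyclic mu.

Lemma free3_zero u v w a b c : free3 u v w -> a *: u + b *: v + c *: w = 0 ->
  [/\ a = 0, b = 0 & c = 0].
Proof. by move/free3P; apply. Qed.

Lemma halfE : half + half = 1 :> F.
Proof. by field. Qed.

Lemma half_neq0 : half != 0 :> F.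
Proof. by rewrite invr_neq0 // two_neq0. Qed.

Lemma half_neq1 : half != 1 :> F.
Proof.
by apply/eqP => /(congr1 (fun c : F => 2%:R * c - 1)); rewrite mulfV ?two_neq0 // subrr;
  apply/eqP; rewrite eq_sym mulr1 addrK oner_neq0.
Qed.

(* In an idempotent-free algebra every element satisfies x^3 = 0; the
   linearizations of this identity then bound the dimension of A^2 by 2. *)
Lemma exists_idempotent : exists2 e, e != 0 & e ** e = e.
Proof.
apply: contrapT => nid.
have idem e : e ** e = e -> e = 0.
  by move=> ee; apply: contrapT => /eqP e0; apply: nid; exists e.
have cube x : x ** (x ** x) = 0.
  have [->|x0] := eqVneq x 0; first by rewrite amul0l.
  have [fr|nfr] := pselect (free2 x (x ** x)); last first.
    have [a xx] := nfree2 x0 nfr.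
    have [a0|a0] := eqVneq a 0; first by rewrite xx a0 scale0r amul0r.
    case/negP: x0; apply/eqP; have /eqP : a^-1 *: x = 0.
      by apply: idem; rewrite !bilE xx; vfield.
    by rewrite scaler_eq0 invr_eq0 (negbTE a0) => /eqP.
  have [a [b x3]] := nfree3 fr (muN (x := x)).
  have x4 : (x ** x) ** (x ** x) = a *: (x ** x) + b *: (x ** (x ** x)).
    by have := muJ x x; rewrite (muC (x ** x) x) x3 !bilE => <-;
      rewrite (muC (x ** x) x) x3.
  have [a0|a0] := eqVneq a 0.
    have [b0|b0] := eqVneq b 0; first by rewrite x3 a0 b0 !scale0r addr0.
    (* Here x^3 = b x^2, so x^2 x^2 = b^2 x^2 and the scaled square is idempotent. *)
    have /eqP : b ^- 2 *: (x ** x) = 0.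
      by apply: idem; rewrite !bilE x4 x3 a0; vfield.
    rewrite scaler_eq0 invr_eq0 expf_eq0 (negbTE b0) /= => /eqP xx.
    by case/free2_neq0: fr => _; rewrite xx eqxx.
  (* As x^3 = a x + b x^2, this is the unit of the subalgebra spanned by x and x^2. *)
  pose u := a^-1 *: (x ** x - b *: x).
  have ux : u ** x = x.
    by rewrite /u !bilE (muC (x ** x) x) x3; vfield.
  have uxx : u ** (x ** x) = x ** x.
    by rewrite /u !bilE x4; vfield.
  have uE : u = a^-1 *: (x ** x - b *: x) by [].
  have u0 : u = 0.
    by clearbody u; apply: idem; rewrite [X in u ** X]uE !bilE ux uxx -uE.
  by case/negP: x0; rewrite -ux u0 amul0l.
have cube_lin x y : (x ** x) ** y = - (2%:R *: (x ** (x ** y))).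
  have E1 := cube (x + y); have E2 := cube (x - y); have E3 := cube y.
  have E : half *: ((x + y) ** ((x + y) ** (x + y)) - (x - y) ** ((x - y) ** (x - y)))
     - y ** (y ** y) = 0 by rewrite E1 E2 E3; vring.
  apply: (eq_via_sub E); rewrite !bilE (muC y x) (muC y (x ** x)); by vfield.
have [[x x2]|/forallNP sq0] := pselect (exists x, x ** x != 0); last first.
  apply: (not_full (u := e1 F) (v := e2 F) (w := e3 F) (mu := mu)) => // [|x y].
    by apply/free3P => a b c E; split; [rewrite -[RHS](cv0E F o0) | rewrite -[RHS](cv0E F o1)
      | rewrite -[RHS](cv0E F o2)]; rewrite -E !cvE /=; ring.
  have sq z : z ** z = 0 by apply/eqP/negPn/negP/sq0.
  exists 0, 0; have E := sq (x + y); rewrite !bilE !sq (muC y x) in E.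
  by apply: (eq_via_sub (congr1 (fun z => half *: z) E)); vfield.
have x0 : x != 0 by apply: contraNneq x2 => ->; rewrite amul0l.
have [z sqx] : exists z, x ** x = z by exists (x ** x).
rewrite sqx in x2.
have xz : x ** z = 0 by rewrite -sqx.
have zz : z ** z = 0 by rewrite -{1}sqx cube_lin xz amul0r scaler0 oppr0.
have fxz : free2 x z.
  apply: contrapT => nfr; have [s zE] := nfree2 x0 nfr.
  have /eqP : s *: z = 0 by rewrite -xz [in RHS]zE amulZr sqx.
  rewrite scaler_eq0 (negbTE x2) orbF => /eqP s0.
  by move: x2; rewrite zE s0 scale0r eqxx.
(* In the basis x, z = x^2, y the linearized cubic identity and y^3 = 0 will force a = c = r = 0.
   Then all products lie in the span of z and x, against [muF]. *)
have [y fr] := free3_ext fxz.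
have [a [b [c xy]]] := free3_span (x ** y) fr.
have zy : z ** y = - (2%:R *: (a *: z + c *: (x ** y))).
  by rewrite -sqx cube_lin xy !bilE sqx xz xy; vring.
have zzy : z ** (z ** y) = 0.
  have /eqP := cube_lin z y; rewrite zz amul0l eq_sym oppr_eq0 scaler_eq0.
  by rewrite (negbTE (two_neq0 F)) => /eqP.
have c2zy : c ^+ 2 *: (z ** y) = 0.
  have E := zzy; rewrite zy xy !bilE zz (muC z x) xz in E.
  by apply: (eq_via_sub (congr1 (fun z => - half *: z) E)); vfield.
have c0 : c = 0.
  have [//|c0] := eqVneq c 0.
  move/eqP: c2zy; rewrite scaler_eq0 expf_eq0 (negbTE c0) /= => /eqP zy0.
  have [|_ _ /eqP] := free3_zero (a := c * a) (b := a + c * b) (c := c ^+ 2) fr.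
    apply: (eq_via_sub (congr1 (fun z => - half *: z) (etrans (esym zy) zy0))).
    by rewrite xy; vfield.
  by rewrite expf_eq0 => /eqP.
have {c2zy zzy} zy' : z ** y = - (2%:R * a) *: z by rewrite zy c0; vring.
have [p [q [r yy]]] := free3_span (y ** y) fr.
have a_r : a * r = 4%:R * a ^+ 2.
  have E := cube_lin y z; rewrite yy (muC y z) zy' !bilE (muC y z) zy' xz zz in E.
  have /eqP : (a * r - 4%:R * a ^+ 2) *: z = 0.
    by apply: (eq_via_sub (congr1 (fun z => - half *: z) E)); vfield.
  by rewrite scaler_eq0 (negbTE x2) orbF subr_eq0 => /eqP.
have r0 : r = 0.
  have E := cube y; rewrite yy !bilE (muC y x) (muC y z) zy' xy c0 yy in E.
  have [|_ _ /eqP] := free3_zero (a := p * a + r * p)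
    (b := p * b - 2%:R * a * q + r * q) (c := r ^+ 2) fr.
    by apply: (eq_via_sub E); vring.
  by rewrite expf_eq0 => /eqP.
have a0 : a = 0.
  have /eqP : 4%:R * a ^+ 2 = 0 by rewrite -a_r r0 mulr0.
  by rewrite mulf_eq0 pnatr_eq0 expf_eq0 => /eqP.
rewrite a0 c0 r0 mulr0 oppr0 scale0r in xy zy' yy.
apply: (not_full_table muC (free3_swap12 fr)) => //.
- by exists 0, 0; rewrite zz !scale0r addr0.
- by exists 1, 0; rewrite sqx scale1r scale0r addr0.
- by exists q, p; rewrite yy; vring.
- by exists 0, 0; rewrite muC xz !scale0r addr0.
- by exists 0, 0; rewrite zy' !scale0r addr0.
- by exists b, 0; rewrite xy; vring.
Qed.

Lemma peirce_basis e : e != 0 -> e ** e = e -> exists v w i j,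
  [/\ free3 e v w, e ** v = i *: v, e ** w = j *: w,
      [\/ i = 0, i = half | i = 1] & [\/ j = 0, j = half | j = 1]].
Proof.
move=> e0 ee.
pose eig y := exists c, e ** y = c *: y.
have split3 y : exists a b c, [/\ y = a + b + c, eig a, eig b & eig c].
  (* Lagrange interpolation: 2 t^2 - t, 4 t - 4 t^2 and 2 t^2 - 3 t + 1 are the projections onto the
     eigenvalues 1, 1/2 and 0. *)
  exists (2%:R *: (e ** (e ** y)) - e ** y), (4%:R *: (e ** y) - 4%:R *: (e ** (e ** y))),
    (2%:R *: (e ** (e ** y)) - 3%:R *: (e ** y) + y).
  have P := peirce_poly muC muJ y ee.
  split; first by vring.
  - by exists 1; apply: (eq_via_sub P); rewrite !bilE; vring.
  - exists half; apply: (eq_via_sub (congr1 (fun z => - (2%:R *: z)) P)).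
    by rewrite !bilE; vfield.
  - by exists 0; apply: (eq_via_sub P); rewrite !bilE; vring.
have eigv y : eig y -> y != 0 -> exists2 i, e ** y = i *: y & [\/ i = 0, i = half | i = 1].
  move=> [i ey] y0; exists i => //; exact: (peirce_eigenvalue muC muJ ee y0 ey).
have [v vE fev] : exists2 v, eig v & free2 e v.
  apply: contrapT => H.
  have [v0 fr] := free2_ext e0.
  have nf v : eig v -> exists a, v = a *: e.
    by move=> ev; apply: nfree2 => // fv; apply: H; exists v.
  have [a [b [c [v0E /nf[a' aE] /nf[b' bE] /nf[c' cE]]]]] := split3 v0.
  have [|_ /eqP] := fr (a' + b' + c') (-1); last by rewrite oppr_eq0 oner_eq0.
  by rewrite v0E aE bE cE; vring.
have [w wE fr] : exists2 w, eig w & free3 e v w.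
  apply: contrapT => H.
  have [w0 fr] := free3_ext fev.
  have nf w : eig w -> exists a b, w = a *: e + b *: v.
    by move=> ew; apply: nfree3 => // fw; apply: H; exists w.
  have [a [b [c [w0E /nf[a' [a'' aE]] /nf[b' [b'' bE]] /nf[c' [c'' cE]]]]]] := split3 w0.
  have [|_ _ /eqP] := free3_zero (a := a' + b' + c') (b := a'' + b'' + c'') (c := -1) fr.
    by rewrite w0E aE bE cE; vring.
  by rewrite oppr_eq0 oner_eq0.
have [i ev iE] := eigv v vE (free2_neq0 fev).2.
have [j ew jE] := eigv w wE (free2_neq0 (free3_free2 (free3_swap23 fr))).2.
by exists v, w, i, j.
Qed.

Lemma frame_neq0 u v w : free3 u v w -> [/\ u != 0, v != 0 & w != 0].
Proof.
move=> fr; have [u0 v0] := free2_neq0 (free3_free2 fr).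
by have [_ w0] := free2_neq0 (free3_free2 (free3_swap23 fr)).
Qed.

Lemma type_quad u : u != 0 -> (forall x, u ** x = x) -> jordan_type mu.
Proof. by move=> u0 /(unital_quadratic muC muN u0) H; constructor 2. Qed.

(** For y in the half space y^2 = a e, and (y^2 e) y = 1/2 y^2 y reads a/2 = a/4 when y is nonzero.
    So the half space has zero product, which is the table [J14]. *)
Lemma type_half_half e v w : free3 e v w -> e ** e = e ->
  e ** v = half *: v -> e ** w = half *: w -> jordan_type mu.
Proof.
move=> fr ee ev ew.
have sq0 y : e ** y = half *: y -> y ** y = 0.
  move=> ey; have [->|y0] := eqVneq y 0; first by rewrite amul0l.
  have [a [b [c yy]]] := free3_span (y ** y) fr.
  have E := peirce_half_sq muC muJ ee ey.
  rewrite yy !(bilE, ev, ew, ee) in E.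
  have [|_ b0 c0] := free3_zero (a := 0) (b := b) (c := c) fr.
    by apply: (eq_via_sub (congr1 (fun z => - 4%:R *: z) E)); vfield.
  have E2 := peirce_half_cube muJ ey.
  rewrite yy b0 c0 !scale0r !addr0 !(bilE, ee, ey) in E2.
  have /eqP : a *: y = 0.
    by apply: (eq_via_sub (congr1 (fun z => 4%:R *: z) E2)); vfield.
  by rewrite scaler_eq0 (negbTE y0) orbF => /eqP a0; rewrite yy a0 b0 c0 !scale0r !addr0.
have vv := sq0 v ev; have ww := sq0 w ew.
have vw : v ** w = 0.
  have E := sq0 (v + w); rewrite !bilE ev ew scalerDr (muC w v) vv ww in E.
  by apply: (eq_via_sub (congr1 (fun z => half *: z) (E erefl))); vfield.
constructor 4; constructor 1; apply: (table_orbit muC fr);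
  by rewrite ?frame_simp -?scalemxAr ?frame_simp.
Qed.

(** The Peirce rules give v^2 = a e + b w, v w = c v, w^2 = d w and a = 2 b c. If d = 0 the table is
    [tabhalf]. Otherwise f = w / d is a second idempotent, with f v = (c / d) v: the eigenvalue 0
    gives [J19], 1/2 makes e + f a unit, and 1 is impossible because e v = v / 2. *)
Lemma type_half_zero e v w : free3 e v w -> e ** e = e ->
  e ** v = half *: v -> e ** w = 0 -> jordan_type mu.
Proof.
move=> fr ee ev ew; have [e0 v0 w0] := frame_neq0 fr.
have ew0 : e ** w = 0 *: w by rewrite scale0r.
have z_half : 0 != half by rewrite eq_sym half_neq0.
have [d ww] : exists d, w ** w = d *: w.
  have E := peirce_mul muC muJ ee ew0 ew0 z_half.
  have [a [b [d wwE]]] := free3_span (w ** w) fr; exists d.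
  rewrite wwE !(bilE, ee, ev, ew) in E.
  have [|a0 b0 _] := free3_zero (a := a) (b := half * b) (c := 0) fr.
    by apply: (eq_via_sub E); vring.
  move/eqP: b0; rewrite mulf_eq0 (negbTE half_neq0) => /eqP b0.
  by rewrite wwE a0 b0; vring.
have [c vw] : exists c, v ** w = c *: v.
  have E := peirce_mul muC muJ ee ew0 ev z_half.
  have [a [c [d' vwE]]] := free3_span (v ** w) fr; exists c.
  rewrite (muC w v) vwE !(bilE, ee, ev, ew) in E.
  have [|a0 _ d'0] := free3_zero (a := half * a) (b := 0) (c := - half * d') fr.
    by apply: (eq_via_sub E); vfield.
  move/eqP: a0; rewrite mulf_eq0 (negbTE half_neq0) => /eqP a0.
  move/eqP: d'0; rewrite mulf_eq0 oppr_eq0 (negbTE half_neq0) => /eqP d'0.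
  by rewrite vwE a0 d'0; vring.
have [a [b vv]] : exists a b, v ** v = a *: e + b *: w.
  have E := peirce_half_sq muC muJ ee ev.
  have [a [c' [b vvE]]] := free3_span (v ** v) fr; exists a, b.
  rewrite vvE !(bilE, ee, ev, ew) in E.
  have [|_ c0 _] := free3_zero (a := 0) (b := c') (c := 0) fr.
    by apply: (eq_via_sub (congr1 (fun z => - 4%:R *: z) E)); vfield.
  by rewrite vvE c0; vring.
have abc : a = 2%:R * (b * c).
  have E := peirce_half_cube muJ ev.
  rewrite vv !(bilE, ee, ev, (muC w v), (muC w e), vw, ew) in E.
  have /eqP : (a - 2%:R * (b * c)) *: v = 0.
    by apply: (eq_via_sub (congr1 (fun z => 4%:R *: z) E)); vfield.
  by rewrite scaler_eq0 (negbTE v0) orbF subr_eq0 => /eqP.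
have [d0|d0] := eqVneq d 0.
  have c0 : c = 0.
    by apply: (nil_square muC muJ (w := w) _ v0); rewrite ?ww ?d0 ?scale0r // muC.
  rewrite c0 mulr0 mulr0 in abc.
  have [b0|b0] := eqVneq b 0.
    case: (not_full_table muC fr _ _ _ _ _ _ muF).
    - by exists 1, 0; rewrite ee; vring.
    - by exists 0, 0; rewrite vv abc b0; vring.
    - by exists 0, 0; rewrite ww d0; vring.
    - by exists 0, half; rewrite ev; vring.
    - by exists 0, 0; rewrite ew; vring.
    - by exists 0, 0; rewrite vw c0; vring.
  have fr' : free3 e v (b *: w).
    apply: (free3_det fr (a1 := 1) (b1 := 0) (c1 := 0) (a2 := 0) (b2 := 1) (c2 := 0)
      (a3 := 0) (b3 := 0) (c3 := b)); try vring.
    by rewrite !(mul1r, mul0r, mulr0, subr0, addr0).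
  constructor 3; apply: (table_orbit muC fr');
    rewrite ?frame_simp -?scalemxAr ?frame_simp // !(bilE, ww, vv, ew, vw, abc, c0, d0); vring.
have [f fE] : exists f, f = d^-1 *: w by eexists.
have ff : f ** f = f by rewrite !fE !bilE ww; vfield.
have fv : f ** v = (c / d) *: v by rewrite !fE !bilE (muC w v) vw; vring.
have fe : f ** e = 0 by rewrite !fE !bilE (muC w e) ew scaler0.
have frf : free3 e f v.
  apply: (free3_det fr (a1 := 1) (b1 := 0) (c1 := 0) (a2 := 0) (b2 := 0) (c2 := d^-1)
      (a3 := 0) (b3 := 1) (c3 := 0)); rewrite ?fE; try vring.
  by rewrite !(mul1r, mul0r, mulr0, subr0, addr0, sub0r) oppr_eq0 invr_eq0.
have fe0 : f ** e = 0 *: e by rewrite scale0r.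
case: (peirce_eigenvalue muC muJ ff v0 fv) => cd; rewrite cd in fv.
- have c0 : c = 0 by move/eqP: cd; rewrite mulf_eq0 invr_eq0 (negbTE d0) orbF => /eqP.
  rewrite c0 mulr0 mulr0 in abc.
  have b0 : b = 0.
    have E := peirce_mul muC muJ ff fv fv z_half.
    rewrite vv abc !scale0r add0r !fE !bilE ww in E.
    have /eqP : b *: w = 0.
      by apply: (eq_via_sub E); vfield.
    by rewrite scaler_eq0 (negbTE w0) orbF => /eqP.
  constructor 4; constructor 3; apply: (table_orbit muC frf);
    rewrite ?frame_simp -?scalemxAr ?frame_simp //.
  + by rewrite vv abc b0; vring.
  + by rewrite muC.
  + by rewrite fv scale0r.
- apply: (type_quad (u := e + f)) => [|x].
    apply: contraTneq (e0) => ef0; rewrite negbK; apply/eqP.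
    by have := congr1 (amul mu e) ef0; rewrite !bilE ee (muC e f) fe addr0.
  have [x1 [x2 [x3 ->]]] := free3_span x frf.
  rewrite !bilE ee (muC e f) fe ff ev fv.
  by vfield.
- have i1 : (1 : F) != half by rewrite eq_sym half_neq1.
  have := peirce_mul muC muJ ff fv fe0 i1.
  rewrite (muC v e) ev scale0r !bilE fv => /eqP.
  by rewrite !scaler_eq0 (negbTE v0) oner_eq0 (negbTE half_neq0).
Qed.

End Peirce.

Section Peirce.
Variables (F : numClosedFieldType) (mu : algstr F 3).
Local Notation "x ** y" := (amul mu x y) (at level 40, left associativity).
Local Notation half := (2%:R^-1 : F).
Implicit Types (x y z u v w e : 'cV[F]_3).

Hypotheses (muC : acommutative mu) (muJ : jordan mu) (muF : full mu).
Hypothesis muN : noncyclic mu.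

(** Completing the square makes v^2 = al e. If al = 0 the table is [tab16]. Otherwise, with d^2 =
    al, e splits into the orthogonal idempotents (e + v / d) / 2 and (e - v / d) / 2; one of them
    acts on w by 1/2 and the other by 0, which is the case of [type_half_zero]. *)
Lemma type_one_half e v w : free3 e v w -> e ** e = e ->
  e ** v = v -> e ** w = half *: w -> jordan_type mu.
Proof.
move=> fr0 ee ev0 ew.
have i1 : (1 : F) != half by rewrite eq_sym half_neq1.
have [v' [al [fr ev vv]]] : exists v' al, [/\ free3 e v' w, e ** v' = v' & v' ** v' = al *: e].
  have ev1 : e ** v = 1 *: v by rewrite scale1r.
  have E := peirce_mul muC muJ ee ev1 ev1 i1.
  have [al [be [c vv]]] := free3_span (v ** v) fr0.
  rewrite vv !(bilE, ee, ev0, ew) in E.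
  have [|_ _ c0] := free3_zero (a := 0) (b := 0) (c := c) fr0.
    by apply: (eq_via_sub (congr1 (fun z => - (2%:R *: z)) E)); vfield.
  exists (v - (be / 2%:R) *: e), (al + be ^+ 2 / 4%:R); split.
  - apply: (free3_det fr0 (a1 := 1) (b1 := 0) (c1 := 0) (a2 := - (be / 2%:R)) (b2 := 1)
      (c2 := 0) (a3 := 0) (b3 := 0) (c3 := 1)); try vring.
    by rewrite !scal01 oner_eq0.
  - by rewrite !bilE ev0 ee.
  - by rewrite !bilE (muC v e) ev0 ee vv c0; vfield.
move: v' fr ev vv => {fr0 ev0}v fr ev vv.
have [e0 v0 w0] := frame_neq0 fr.
have ev1 : e ** v = 1 *: v by rewrite scale1r.
have [c vw] : exists c, v ** w = c *: w.
  have E := peirce_mul muC muJ ee ev1 ew i1.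
  have [a [b [c vwE]]] := free3_span (v ** w) fr; exists c.
  rewrite vwE !(bilE, ee, ev, ew) in E.
  have [|a0 b0 _] := free3_zero (a := a) (b := b) (c := 0) fr.
    by apply: (eq_via_sub (congr1 (fun z => 2%:R *: z) E)); vfield.
  by rewrite vwE a0 b0; vring.
have [a [b ww]] : exists a b, w ** w = a *: e + b *: v.
  have E := peirce_half_sq muC muJ ee ew.
  have [a [b [c' wwE]]] := free3_span (w ** w) fr; exists a, b.
  rewrite wwE !(bilE, ee, ev, ew) in E.
  have [|_ _ c0] := free3_zero (a := 0) (b := 0) (c := c') fr.
    by apply: (eq_via_sub (congr1 (fun z => - 4%:R *: z) E)); vfield.
  by rewrite wwE c0; vring.
have abc : a = - (2%:R * (b * c)).
  have E := peirce_half_cube muJ ew.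
  rewrite ww !(bilE, ee, (muC v e), ev, ew, vw) in E.
  have /eqP : (a + 2%:R * (b * c)) *: w = 0.
    by apply: (eq_via_sub (congr1 (fun z => 4%:R *: z) E)); vfield.
  by rewrite scaler_eq0 (negbTE w0) orbF addr_eq0 => /eqP.
have [al0|al0] := eqVneq al 0.
  have c0 : c = 0 by apply: (nil_square muC muJ (w := v) _ w0) => //; rewrite vv al0 scale0r.
  rewrite c0 mulr0 mulr0 oppr0 in abc.
  constructor 4; constructor 2; exists b.
  apply: (table_orbit muC (free3_swap23 fr));
    rewrite ?frame_simp -?scalemxAr ?frame_simp //.
  - by rewrite ww abc; vring.
  - by rewrite vv al0 scale0r.
  - by rewrite muC vw c0 scale0r.
have [d d2] : exists d : F, d ^+ 2 = al by exists (sqrtC al); rewrite sqrtCK.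
have d0 : d != 0 by apply: contraNneq al0 => dE; rewrite -d2 dE expr0n.
have ff s : s ^+ 2 = 1 -> (half *: (e + (s / d) *: v)) ** (half *: (e + (s / d) *: v)) =
    half *: (e + (s / d) *: v).
  move=> s2; rewrite !bilE (muC v e) ev ee vv -d2.
  transitivity (half *: (half *: e + (half * s ^+ 2) *: e + (s / d) *: v)).
    by vfield.
  by rewrite s2; vfield.
have [f fE] : exists f, f = half *: (e + d^-1 *: v) by eexists.
have [g gE] : exists g, g = half *: (e - d^-1 *: v) by eexists.
have fff : f ** f = f by rewrite fE -[d^-1]mul1r ff // expr1n.
have ggg : g ** g = g.
  by rewrite gE -scaleNr -mulN1r ff // sqrrN expr1n.
have fg : f ** g = 0.
  by rewrite fE gE !bilE (muC v e) ev ee vv -d2; vfield.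
have fw : f ** w = (half * (half + c / d)) *: w.
  by rewrite fE !bilE ew vw; vring.
have gw : g ** w = (half - (half * (half + c / d))) *: w.
  by rewrite gE !bilE ew vw; vfield.
have frfg : free3 f w g.
  apply: (free3_det fr (a1 := half) (b1 := half / d) (c1 := 0) (a2 := 0) (b2 := 0)
      (c2 := 1) (a3 := half) (b3 := - (half / d)) (c3 := 0)); rewrite ?fE ?gE; try vring.
  have -> : half * (0 * 0 - (- (half / d)) * 1) - half / d * (0 * 0 - half * 1) +
     0 * (0 * (- (half / d)) - half * 0) = half / d by field.
  by apply: mulf_neq0; [exact: half_neq0 | rewrite invr_neq0].
case: (peirce_eigenvalue muC muJ fff w0 fw) => cE; rewrite cE in fw gw.
- apply: (type_half_zero muC muJ muF muN (e := g) (v := w) (w := f)) => //.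
  + by apply: free3_swap12; apply: free3_swap23; apply: free3_swap12;
       apply: free3_swap23; apply: free3_swap12; apply: free3_swap23;
       apply: free3_swap12; apply: free3_swap23; apply: free3_swap12.
  + by rewrite gw subr0.
  + by rewrite muC.
- exact: (type_half_zero muC muJ muF muN frfg).
- have := peirce_eigenvalue muC muJ ggg w0 gw.
  have -> : half - 1 = - half by field.
  case=> /eqP.
  + by rewrite oppr_eq0 (negbTE (half_neq0 F)).
  + by rewrite -subr_eq0 -opprD halfE oppr_eq0 oner_eq0.
  + rewrite -subr_eq0 -opprD oppr_eq0.
    have -> : half + 1 = 3%:R / 2%:R by field.
    by rewrite mulf_eq0 invr_eq0 !pnatr_eq0.
Qed.

(** The Peirce components for 1 and 0 annihilate each other and w^2 = d w. If d = 0 no product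
    involves w, against [muF]; otherwise e + w / d is a unit. *)
Lemma type_one_zero e v w : free3 e v w -> e ** e = e ->
  e ** v = v -> e ** w = 0 -> jordan_type mu.
Proof.
move=> fr ee ev ew; have [e0 v0 w0] := frame_neq0 fr.
have i1 : (1 : F) != half by rewrite eq_sym half_neq1.
have z_half : 0 != half by rewrite eq_sym half_neq0.
have ev1 : e ** v = 1 *: v by rewrite scale1r.
have ew0 : e ** w = 0 *: w by rewrite scale0r.
have [al [be vv]] : exists al be, v ** v = al *: e + be *: v.
  have E := peirce_mul muC muJ ee ev1 ev1 i1.
  have [al [be [c vvE]]] := free3_span (v ** v) fr; exists al, be.
  rewrite vvE !(bilE, ee, ev, ew) in E.
  have [|_ _ c0] := free3_zero (a := 0) (b := 0) (c := c) fr.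
    by apply: (eq_via_sub (esym E)); vring.
  by rewrite vvE c0; vring.
have vw : v ** w = 0.
  have := peirce_mul muC muJ ee ew0 ev1 z_half.
  by rewrite (muC w v) (peirce_mul muC muJ ee ev1 ew0 i1) scale0r scale1r.
have [d ww] : exists d, w ** w = d *: w.
  have E := peirce_mul muC muJ ee ew0 ew0 z_half.
  have [a [b [d wwE]]] := free3_span (w ** w) fr; exists d.
  rewrite wwE !(bilE, ee, ev, ew) in E.
  have [|a0 b0 _] := free3_zero (a := a) (b := b) (c := 0) fr.
    by apply: (eq_via_sub E); vring.
  by rewrite wwE a0 b0; vring.
have [d0|d0] := eqVneq d 0.
  case: (not_full_table muC fr _ _ _ _ _ _ muF).
  - by exists 1, 0; rewrite ee; vring.
  - by exists al, be.
  - by exists 0, 0; rewrite ww d0; vring.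
  - by exists 0, 1; rewrite ev; vring.
  - by exists 0, 0; rewrite ew; vring.
  - by exists 0, 0; rewrite vw; vring.
apply: (type_quad muC muN (u := e + d^-1 *: w)) => [|x].
  apply: contraTneq (e0) => ef0; rewrite negbK; apply/eqP.
  by have := congr1 (amul mu e) ef0; rewrite !bilE ee ew scaler0 addr0.
have [x1 [x2 [x3 ->]]] := free3_span x fr.
rewrite !bilE ee ev ew (muC w e) ew (muC w v) vw ww.
by vfield.
Qed.

(** If x and x^2 were free in the kernel of e, then e + s x would generate the algebra for some s.
    So x^2 = t(x) x on this kernel, and polarizing, 2 v w = t(w) v + t(v) w. Either t = 0, against
    [muF], or a vector with t = 1, the idempotent e and a vector with t = 0 form the table [J19]. *)
Lemma type_zero_zero e v w : free3 e v w -> e ** e = e ->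
  e ** v = 0 -> e ** w = 0 -> jordan_type mu.
Proof.
move=> fr ee ev ew; have [e0 v0 w0] := frame_neq0 fr.
have z_half : 0 != half by rewrite eq_sym half_neq0.
pose ker y := e ** y = 0.
have kerE y : ker y -> exists a b, y = a *: v + b *: w.
  have [a [b [c ->]]] := free3_span y fr.
  rewrite /ker !(bilE, ee, ev, ew) => E; exists b, c.
  have [|a0 _ _] := free3_zero (a := a) (b := 0) (c := 0) fr.
    by apply: (eq_via_sub E); vring.
  by rewrite a0; vring.
have kerM y z : ker y -> ker z -> ker (y ** z).
  rewrite /ker => ey ez; have ey0 : e ** y = 0 *: y by rewrite scale0r.
  have ez0 : e ** z = 0 *: z by rewrite scale0r.
  by rewrite (peirce_mul muC muJ ee ey0 ez0 z_half) scale0r.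
have ker_sq x : ker x -> exists t, x ** x = t *: x.
  move=> kx; have [->|x0] := eqVneq x 0; first by exists 0; rewrite amul0l scaler0.
  apply: nfree2 => // fx.
  have kxx := kerM _ _ kx kx.
  have fr3 : free3 e x (x ** x).
    apply/free3P => a b c E.
    have a0 : a = 0.
      have := congr1 (amul mu e) E; rewrite !bilE ee [e ** x]kx [e ** (x ** x)]kxx.
      by rewrite !scaler0 !addr0 => /eqP; rewrite scaler_eq0 (negbTE e0) orbF => /eqP.
    have [|b0 c0] := fx b c; last by [].
    by rewrite -[RHS]E a0; vring.
  have [c [d x3]] : exists c d, x ** (x ** x) = c *: x + d *: (x ** x).
    have kx3 : ker (x ** (x ** x)) by apply: kerM.
    have [a [c [d x3]]] := free3_span (x ** (x ** x)) fr3; exists c, d.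
    have := kx3; rewrite /ker x3 !bilE ee [e ** x]kx [e ** (x ** x)]kxx !scaler0 !addr0.
    move/eqP; rewrite scaler_eq0 (negbTE e0) orbF => /eqP ->.
    by rewrite scale0r add0r.
  (* This is the determinant of y, y^2, y^3 in the basis e, x, x^2, for y = e + s x. *)
  have [|s] := @poly_nonroot F (('X^3 : {poly F}) * (1%:P - d *: 'X - c *: 'X^2)).
    apply/negP => /eqP/polyP/(_ 3).
    rewrite -commr_polyXn coefMXn /= !(coefD, coefN, coefZ, coefXn, coefX, coefC) /=.
    by rewrite !mulr0 !subr0 => /eqP; rewrite oner_eq0.
  rewrite hornerM !(hornerD, hornerN, hornerZ, hornerXn, hornerX, hornerC) => s0.
  pose y := e + s *: x.
  have y2 : y ** y = 1 *: e + 0 *: x + s ^+ 2 *: (x ** x).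
    by rewrite /y !bilE ee (muC x e) [e ** x]kx; vring.
  have y3 : y ** (y ** y) = 1 *: e + (s ^+ 3 * c) *: x + (s ^+ 3 * d) *: (x ** x).
    by rewrite y2 /y !bilE ee (muC x e) [e ** x]kx [e ** (x ** x)]kxx x3; vring.
  apply: (muN (x := y)); apply: (free3_det fr3 (a1 := 1) (b1 := s) (c1 := 0) _ y2 y3).
    by rewrite /y; vring.
  move: s0; apply: contraNN => /eqP E; apply/eqP; rewrite -[RHS]E; ring.
have [tv vv] := ker_sq v ev; have [tw ww] := ker_sq w ew.
have [t1 E1] : exists t, (v + w) ** (v + w) = t *: (v + w).
  by apply: ker_sq; rewrite /ker bilE ev ew addr0.
have [t2 E2] : exists t, (v - w) ** (v - w) = t *: (v - w).
  by apply: ker_sq; rewrite /ker bilE bilE ev ew subr0.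
rewrite !bilE (muC w v) vv ww in E1 E2.
have [|_ s1 s2] := free3_zero (a := 0) (b := 2%:R * tv - t1 - t2) (c := 2%:R * tw - t1 + t2) fr.
  by apply: (eq_via_sub (f_equal2 +%R E1 E2)); vring.
have t1E : t1 = tv + tw.
  have E : 2%:R * tv - t1 - t2 + (2%:R * tw - t1 + t2) = 0 by rewrite s1 s2 addr0.
  by apply: (eq_via_sub (congr1 (fun z : F => - half * z) E)); field.
have vw : v ** w = (half * tw) *: v + (half * tv) *: w.
  by rewrite t1E in E1; apply: (eq_via_sub (congr1 (fun z => half *: z) E1)); vfield.
have type19 (v1 w1 : 'cV[F]_3) t t' : free3 e v1 w1 -> e ** v1 = 0 -> e ** w1 = 0 ->
    v1 ** v1 = t *: v1 -> w1 ** w1 = t' *: w1 ->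
    v1 ** w1 = (half * t') *: v1 + (half * t) *: w1 -> t != 0 -> jordan_type mu.
  move=> fr1 ev1 ew1 vv1 ww1 vw1 t0.
  have [f fE] : exists f, f = t^-1 *: v1 by eexists.
  have [w2 w2E] : exists w2, w2 = w1 - (t' / t) *: v1 by eexists.
  have frf : free3 f e w2.
    apply: (free3_det fr1 (a1 := 0) (b1 := t^-1) (c1 := 0) (a2 := 1) (b2 := 0) (c2 := 0)
      (a3 := 0) (b3 := - (t' / t)) (c3 := 1)); rewrite ?fE ?w2E; try vring.
    by rewrite !scal01 oppr_eq0 invr_eq0.
  constructor 4; constructor 3; apply: (table_orbit muC frf);
    rewrite ?frame_simp -?scalemxAr ?frame_simp // ?fE ?w2E !bilE ?(muC w1 v1) ?(muC v1 e)
      ?ev1 ?ew1 ?vv1 ?ww1 ?vw1; by vfield.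
have [tv0|tv0] := eqVneq tv 0; last exact: (type19 v w tv tw).
have [tw0|tw0] := eqVneq tw 0; last first.
  apply: (type19 w v tw tv) => //; first exact: free3_swap23.
  by rewrite muC vw addrC.
case: (not_full_table muC fr _ _ _ _ _ _ muF).
- by exists 1, 0; rewrite ee; vring.
- by exists 0, 0; rewrite vv tv0; vring.
- by exists 0, 0; rewrite ww tw0; vring.
- by exists 0, 0; rewrite ev; vring.
- by exists 0, 0; rewrite ew; vring.
- by exists 0, 0; rewrite vw tv0 tw0; vring.
Qed.

End Peirce.

Theorem jordan_classification (F : numClosedFieldType) (mu : algstr F 3) :
  acommutative mu -> jordan mu -> full mu -> jordan_type mu.
Proof.
move=> muC muJ muF; have [[x fx]|/forallNP muN] :=
  pselect (exists x, free3 x (amul mu x x) (amul mu x (amul mu x x))).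
  by constructor 1; apply: jordan_cyclic fx.
have [e e0 ee] := exists_idempotent muC muJ muF muN.
have [v [w [i [j [fr ev ew iE jE]]]]] := peirce_basis muC muJ e0 ee.
have fr' := free3_swap23 fr.
case: iE ev => -> ev; case: jE ew => -> ew; rewrite ?scale0r ?scale1r in ev ew.
- exact: (type_zero_zero muC muJ muF muN fr).
- exact: (type_half_zero muC muJ muF muN fr').
- exact: (type_one_zero muC muJ muF muN fr').
- exact: (type_half_zero muC muJ muF muN fr).
- exact: (type_half_half muC muJ fr).
- exact: (type_one_half muC muJ muF muN fr').
- exact: (type_one_zero muC muJ muF muN fr).
- exact: (type_one_half muC muJ muF muN fr).
- apply: (type_quad muC muN e0) => x.
  by have [a [b [c ->]]] := free3_span x fr; rewrite !bilE ee ev ew.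
Qed.

(** * Degenerations *)

Section Vec.
Variable F : fieldType.

Definition vec (a b c : F) : 'cV[F]_3 := a *: e1 F + b *: e2 F + c *: e3 F.

Lemma vec0E a b c : vec a b c o0 0 = a.
Proof. by rewrite /vec !cvE /=; ring. Qed.
Lemma vec1E a b c : vec a b c o1 0 = b.
Proof. by rewrite /vec !cvE /=; ring. Qed.
Lemma vec2E a b c : vec a b c o2 0 = c.
Proof. by rewrite /vec !cvE /=; ring. Qed.
Definition vec_coord := (vec0E, vec1E, vec2E).

Lemma vec_inj a b c a' b' c' : vec a b c = vec a' b' c' -> [/\ a = a', b = b' & c = c'].
Proof.
by move=> E; split; [rewrite -(vec0E a b c) E | rewrite -(vec1E a b c) E |
  rewrite -(vec2E a b c) E]; rewrite vec_coord.
Qed.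

Lemma free3_std : free3 (e1 F) (e2 F) (e3 F).
Proof.
by apply/free3P => a b c E; split; [rewrite -[RHS](cv0E F o0) |
  rewrite -[RHS](cv0E F o1) | rewrite -[RHS](cv0E F o2)];
  rewrite -E !cvE /=; ring.
Qed.

Lemma free3_vec a1 b1 c1 a2 b2 c2 a3 b3 c3 :
  a1 * (b2 * c3 - b3 * c2) - b1 * (a2 * c3 - a3 * c2) + c1 * (a2 * b3 - a3 * b2) != 0 ->
  free3 (vec a1 b1 c1) (vec a2 b2 c2) (vec a3 b3 c3).
Proof. exact: (free3_det free3_std). Qed.

Lemma e1_vec : e1 F = vec 1 0 0. Proof. by rewrite /vec; vring. Qed.
Lemma e2_vec : e2 F = vec 0 1 0. Proof. by rewrite /vec; vring. Qed.
Lemma e3_vec : e3 F = vec 0 0 1. Proof. by rewrite /vec; vring. Qed.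
Lemma zero_vec : 0 = vec 0 0 0 :> 'cV[F]_3. Proof. by rewrite /vec; vring. Qed.
Lemma scale_vec k a b c : k *: vec a b c = vec (k * a) (k * b) (k * c).
Proof. by rewrite /vec; vring. Qed.
Lemma add_vec a b c a' b' c' : vec a b c + vec a' b' c' = vec (a + a') (b + b') (c + c').
Proof. by rewrite /vec; vring. Qed.
Lemma opp_vec a b c : - vec a b c = vec (- a) (- b) (- c).
Proof. by rewrite /vec; vring. Qed.
Definition vec_norm := (e1_vec, e2_vec, e3_vec, zero_vec, scale_vec, opp_vec, add_vec).

Definition bil6 (p11 p22 p33 p12 p13 p23 a b c a' b' c' : F) :=
  a * a' * p11 + b * b' * p22 + c * c' * p33 + (a * b' + b * a') * p12 +
  (a * c' + c * a') * p13 + (b * c' + c * b') * p23.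

Lemma amul_vec p11 q11 r11 p22 q22 r22 p33 q33 r33 p12 q12 r12 p13 q13 r13 p23 q23 r23
    a b c a' b' c' :
  amul (commalg3 (vec p11 q11 r11) (vec p22 q22 r22) (vec p33 q33 r33)
    (vec p12 q12 r12) (vec p13 q13 r13) (vec p23 q23 r23)) (vec a b c) (vec a' b' c') =
  vec (bil6 p11 p22 p33 p12 p13 p23 a b c a' b' c')
    (bil6 q11 q22 q33 q12 q13 q23 a b c a' b' c')
    (bil6 r11 r22 r33 r12 r13 r23 a b c a' b' c').
Proof. by rewrite amul_commalg3 !vec_coord !scale_vec !add_vec. Qed.

Lemma frame_vec a1 b1 c1 a2 b2 c2 a3 b3 c3 a b c :
  frame (vec a1 b1 c1) (vec a2 b2 c2) (vec a3 b3 c3) *m vec a b c =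
  vec (a * a1 + b * a2 + c * a3) (a * b1 + b * b2 + c * b3) (a * c1 + b * c2 + c * c3).
Proof. by rewrite frameE !vec_coord !scale_vec !add_vec. Qed.

End Vec.

Ltac tab_norm := rewrite ?vec_norm ?amul_vec ?frame_vec /bil6; congr vec.
Ltac tab_ring := tab_norm; ring.
Ltac tab_field := tab_norm; field.
Ltac inv_norm := rewrite ?vec_norm ?amul_vec /bil6 ?vec_norm ?amul_vec /bil6 ?vec_norm
  ?amul_vec /bil6 ?vec_coord.

Section Curves.
Variable F : numClosedFieldType.
Implicit Types (C : set (algstr F 3)).

Lemma upolyfun_cst (c : F) : upolyfun (fun=> c).
Proof. exact: (fsC (upolyfun_subalg F)). Qed.

Lemma acurve_commalg3 (p11 p22 p33 p12 p13 p23 : F -> 'cV[F]_3) :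
  (forall k, upolyfun (fun t => p11 t k 0)) -> (forall k, upolyfun (fun t => p22 t k 0)) ->
  (forall k, upolyfun (fun t => p33 t k 0)) -> (forall k, upolyfun (fun t => p12 t k 0)) ->
  (forall k, upolyfun (fun t => p13 t k 0)) -> (forall k, upolyfun (fun t => p23 t k 0)) ->
  acurve (fun t => commalg3 (p11 t) (p22 t) (p33 t) (p12 t) (p13 t) (p23 t)).
Proof.
move=> P11 P22 P33 P12 P13 P23 [[i j] k]; under eq_fun do rewrite ffunE /=.
by elim/ord3P: i; elim/ord3P: j => /=.
Qed.

(** The form in which degenerations are proved: [s] lists the parameters at which the perturbed
    table fails to be generic. *)
Lemma closed_perturb C (g : F -> algstr F 3) (s : seq F) : closed C -> acurve g ->
  (forall t, t \notin s -> C (g t)) -> C (g 0).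
Proof.
move=> cC gc H; pose p := \prod_(a <- s) ('X - a%:P).
have pE t : (p.[t] != 0) = (t \notin s).
  rewrite horner_prod prodf_seq_neq0; apply/allP/idP => [Hs|ts a As].
    apply/negP => /Hs; by rewrite !hornerE subrr eqxx.
  by rewrite !hornerE subr_eq0; apply: contraNneq ts => ->.
apply: (@closed_curve F 3 C g (fun t => p.[t]) cC gc); first by exists p.
  apply: poly_nonroot; exact: monic_neq0 (monic_prod_XsubC _ _ _).
by move=> t; rewrite pE; apply: H.
Qed.

End Curves.

Ltac upoly F := let H := constr:(upolyfun_subalg F) in
  repeat first [ exact: upolyfun_cst | exact: upolyfun_id | apply: (fsD H)
               | apply: (fsM H) | apply: (fsN H) | apply: (fsX H) ].
Ltac acurve_tac F := apply: acurve_commalg3; let k := fresh "k" in move=> k;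
  rewrite /vec; under eq_fun do rewrite ?cvE; upoly F.

Section Degenerations.
Variable F : numClosedFieldType.
Local Notation half := (2%:R^-1 : F).
Implicit Types (C : set (algstr F 3)).

Lemma free3_scale (u v w : 'cV[F]_3) a b c : free3 u v w -> a != 0 -> b != 0 -> c != 0 ->
  free3 (a *: u) (b *: v) (c *: w).
Proof.
move=> fr a0 b0 c0; apply: (free3_det fr (a1 := a) (b1 := 0) (c1 := 0) (a2 := 0)
  (b2 := b) (c2 := 0) (a3 := 0) (b3 := 0) (c3 := c)); try vring.
by rewrite !scal01 !mulf_neq0.
Qed.

Lemma add_neq0 (a t : F) : t != - a -> a + t != 0.
Proof. by apply: contraNneq => E; apply/eqP; apply: (eq_via_sub E); ring. Qed.

Lemma sqrt_ex (a : F) : exists b, b ^+ 2 = a.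
Proof. by exists (sqrtC a); rewrite sqrtCK. Qed.

Lemma tabpow_swap12 (a b c : F) : tabpow a b c = tabpow b a c.
Proof.
rewrite /tabpow.
have -> : a + b + c = b + a + c by ring.
have -> : a * b + a * c + b * c = b * a + b * c + a * c by ring.
by have -> : a * b * c = b * a * c by ring.
Qed.

Lemma tabpow_swap13 (a b c : F) : tabpow a b c = tabpow c b a.
Proof.
rewrite /tabpow.
have -> : a + b + c = c + b + a by ring.
have -> : a * b + a * c + b * c = c * b + c * a + b * a by ring.
by have -> : a * b * c = c * b * a by ring.
Qed.

(* (x - b) (x - c) x is an eigenvector of multiplication by x. *)
Lemma tabpow_eigen (a b c : F) y :
  amul (tabpow a b c) (vec (b * c) (- (b + c)) 1) y =
  (a * y o0 0 + a ^+ 2 * y o1 0 + a ^+ 3 * y o2 0) *: vec (b * c) (- (b + c)) 1.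
Proof.
rewrite (_ : y = vec (y o0 0) (y o1 0) (y o2 0)); last exact: vecE.
by rewrite /tabpow !vec_coord; tab_ring.
Qed.

(** The table is the ideal generated by T in F[T] modulo T (T - a) (T - b) (T - c). The vector T (T
    - b) (T - c) vanishes at all roots but a, where its value is a (a - b) (a - c), whence the
    normalization [k] that makes it idempotent. *)
Lemma tabpow_distinct (a b c : F) : a != 0 -> b != 0 -> c != 0 ->
  a != b -> a != c -> b != c -> GLorbit (J07 F) (tabpow a b c).
Proof.
move=> a0 b0 c0; rewrite -[a == b]subr_eq0 -[a == c]subr_eq0 -[b == c]subr_eq0.
move=> ab ac bc.
pose w (x y : F) := vec (x * y) (- (x + y)) 1.
have wa y : amul (tabpow a b c) (w b c) y =
    (a * y o0 0 + a ^+ 2 * y o1 0 + a ^+ 3 * y o2 0) *: w b c.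
  exact: tabpow_eigen.
have wb y : amul (tabpow a b c) (w a c) y =
    (b * y o0 0 + b ^+ 2 * y o1 0 + b ^+ 3 * y o2 0) *: w a c.
  by rewrite tabpow_swap12; apply: tabpow_eigen.
have wc y : amul (tabpow a b c) (w b a) y =
    (c * y o0 0 + c ^+ 2 * y o1 0 + c ^+ 3 * y o2 0) *: w b a.
  by rewrite tabpow_swap13; apply: tabpow_eigen.
have fr : free3 (w b c) (w a c) (w b a).
  apply: free3_vec; have -> : b * c * (- (a + c) * 1 - - (b + a) * 1) -
     - (b + c) * (a * c * 1 - b * a * 1) + 1 * (a * c * - (b + a) - b * a * - (a + c))
     = (a - b) * (a - c) * (b - c) by ring.
  by rewrite !mulf_neq0.
pose k (x y z : F) := (x * (x - y) * (x - z))^-1.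
have wsq (x y z : F) : x != 0 -> x - y != 0 -> x - z != 0 ->
    k x y z * (x * (y * z) + x ^+ 2 * (- (y + z)) + x ^+ 3 * 1) = 1.
  by move=> x0 xy xz; rewrite /k; field; rewrite ?xy ?xz ?x0.
have N (x y : F) : x - y != 0 -> y - x != 0 by rewrite -opprB oppr_eq0.
have KC : acommutative (tabpow a b c) by exact: commalg3_comm.
move: (tabpow a b c) KC wa wb wc => K KC wa wb wc.
have frk : free3 (k a b c *: w b c) (k b a c *: w a c) (k c b a *: w b a).
  by apply: free3_scale => //; rewrite invr_neq0 // !mulf_neq0 // N.
apply: (table_orbit KC frk); rewrite !amulZl !amulZr ?(wa, wb, wc) !vec_coord.
- by rewrite frame_e1; congr (_ *: _); rewrite scalerA (wsq _ _ _ a0 ab ac) scale1r.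
- by rewrite frame_e2; congr (_ *: _); rewrite scalerA (wsq _ _ _ b0 (N _ _ ab) bc) scale1r.
- rewrite frame_e3; congr (_ *: _).
  by rewrite scalerA (wsq _ _ _ c0 (N _ _ bc) (N _ _ ac)) scale1r.
- by rewrite mulmx0; vring.
- by rewrite mulmx0; vring.
- by rewrite mulmx0; vring.
Qed.

Lemma tabpow_degeneration C : closed C -> GLstable C -> C (J07 F) -> forall a b c, C (tabpow a b c).
Proof.
move=> cC sC CJ a b c.
(* With the different speeds 1, 2, 3, each vanishing root or coincidence of two roots excludes
   exactly one t. *)
pose g t := tabpow (a + t) (b + 2%:R * t) (c + 3%:R * t).
have -> : tabpow a b c = g 0 by rewrite /g !mulr0 !addr0.
apply: (closed_perturb (s := [:: - a; - b / 2%:R; - c / 3%:R; a - b; (a - c) / 2%:R; b - c])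
  cC) => [|t].
  rewrite /g /tabpow; acurve_tac F.
rewrite !inE !negb_or => /and5P[t1 t2 t3 t4 /andP[t5 t6]].
apply: (GLstable_orbit sC CJ); apply: tabpow_distinct.
- by apply: contraNneq t1 => E; apply/eqP; apply: (eq_via_sub E); ring.
- apply: contraNneq t2 => E; apply/eqP.
  by apply: (eq_via_sub (congr1 (fun x => x / 2%:R) E)); field.
- apply: contraNneq t3 => E; apply/eqP.
  by apply: (eq_via_sub (congr1 (fun x => x / 3%:R) E)); field.
- by apply: contraNneq t4 => E; apply/eqP; apply: (eq_via_sub (esym E)); ring.
- apply: contraNneq t5 => E; apply/eqP.
  by apply: (eq_via_sub (congr1 (fun x => - x / 2%:R) E)); field.
- by apply: contraNneq t6 => E; apply/eqP; apply: (eq_via_sub (esym E)); ring.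
Qed.

(** Gram-Schmidt: e3 is replaced by e3 - (p / n) e2. *)
Lemma tabquad_shift (n m p : F) : n != 0 ->
  GLorbit (tabquad n (m - p ^+ 2 / n) 0) (tabquad n m p).
Proof.
move=> n0; have fr : free3 (vec 1 0 0) (vec 0 1 0) (vec 0 (- (p / n)) 1).
  by apply: free3_vec; rewrite !scal01 oner_eq0.
by apply: (commalg3_orbit fr); rewrite /tabquad; tab_field.
Qed.

Lemma tabquad_J12 (n m : F) : n != 0 -> m != 0 -> GLorbit (J12 F) (tabquad n m 0).
Proof.
have [a <-] := sqrt_ex n; have [b <-] := sqrt_ex m.
rewrite !expf_eq0 /= => a0 b0.
(* As e2^2 = a^2 e1, the first two vectors are orthogonal idempotents whose sum is the unit. *)
have fr : free3 (vec half (half / a) 0) (vec half (- (half / a)) 0) (vec 0 0 b^-1).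
  apply: free3_vec.
  have -> : half * (- (half / a) * b^-1 - 0 * 0) - half / a * (half * b^-1 - 0 * 0) +
     0 * (half * 0 - 0 * - (half / a)) = - (half / (a * b)) by field; rewrite a0 b0.
  by rewrite oppr_eq0 mulf_neq0 ?half_neq0 // invr_neq0 // mulf_neq0.
apply: (commalg3_orbit fr); rewrite /tabquad;
  by tab_field; rewrite ?a0 ?b0.
Qed.

Lemma tabquad_degeneration C : closed C -> GLstable C -> C (J12 F) -> forall n m p, C (tabquad n m p).
Proof.
move=> cC sC CJ n m p.
have C0 n' m' : n' != 0 -> C (tabquad n' m' 0).
  move=> n0; pose g t := tabquad n' (m' + t) 0.
  have -> : tabquad n' m' 0 = g 0 by rewrite /g addr0.
  apply: (closed_perturb (s := [:: - m']) cC) => [|t]; first by rewrite /g /tabquad; acurve_tac F.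
  rewrite inE => /add_neq0 t0.
  by apply: (GLstable_orbit sC CJ); apply: tabquad_J12.
pose g t := tabquad (n + t) m p.
have -> : tabquad n m p = g 0 by rewrite /g addr0.
apply: (closed_perturb (s := [:: - n]) cC) => [|t]; first by rewrite /g /tabquad; acurve_tac F.
rewrite inE => /add_neq0 n0; exact: (GLstable_orbit sC (C0 _ _ n0) (tabquad_shift m p n0)).
Qed.

Lemma tabhalf_degeneration C : closed C -> GLstable C -> C (J12 F) -> C (tabhalf F).
Proof.
move=> cC sC CJ.
(* For nonzero t, e3 / t is an idempotent orthogonal to e1, and together with e2 divided by a square
   root of t they form the table [J12]. *)
pose g t := commalg3 (e1 F) (t *: e1 F + e3 F) (t *: e3 F) (half *: e2 F) 0
   ((t * half) *: e2 F).
have -> : tabhalf F = g 0 by rewrite /g /tabhalf !mul0r !scale0r add0r.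
apply: (closed_perturb (s := [:: 0]) cC) => [|t]; first by rewrite /g; acurve_tac F.
rewrite inE; have [s <-] := sqrt_ex t; rewrite expf_eq0 /= => s0.
apply: (GLstable_orbit sC CJ).
have fr : free3 (vec 1 0 0) (vec 0 0 (s ^- 2)) (vec 0 s^-1 0).
  apply: free3_vec; rewrite !scal01.
  by rewrite oppr_eq0 !mulf_neq0 ?invr_neq0 ?expf_neq0.
by apply: (commalg3_orbit fr); rewrite /g; tab_field.
Qed.

Lemma tab16_J16 (b : F) : b != 0 -> GLorbit (J16 F) (tab16 b).
Proof.
move=> b0; have fr : free3 (vec 1 0 0) (vec 0 1 0) (vec 0 0 b).
  by apply: free3_vec; rewrite !scal01.
by apply: (commalg3_orbit fr); rewrite /tab16; tab_field.
Qed.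

Lemma tab16_degeneration C : closed C -> GLstable C -> C (J16 F) -> forall b, C (tab16 b).
Proof.
move=> cC sC CJ b; pose g t := tab16 (b + t).
have -> : tab16 b = g 0 by rewrite /g addr0.
apply: (closed_perturb (s := [:: - b]) cC) => [|t]; first by rewrite /g /tab16; acurve_tac F.
by rewrite inE => /add_neq0 t0; apply: (GLstable_orbit sC CJ); apply: tab16_J16.
Qed.

End Degenerations.

(** * Tables with all products in a plane, as members of the two families *)

Section PlaneAlgebras.
Variable F : numClosedFieldType.
Local Notation half := (2%:R^-1 : F).
Implicit Types (C : set (algstr F 3)).

(* The plane <e1, e2> contains all products; in the three tables it is
   respectively a diagonal algebra, F[x]-like with x = e1, x^2 = e2 and
   x^3 = (a + b) x^2 - a b x, and an algebra with x^2 proportional to x. *)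
Definition tabdiag (l m x1 x2 y1 y2 z1 z2 : F) : algstr F 3 :=
  commalg3 (vec l 0 0) (vec 0 m 0) (vec z1 z2 0) (vec 0 0 0) (vec x1 x2 0) (vec y1 y2 0).

Definition tabplane (a b x1 x2 y1 y2 z1 z2 : F) : algstr F 3 :=
  commalg3 (vec 0 1 0)
    (vec (- (a * b) * (a + b)) (- (a * b) + (a + b) ^+ 2) 0) (vec z1 z2 0)
    (vec (- (a * b)) (a + b) 0) (vec x1 x2 0) (vec y1 y2 0).

Definition tabline (a x1 x2 y1 y2 z1 z2 : F) : algstr F 3 :=
  commalg3 (vec a 0 0) (vec 0 0 0) (vec z1 z2 0) (vec 0 (half * a) 0) (vec x1 x2 0)
    (vec y1 y2 0).

Lemma tabdiag_A01 (a b g : F) : tabdiag 1 1 0 a b 0 1 g = A01 a b g.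
Proof. by rewrite /tabdiag /A01; congr commalg3; tab_ring. Qed.

Lemma tabline_calJ01 (a : F) : tabline 1 0 0 1 0 1 a = calJ01 a.
Proof. by rewrite /tabline /calJ01; congr commalg3; tab_ring. Qed.

Section C7.
Variable C : set (algstr F 3).
Hypotheses (cC : closed C) (sC : GLstable C) (CA : forall a b g, C (A01 a b g)).

Lemma tabdiag_scaled x2 y1 z1 z2 : C (tabdiag 1 1 0 x2 y1 0 z1 z2).
Proof.
pose g t := tabdiag 1 1 0 x2 y1 0 (z1 + t) z2.
have -> : tabdiag 1 1 0 x2 y1 0 z1 z2 = g 0 by rewrite /g addr0.
apply: (closed_perturb (s := [:: - z1]) cC) => [|t]; first by rewrite /g /tabdiag; acurve_tac F.
rewrite inE => /add_neq0; have [s sE] := sqrt_ex (z1 + t).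
rewrite /g -sE expf_eq0 /= => s0.
apply: (GLstable_orbit sC (CA (x2 / s) (y1 / s) (z2 / s ^+ 2))).
have fr : free3 (vec 1 0 0) (vec 0 1 0) (vec 0 0 (s^-1)).
  by apply: free3_vec; rewrite !scal01 invr_neq0.
by rewrite -tabdiag_A01; apply: (commalg3_orbit fr);
  rewrite /tabdiag; tab_field.
Qed.

Lemma tabdiag_degeneration l m x1 x2 y1 y2 z1 z2 : C (tabdiag l m x1 x2 y1 y2 z1 z2).
Proof.
pose g t := tabdiag (l + t) (m + t) x1 x2 y1 y2 z1 z2.
have -> : tabdiag l m x1 x2 y1 y2 z1 z2 = g 0 by rewrite /g !addr0.
apply: (closed_perturb (s := [:: - l; - m]) cC) => [|t]; first by rewrite /g /tabdiag; acurve_tac F.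
rewrite !inE negb_or => /andP[/add_neq0 l0 /add_neq0 m0]; rewrite /g {g}.
move: (l + t) (m + t) l0 m0 => {}l {}m l0 m0.
(* The first two vectors are idempotents. The correction of e3 removes the e1-part of e1 e3 and the
   e2-part of e2 e3, and Z1, Z2 are the coordinates of its new square. *)
have fr : free3 (vec l^-1 0 0) (vec 0 m^-1 0) (vec (- (x1 / l)) (- (y2 / m)) 1).
  apply: free3_vec; rewrite !scal01.
  by rewrite mulf_neq0 ?invr_neq0.
pose Z1 := l * (z1 - 2%:R * x1 * (x1 / l) - 2%:R * y1 * (y2 / m) + x1 ^+ 2 / l).
pose Z2 := m * (z2 - 2%:R * x2 * (x1 / l) - 2%:R * y2 * (y2 / m) + y2 ^+ 2 / m).
apply: (GLstable_orbit sC (tabdiag_scaled (x2 / l * m) (y1 / m * l) Z1 Z2)).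
apply: (commalg3_orbit fr); rewrite /tabdiag /Z1 /Z2; tab_field;
  by rewrite ?l0 ?m0.
Qed.

(* On the plane, x - b and x - a, times x, are orthogonal eigenvectors. *)
Lemma tabplane_degeneration a b x1 x2 y1 y2 z1 z2 : C (tabplane a b x1 x2 y1 y2 z1 z2).
Proof.
pose g t := tabplane (a + t) (b + 2%:R * t) x1 x2 y1 y2 z1 z2.
have -> : tabplane a b x1 x2 y1 y2 z1 z2 = g 0 by rewrite /g !mulr0 !addr0.
apply: (closed_perturb (s := [:: a - b]) cC) => [|t]; first by rewrite /g /tabplane; acurve_tac F.
rewrite inE => tab; rewrite /g {g}.
have {}tab : (a + t) - (b + 2%:R * t) != 0.
  by apply: contraNneq tab => E; apply/eqP; apply: (eq_via_sub (esym E)); ring.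
move: (a + t) (b + _) tab => {}a {}b ab.
have fr : free3 (vec (- b) 1 0) (vec (- a) 1 0) (vec 0 0 1).
  apply: free3_vec; rewrite !scal01.
  by rewrite opprK addrC.
apply: (GLstable_orbit sC (tabdiag_degeneration (a ^+ 2 - a * b) (b ^+ 2 - a * b)
  ((y1 - b * x1 + a * (y2 - b * x2)) / (a - b)) (- (y1 - b * x1 + b * (y2 - b * x2)) / (a - b))
  ((y1 - a * x1 + a * (y2 - a * x2)) / (a - b)) (- (y1 - a * x1 + b * (y2 - a * x2)) / (a - b))
  ((z1 + a * z2) / (a - b)) (- (z1 + b * z2) / (a - b)))).
apply: (commalg3_orbit fr); rewrite /tabdiag /tabplane; by tab_field.
Qed.

Lemma tabnil_degeneration n x y z : C (commalg3 0 (vec n 0 0) (vec z 0 0) 0 (vec x 0 0) (vec y 0 0)).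
Proof.
pose g t := commalg3 (vec 0 0 0) (vec (n + t) 0 0) (vec z 0 0) (vec 0 0 0) (vec x 0 0) (vec y 0 0).
have -> : commalg3 0 (vec n 0 0) (vec z 0 0) 0 (vec x 0 0) (vec y 0 0) = g 0.
  by rewrite /g addr0 /vec !scale0r !addr0.
apply: (closed_perturb (s := [:: - n]) cC) => [|t]; first by rewrite /g; acurve_tac F.
rewrite inE => /add_neq0 n0; rewrite /g {g}; move: (n + t) n0 => {}n n0.
(* e2 generates the plane: its square is n e1 and its cube is 0, so both roots of [tabplane] are
   0. *)
have fr : free3 (vec 0 1 0) (vec n 0 0) (vec 0 0 1).
  apply: free3_vec; rewrite !scal01.
  by rewrite oppr_eq0.
apply: (GLstable_orbit sC (tabplane_degeneration 0 0 0 (y / n) 0 x 0 (z / n))).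
by apply: (commalg3_orbit fr); rewrite /tabplane; tab_field.
Qed.

End C7.

Section C6.
Variable C : set (algstr F 3).
Hypotheses (cC : closed C) (sC : GLstable C) (CJ : forall a, C (calJ01 a)).

Lemma tabline_normal y z1 z2 : y != 0 -> C (tabline 1 0 0 y 0 z1 z2).
Proof.
move=> y0; pose g t := tabline 1 0 0 y 0 (z1 + t) z2.
have -> : tabline 1 0 0 y 0 z1 z2 = g 0 by rewrite /g addr0.
apply: (closed_perturb (s := [:: - z1]) cC) => [|t]; first by rewrite /g /tabline; acurve_tac F.
rewrite inE => /add_neq0; have [s sE] := sqrt_ex (z1 + t).
rewrite /g -sE expf_eq0 /= => s0.
apply: (GLstable_orbit sC (CJ (z2 / s ^+ 2 * (y / s)))).
have fr : free3 (vec 1 0 0) (vec 0 (s / y) 0) (vec 0 0 (s^-1)).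
  apply: free3_vec; rewrite !scal01.
  by rewrite !mulf_neq0 ?invr_neq0.
rewrite -tabline_calJ01; apply: (commalg3_orbit fr);
  rewrite /tabline; tab_field; by rewrite ?s0 ?y0.
Qed.

Lemma tabline_idem y1 y2 z1 z2 : y1 != 0 -> C (tabline 1 0 0 y1 y2 z1 z2).
Proof.
move=> y0; have three0 : 3%:R != 0 :> F by rewrite pnatr_eq0.
(* f = e1 + k e2 is idempotent for every k. The values p and q make f annihilate e3 - p f - q e2,
   and the e2-part of e2 (e3 - p f - q e2) is then y2 - 3/2 k y1; this choice of k makes it
   vanish. *)
have [k kE] : exists k, k = 2%:R * y2 / (3%:R * y1) by eexists.
have y2E : y2 = 3%:R * y1 * k / 2%:R by rewrite kE; field.
pose p := k * y1; pose q := 2%:R * (k * y2 - k ^+ 2 * y1).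
have fr : free3 (vec 1 k 0) (vec 0 1 0) (vec (- p) (- (p * k + q)) 1).
  apply: free3_vec; rewrite !scal01.
  exact: oner_neq0.
apply: (GLstable_orbit sC (tabline_normal (z1 - p ^+ 2 - 2%:R * q * y1)
  (z2 - k * z1 - 2%:R * q * (y2 - k * y1)) y0)).
apply: (commalg3_orbit fr); rewrite /tabline /q /p y2E; by tab_field.
Qed.

Lemma tabline_degeneration a x1 x2 y1 y2 z1 z2 : C (tabline a x1 x2 y1 y2 z1 z2).
Proof.
pose g t := tabline (a + t) x1 x2 (y1 + t) y2 z1 z2.
have -> : tabline a x1 x2 y1 y2 z1 z2 = g 0 by rewrite /g !addr0.
apply: (closed_perturb (s := [:: - a; - y1]) cC) => [|t].
  by rewrite /g /tabline; acurve_tac F.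
rewrite !inE negb_or => /andP[/add_neq0 a0 /add_neq0 y0]; rewrite /g {g}.
move: (a + t) (y1 + t) a0 y0 => {}a {}y1 a0 y0.
(* The third vector is annihilated by e1, since e1 e1 = a e1 and e1 e2 = (a / 2) e2. *)
have fr : free3 (vec a^-1 0 0) (vec 0 1 0) (vec (- (x1 / a)) (- (2%:R * x2 / a)) 1).
  apply: free3_vec; rewrite !scal01.
  by rewrite invr_neq0.
apply: (GLstable_orbit sC (tabline_idem (y2 - x1 / 2%:R)
  (a * z1 - x1 ^+ 2 - 4%:R * x2 * y1) (z2 - 4%:R * x2 * y2 / a) (mulf_neq0 a0 y0))).
apply: (commalg3_orbit fr); rewrite /tabline; by tab_field.
Qed.

End C6.
End PlaneAlgebras.

Section Square.
Variables (F : fieldType) (n : nat) (mu : algstr F n).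
Implicit Types (x y z : 'cV[F]_n).

Lemma asquare_mul x y : asquare mu (amul mu x y).
Proof.
by exists 1%N, (fun=> 1), (fun=> x), (fun=> y); rewrite big_ord1 scale1r.
Qed.

Lemma asquare_ind (P : 'cV[F]_n -> Prop) :
  P 0 -> (forall x y, P x -> P y -> P (x + y)) ->
  (forall c x y, P (c *: amul mu x y)) -> forall z, asquare mu z -> P z.
Proof.
move=> P0 PD PM _ [m [c [u [v ->]]]].
by elim/big_ind: _ => // i _; apply: PM.
Qed.

Lemma asquare_add x y : asquare mu x -> asquare mu y -> asquare mu (x + y).
Proof.
move=> [m [c [u [v ->]]]] [m' [c' [u' [v' ->]]]].
pose f T (a : 'I_m -> T) (b : 'I_m' -> T) (t : 'I_(m + m')) :=
  match split t with inl i => a i | inr j => b j end.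
exists (m + m')%N, (f _ c c'), (f _ u u'), (f _ v v').
rewrite big_split_ord /=; congr (_ + _); apply: eq_bigr => i _; rewrite /f.
  by rewrite (unsplitK (inl i)).
by rewrite (unsplitK (inr i)).
Qed.

Lemma asquare_scale k x : asquare mu x -> asquare mu (k *: x).
Proof.
move=> [m [c [u [v ->]]]]; exists m, (fun t => k * c t), u, v.
by rewrite scaler_sumr; apply: eq_bigr => i _; rewrite scalerA.
Qed.

End Square.

(** * Algebras of the variety with A^2 different from A *)

Section NonFull.
Variables (F : numClosedFieldType) (mu : algstr F 3).
Local Notation "x ** y" := (amul mu x y) (at level 40, left associativity).
Local Notation half := (2%:R^-1 : F).
Implicit Types (x y z u v w : 'cV[F]_3).

Lemma not_full_plane : ~ full mu -> exists u v w, free3 u v w /\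
  forall x y, exists a b, x ** y = a *: u + b *: v.
Proof.
move=> /existsNP[l /not_implyP[lmu l0]].
pose f x := (l *m x) 0 0.
have fD x y : f (x + y) = f x + f y by rewrite /f mulmxDr mxE.
have fZ c x : f (c *: x) = c * f x by rewrite /f -scalemxAr mxE.
have [w0 fw0] : exists w, f w != 0.
  apply: contrapT => /forallNP H; apply: l0; apply/rowP => i; rewrite mxE.
  have /negP/negPn/eqP := H (delta_mx i 0); rewrite /f -[RHS]/(0 : F) => <-.
  by rewrite -colE mxE.
have [w fw] : exists w, f w = 1.
  by exists ((f w0)^-1 *: w0); rewrite fZ mulVf.
have wn0 : w != 0.
  apply/eqP => wE; have := oner_eq0 F.
  by rewrite -fw wE -(scale0r (0 : 'cV_3)) fZ mul0r eqxx.
have [a fwa] := free2_ext wn0; have [b fr] := free3_ext fwa.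
have [u uE] : exists u, u = a - f a *: w by eexists.
have [v vE] : exists v, v = b - f b *: w by eexists.
have f0 (c : 'cV_3) : f (c - f c *: w) = 0 by rewrite fD -scaleNr fZ fw mulr1 subrr.
have fru : free3 u v w.
  apply: (free3_det fr (a1 := - f a) (b1 := 1) (c1 := 0) (a2 := - f b) (b2 := 0) (c2 := 1)
    (a3 := 1) (b3 := 0) (c3 := 0)); rewrite ?uE ?vE; try vring.
  by rewrite !scal01 opprK oner_eq0.
exists u, v, w; split=> // x y.
have [p [q [r xyE]]] := free3_span (x ** y) fru; exists p, q.
have : f (x ** y) = 0 by rewrite /f lmu mxE.
rewrite xyE !fD !fZ fw uE vE !f0 !mulr0 !add0r mulr1 => ->.
by rewrite scale0r addr0.
Qed.

Hypotheses (muC : acommutative mu) (muD : jordan_identity_on mu (asquare mu)).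
Variables (C6 C7 : set (algstr F 3)).
Hypotheses (cC6 : closed C6) (sC6 : GLstable C6) (C6J : forall a, C6 (calJ01 a)).
Hypotheses (cC7 : closed C7) (sC7 : GLstable C7) (C7A : forall a b g, C7 (A01 a b g)).

(** The Jordan identity at x gives x^2 x^2 = x (x x^2), so the product on the plane is determined by
    the equation x x^2 = c x + d x^2. *)
Lemma plane_cyclic x w : asquare mu x -> free3 x (x ** x) w ->
  (forall y z, exists a b, y ** z = a *: x + b *: (x ** x)) -> C7 mu.
Proof.
move=> Ax fr plane; have [z zE] : exists z, z = x ** x by eexists.
have [c [d x3]] := plane x z.
rewrite -zE in fr plane x3.
have zz : z ** z = c *: z + d *: (x ** z).
  have := muD Ax Ax; rewrite -zE (muC z x) x3 => <-.
  by rewrite !bilE -zE (muC z x) x3.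
(* a and d - a are the roots of T^2 - d T - c, the two parameters of [tabplane]. *)
have [a aE] : exists a : F, a ^+ 2 = d * a + c.
  have [a aE] := @solve_monicpoly F 2 (fun i => nth 0 [:: c; d] i) isT.
  by exists a; rewrite aE !big_ord_recl big_ord0 /= /bump /=; ring.
have cE : c = - (a * (d - a)) by apply: (eq_via_sub (esym aE)); ring.
have dE : d = a + (d - a) by ring.
move: (d - a) cE dE => b cE dE.
have [x1 [x2 xw]] := plane x w; have [y1 [y2 zw]] := plane z w.
have [z1 [z2 ww]] := plane w w.
apply: (GLstable_orbit sC7 (tabplane_degeneration cC7 sC7 C7A a b x1 x2 y1 y2 z1 z2)).
apply: (table_orbit muC fr); rewrite frameE !vec_coord.
- by rewrite -zE; vring.
- by rewrite zz x3 cE dE; vring.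
- by rewrite ww; vring.
- by rewrite x3 cE dE; vring.
- by rewrite xw; vring.
- by rewrite zw; vring.
Qed.

(** Evaluating x^2 = t(x) x at u + v and u - v gives 2 u v = t(v) u + t(u) v. If t is nonzero on the
    basis, a second basis vector with square zero is obtained by subtraction, which is the shape of
    [tabline]; if t = 0 the plane has zero product. *)
Lemma plane_proportional u v w : free3 u v w -> asquare mu u -> asquare mu v ->
  (forall y z, exists a b, y ** z = a *: u + b *: v) ->
  (forall x, asquare mu x -> exists t, x ** x = t *: x) -> C6 mu.
Proof.
move=> fr Au Av plane sq.
have [tu uu] := sq u Au; have [tv vv] := sq v Av.
have [t1 E1] := sq _ (asquare_add Au Av).
have [t2 E2] := sq _ (asquare_add Au (asquare_scale (-1) Av)).
rewrite scaleN1r in E2.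
rewrite !bilE (muC v u) uu vv in E1 E2.
have [|s1 s2 _] := free3_zero (a := 2%:R * tu - t1 - t2) (b := 2%:R * tv - t1 + t2)
    (c := 0) fr.
  by apply: (eq_via_sub (f_equal2 +%R E1 E2)); vring.
have t1E : t1 = tu + tv.
  have E : 2%:R * tu - t1 - t2 + (2%:R * tv - t1 + t2) = 0 by rewrite s1 s2 addr0.
  by apply: (eq_via_sub (congr1 (fun z : F => - half * z) E)); field.
have uv : u ** v = (half * tv) *: u + (half * tu) *: v.
  by rewrite t1E in E1; apply: (eq_via_sub (congr1 (fun z => half *: z) E1)); vfield.
have conclude u' v' t t' : free3 u' v' w -> u' ** u' = t *: u' -> v' ** v' = t' *: v' ->
    u' ** v' = (half * t') *: u' + (half * t) *: v' -> t != 0 ->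
    (forall y z, exists a b, y ** z = a *: u' + b *: v') -> C6 mu.
  move=> fr' uu' vv' uv' t0 plane'.
  have [v2 v2E] : exists v2, v2 = v' - (t' / t) *: u' by eexists.
  have fr2 : free3 u' v2 w.
    apply: (free3_det fr' (a1 := 1) (b1 := 0) (c1 := 0) (a2 := - (t' / t)) (b2 := 1)
      (c2 := 0) (a3 := 0) (b3 := 0) (c3 := 1)); rewrite ?v2E; try vring.
    by rewrite !scal01 oner_eq0.
  have plane2 y z : exists a b, y ** z = a *: u' + b *: v2.
    have [a [b ->]] := plane' y z; exists (a + b * (t' / t)), b.
    by rewrite v2E; vring.
  have [x1 [x2 xw]] := plane2 u' w; have [y1 [y2 yw]] := plane2 v2 w.
  have [z1 [z2 ww]] := plane2 w w.
  apply: (GLstable_orbit sC6 (tabline_degeneration cC6 sC6 C6J t x1 x2 y1 y2 z1 z2)).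
  apply: (table_orbit muC fr2); rewrite frameE !vec_coord.
  - by rewrite uu'; vring.
  - by rewrite v2E !bilE (muC v' u') uu' vv' uv'; vfield.
  - by rewrite ww; vring.
  - by rewrite v2E !bilE uu' uv'; vfield.
  - by rewrite xw; vring.
  - by rewrite yw; vring.
have [tu0|tu0] := eqVneq tu 0; last exact: (conclude u v tu tv).
have [tv0|tv0] := eqVneq tv 0; last first.
  apply: (conclude v u tv tu) => //; first exact: free3_swap12.
    by rewrite muC uv addrC.
  by move=> y z; have [a [b ->]] := plane y z; exists b, a; rewrite addrC.
have [x1 [x2 xw]] := plane u w; have [y1 [y2 yw]] := plane v w.
have [z1 [z2 ww]] := plane w w.
apply: (GLstable_orbit sC6 (tabline_degeneration cC6 sC6 C6J 0 x1 x2 y1 y2 z1 z2)).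
apply: (table_orbit muC fr); rewrite frameE !vec_coord.
- by rewrite uu tu0; vring.
- by rewrite vv tv0; vring.
- by rewrite ww; vring.
- by rewrite uv tu0 tv0; vring.
- by rewrite xw; vring.
- by rewrite yw; vring.
Qed.

(** The product is a symmetric bilinear form with values in the line of z. If z is isotropic, a
    further vector orthogonal to it gives the table of [tabnil_degeneration]. Otherwise the
    orthogonal complement of z contains an isotropic vector, F being algebraically closed, and the
    table is [tabdiag] with m = 0. *)
Lemma line_isotropic z : z != 0 -> (forall x y, exists b, x ** y = b *: z) -> C7 mu.
Proof.
move=> z0 line; have [p frzp] := free2_ext z0; have [q fr] := free3_ext frzp.
have [l zz] := line z z; have [a zp] := line z p; have [b zq] := line z q.
have [l0|l0] := eqVneq l 0.
  have nil x y : free3 z x y -> z ** x = 0 -> C7 mu.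
    move=> frx zx; have [n xx] := line x x; have [c zy] := line z y.
    have [d xy] := line x y; have [k yy] := line y y.
    apply: (GLstable_orbit sC7 (tabnil_degeneration cC7 sC7 C7A n c d k)).
    apply: (table_orbit muC frx); rewrite frameE ?vec_coord ?cv0E.
    - by rewrite zz l0; vring.
    - by rewrite xx; vring.
    - by rewrite yy; vring.
    - by rewrite zx; vring.
    - by rewrite zy; vring.
    - by rewrite xy; vring.
  have [a0|a0] := eqVneq a 0; first by apply: (nil p q) => //; rewrite zp a0 scale0r.
  apply: (nil (q - (b / a) *: p) p).
    apply: (free3_det fr (a1 := 1) (b1 := 0) (c1 := 0) (a2 := 0) (b2 := - (b / a))
      (c2 := 1) (a3 := 0) (b3 := 1) (c3 := 0)); try vring.
    by rewrite !scal01 oppr_eq0 oner_eq0.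
  by rewrite !bilE zp zq; vfield.
have iso x y : free3 z x y -> z ** x = 0 -> x ** x = 0 -> C7 mu.
  move=> frx zx xx; have [c zy] := line z y.
  have [d xy] := line x y; have [k yy] := line y y.
  apply: (GLstable_orbit sC7 (tabdiag_degeneration cC7 sC7 C7A l 0 c 0 d 0 k 0)).
  apply: (table_orbit muC frx); rewrite frameE ?vec_coord ?cv0E.
  - by rewrite zz; vring.
  - by rewrite xx; vring.
  - by rewrite yy; vring.
  - by rewrite zx; vring.
  - by rewrite zy; vring.
  - by rewrite xy; vring.
have [p' p'E] : exists p', p' = p - (a / l) *: z by eexists.
have [q' q'E] : exists q', q' = q - (b / l) *: z by eexists.
have zp' : z ** p' = 0 by rewrite p'E !bilE zp zz; vfield.
have zq' : z ** q' = 0 by rewrite q'E !bilE zq zz; vfield.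
have fr' : free3 z p' q'.
  apply: (free3_det fr (a1 := 1) (b1 := 0) (c1 := 0) (a2 := - (a / l)) (b2 := 1)
    (c2 := 0) (a3 := - (b / l)) (b3 := 0) (c3 := 1)); rewrite ?p'E ?q'E; try vring.
  by rewrite !scal01 oner_eq0.
have [al pp] := line p' p'; have [be pq] := line p' q'; have [ga qq] := line q' q'.
have [al0|al0] := eqVneq al 0; first by apply: (iso p' q') => //; rewrite pp al0 scale0r.
have [s sE] : exists s : F, al * s ^+ 2 + 2%:R * be * s + ga = 0.
  have [s sE] := @solve_monicpoly F 2 (fun i => nth 0 [:: - ga / al; - (2%:R * be) / al] i) isT.
  by exists s; rewrite sE !big_ord_recl big_ord0 /= /bump /=; field.
apply: (iso (q' + s *: p') p').
- apply: (free3_det fr' (a1 := 1) (b1 := 0) (c1 := 0) (a2 := 0) (b2 := s)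
    (c2 := 1) (a3 := 0) (b3 := 1) (c3 := 0)); try vring.
  by rewrite !scal01 oppr_eq0 oner_eq0.
- by rewrite !bilE zp' zq' scaler0 addr0.
- rewrite !bilE (muC q' p') pp pq qq -[RHS](scale0r z) -sE; vring.
Qed.

(** Three cases: A^2 contains some x with x and x^2 independent; or it is a plane in which all
    squares are proportional to their argument; or it has dimension at most one. In the first two,
    independent elements of A^2 span the plane of all products. *)
Lemma not_full_components : ~ full mu -> C6 mu \/ C7 mu.
Proof.
move=> /not_full_plane[u [v [w [fr plane]]]].
have Aplane x : asquare mu x -> exists a b, x = a *: u + b *: v.
  move=> Ax; pattern x; apply: (asquare_ind _ _ _ Ax).
  - by exists 0, 0; vring.
  - by move=> _ _ [a [b ->]] [c [d ->]]; exists (a + c), (b + d); vring.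
  - by move=> c y z; have [a [b ->]] := plane y z; exists (c * a), (c * b); vring.
have Afree x y : asquare mu x -> asquare mu y -> free2 x y ->
    exists z, free3 x y z /\ forall p q, exists a b, p ** q = a *: x + b *: y.
  move=> Ax Ay fxy; have [z frz] := free3_ext fxy; exists z; split=> // p q.
  have [a [b [c pqE]]] := free3_span (p ** q) frz; exists a, b.
  suff c0 : c = 0 by rewrite pqE c0 scale0r addr0.
  apply: contrapT => /eqP c0.
  have span t : exists k : 'I_2 -> F, t = \sum_i k i *: (if i == ord0 then u else v).
    have {}Aplane2 s : (exists a b, s = a *: u + b *: v) ->
        exists k : 'I_2 -> F, s = \sum_i k i *: (if i == ord0 then u else v).
      move=> [a' [b' ->]]; exists (fun i => if i == ord0 then a' else b').
      by rewrite !big_ord_recl big_ord0 addr0.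
    apply: Aplane2; have [x1 [x2 [x3 ->]]] := free3_span t frz.
    have [xu [xv xE]] := Aplane x Ax; have [yu [yv yE]] := Aplane y Ay.
    have [pu [pv pE]] := plane p q.
    have zE : z = c^-1 *: (p ** q - a *: x - b *: y) by rewrite pqE; vfield.
    rewrite zE pE xE yE.
    exists (x1 * xu + x2 * yu + x3 * (c^-1 * (pu - a * xu - b * yu))).
    exists (x1 * xv + x2 * yv + x3 * (c^-1 * (pv - a * xv - b * yv))).
    by vring.
  exact: rank_span span.
have [[x [Ax fx]]|/forallNP nx] := pselect (exists x, asquare mu x /\ free2 x (x ** x)).
  have [z [frz plz]] := Afree x (x ** x) Ax (asquare_mul _ _ _) fx.
  by right; apply: (plane_cyclic Ax frz plz).
have sq x : asquare mu x -> exists t, x ** x = t *: x.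
  move=> Ax; have [->|x0] := eqVneq x 0; first by exists 0; rewrite amul0l scaler0.
  by apply: nfree2 => // fx; apply: (nx x).
have [[x [y [Ax Ay fxy]]]|nfree] :=
    pselect (exists x y, [/\ asquare mu x, asquare mu y & free2 x y]).
  have [z [frz plz]] := Afree x y Ax Ay fxy.
  by left; apply: (plane_proportional frz Ax Ay plz sq).
right; have [[z [Az z0]]|/forallNP Az0] := pselect (exists z, asquare mu z /\ z != 0).
  apply: (line_isotropic z0) => x y.
  have [//|t ->] := @nfree2 _ z (x ** y) z0.
    by move=> fzxy; apply: nfree; exists z, (x ** y); split=> //; apply: asquare_mul.
  by exists t.
apply: (line_isotropic (e1_neq0 F)) => x y; exists 0; rewrite scale0r.
apply/eqP; apply: contrapT => /negP xy0; apply: (Az0 (x ** y)).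
by split=> //; apply: asquare_mul.
Qed.

Lemma full_jordan : full mu -> jordan mu.
Proof.
move=> muF.
have A x : asquare mu x.
  (* Row 3 k + l is the product of the basis vectors of indices k and l. A linear form killing all
     rows is zero by [muF], so the rows span the whole space. *)
  pose M : 'M[F]_(9, 3) := \matrix_(i < 9, j < 3)
    (delta_mx (inord (i %/ 3) : 'I_3) 0 ** delta_mx (inord (i %% 3) : 'I_3) 0) j 0.
  have rfM : row_full M.
    rewrite -cokermx_eq0 -trmx_eq0; apply/eqP/row_matrixP => i; rewrite row0.
    apply: muF => y z.
    have dd k l : row i (cokermx M)^T *m (delta_mx k 0 ** delta_mx l 0) = 0.
      have := congr1 (fun A : 'M_(9, 3) => (row (inord (3 * k + l)) A)^T) (mulmx_coker M).
      rewrite row_mul trmx_mul row0 trmx0 => /(congr1 (row i)); rewrite row_mul row0.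
      have -> : (row (inord (3 * k + l)) M)^T = delta_mx k 0 ** delta_mx l 0; last by [].
      apply/colP => j; rewrite mxE mxE mxE.
      have kl : (inord (3 * k + l) : 'I_9) = (3 * k + l)%N :> nat.
        by rewrite inordK //; case: k l => [[|[|[|k]]] Hk] [[|[|[|l]]] Hl].
      rewrite kl mulnC divnMDl // modnMDl divn_small // addn0 modn_small //.
      by rewrite !inord_val.
    rewrite (col_delta y) (col_delta z) amul_suml mulmx_sumr big1 // => k _.
    rewrite amul_sumr mulmx_sumr big1 // => l _.
    by rewrite amulZl amulZr -!scalemxAr dd !scaler0.
  have /submxP[D xE] : (x^T <= M)%MS by rewrite submx_full.
  exists 9%N, (fun i => D 0 i), (fun i => delta_mx (inord (i %/ 3)) 0),
    (fun i => delta_mx (inord (i %% 3)) 0).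
  rewrite -[x]trmxK xE; apply/colP => j; rewrite !mxE summxE.
  by apply: eq_bigr => i _; rewrite cvZE mxE.
by move=> x y; apply: muD; apply: A.
Qed.

End NonFull.

(** * Invariants *)

Section Invariants.
Variable F : numClosedFieldType.
Local Notation half := (2%:R^-1 : F).
Implicit Types (mu K : algstr F 3) (x y z u v w : 'cV[F]_3) (g : 'M[F]_3).

Definition Lmx mu x : 'M[F]_3 := \matrix_(i, j) amul mu x (delta_mx j 0) i 0.

Lemma LmxE mu x y : Lmx mu x *m y = amul mu x y.
Proof.
rewrite [in RHS](col_delta y) amul_sumr; apply/colP => i; rewrite mxE summxE.
by apply: eq_bigr => j _; rewrite amulZr cvZE mxE mulrC.
Qed.

Definition tau mu x := \tr (Lmx mu x).

(** For nonzero c it vanishes exactly when the trace of multiplication by x is c times one of its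
    eigenvalues. *)
Definition specdet (c : F) mu x := \det ((tau mu x)%:M - c *: Lmx mu x).

Definition assoc mu x y z := amul mu (amul mu x y) z - amul mu x (amul mu y z).

Definition gram mu : 'M[F]_3 :=
  \matrix_(i, j) tau mu (amul mu (delta_mx i 0) (delta_mx j 0)).

Lemma mxE_delta (A B : 'M[F]_3) : (forall x : 'cV_3, A *m x = B *m x) -> A = B.
Proof.
move=> H; apply/matrixP => i j.
by have := congr1 (fun x : 'cV_3 => x i 0) (H (delta_mx j 0)); rewrite -!colE !mxE.
Qed.

Lemma Lmx_gact g K x : g \in unitmx ->
  Lmx (gact g K) x = g *m Lmx K (invmx g *m x) *m invmx g.
Proof.
by move=> gu; apply: mxE_delta => y; rewrite -!mulmxA !LmxE amul_gact.
Qed.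

Lemma tau_gact g K x : g \in unitmx -> tau (gact g K) x = tau K (invmx g *m x).
Proof. by move=> gu; rewrite /tau Lmx_gact // mxtrace_mulC mulKmx. Qed.

Lemma specdet_gact c g K x : g \in unitmx ->
  specdet c (gact g K) x = specdet c K (invmx g *m x).
Proof.
move=> gu; rewrite /specdet tau_gact // Lmx_gact //.
have -> : (tau K (invmx g *m x))%:M - c *: (g *m Lmx K (invmx g *m x) *m invmx g) =
    g *m ((tau K (invmx g *m x))%:M - c *: Lmx K (invmx g *m x)) *m invmx g.
  rewrite mulmxBr mulmxBl mul_mx_scalar -scalemxAl mulmxV // scalemx1.
  by rewrite -scalemxAr -scalemxAl.
rewrite !det_mulmx det_inv mulrAC mulfV ?mul1r //.
by move: gu; rewrite unitmxE unitfE.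
Qed.

Lemma specdet_orbit c K mu : (forall x, specdet c K x = 0) -> GLorbit K mu ->
  forall x, specdet c mu x = 0.
Proof. by move=> H [g gu <-] x; rewrite specdet_gact. Qed.

Definition associative_alg mu := forall x y z, assoc mu x y z = 0.

Lemma assoc_gact g K x y z : g \in unitmx ->
  assoc (gact g K) x y z = g *m assoc K (invmx g *m x) (invmx g *m y) (invmx g *m z).
Proof. by move=> gu; rewrite /assoc !amul_gact !mulKmx // mulmxBr. Qed.

Definition assoc_line mu := exists v, forall x y z, exists t, assoc mu x y z = t *: v.

Lemma assoc_line_orbit K mu : assoc_line K -> GLorbit K mu -> assoc_line mu.
Proof.
move=> [v H] [g gu <-]; exists (g *m v) => x y z.
have [t tE] := H (invmx g *m x) (invmx g *m y) (invmx g *m z).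
by exists t; rewrite assoc_gact // tE scalemxAr.
Qed.

Lemma associative_line mu : associative_alg mu -> assoc_line mu.
Proof. by move=> H; exists 0 => x y z; exists 0; rewrite H scaler0. Qed.

Lemma associative_orbit K mu : associative_alg K -> GLorbit K mu -> associative_alg mu.
Proof. by move=> H [g gu <-] x y z; rewrite assoc_gact // H mulmx0. Qed.

Definition null_ideal mu := exists v, [/\ v != 0, amul mu v v = 0 &
  forall y, exists t, amul mu v y = t *: v].

Lemma null_ideal_orbit K mu : null_ideal K -> GLorbit K mu -> null_ideal mu.
Proof.
move=> [v [v0 vv H]] [g gu <-]; exists (g *m v); split.
- by apply: contraNneq v0 => gv; rewrite -(mulKmx gu v) gv mulmx0.
- by rewrite amul_gactK // vv mulmx0.
- move=> y; have [t tE] := H (invmx g *m y); exists t.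
  by rewrite -{1}(mulKVmx gu y) amul_gactK // tE scalemxAr.
Qed.

(* Multiplication by v has rank one and square zero, so it is traceless; as
   v spans an ideal, v lies in the radical of the trace form. *)
Lemma null_ideal_gram mu : acommutative mu -> null_ideal mu -> \det (gram mu) = 0.
Proof.
move=> muC [v [v0 vv /choice[t tE]]].
pose r : 'rV[F]_3 := \row_j t (delta_mx j 0).
have Lv : Lmx mu v = v *m r.
  by apply/matrixP => i j; rewrite mxE tE !mxE big_ord1 !mxE mulrC.
have tv : tau mu v = 0.
  rewrite /tau Lv mxtrace_mulC /mxtrace big_ord1.
  have /eqP : (r *m v) 0 0 *: v = 0.
    rewrite -[RHS]vv -LmxE Lv -mulmxA [r *m v]mx11_scalar mul_mx_scalar mxE eqxx mulr1n //.
  by rewrite scaler_eq0 (negbTE v0) orbF => /eqP.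
have tauZ c x : tau mu (c *: x) = c * tau mu x.
  rewrite /tau -mxtraceZ; congr (\tr _); apply: mxE_delta => y.
  by rewrite -scalemxAl !LmxE amulZl.
have tauD x y : tau mu (x + y) = tau mu x + tau mu y.
  rewrite /tau -mxtraceD; congr (\tr _); apply: mxE_delta => z.
  by rewrite mulmxDl !LmxE amulDl.
have tau_sum (f : 'I_3 -> 'cV_3) : tau mu (\sum_i f i) = \sum_i tau mu (f i).
  apply: (big_morph (tau mu)) => //.
  by rewrite -(scale0r (0 : 'cV_3)) tauZ mul0r.
apply/eqP/negPn/negP => d0.
case/negP: v0; apply/eqP.
have gu : gram mu \in unitmx by rewrite unitmxE unitfE.
rewrite -(mulKmx gu v); suff -> : gram mu *m v = 0 by rewrite mulmx0.
apply/colP => i; rewrite mxE [RHS]mxE.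
transitivity (tau mu (amul mu (delta_mx i 0) v)).
  rewrite {2}(col_delta v) amul_sumr tau_sum; apply: eq_bigr => j _.
  by rewrite amulZr tauZ mxE mulrC.
by rewrite muC tE tauZ tv mulr0.
Qed.

(** The trace form has rank at most one: all its two by two Gram determinants vanish. *)
Definition tau_rank1 mu := forall x y,
  tau mu (amul mu x x) * tau mu (amul mu y y) = tau mu (amul mu x y) ^+ 2.

Lemma tau_rank1_orbit K mu : tau_rank1 K -> GLorbit K mu -> tau_rank1 mu.
Proof.
by move=> H [g gu <-] x y; rewrite !tau_gact // !amul_gact !mulKmx.
Qed.

Lemma tau3 mu x : tau mu x =
  amul mu x (e1 F) o0 0 + amul mu x (e2 F) o1 0 + amul mu x (e3 F) o2 0.
Proof.
rewrite /tau /mxtrace !big_ord_recl big_ord0 addr0 !mxE addrA.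
have -> : ord0 = o0 by apply: val_inj.
have -> : lift o0 (ord0 : 'I_2) = o1 by apply: val_inj.
by have -> : lift o0 (lift ord0 (ord0 : 'I_1)) = o2 by apply: val_inj.
Qed.

Lemma specdet3 c mu x :
  let t := tau mu x in
  let a i := amul mu x (e1 F) i 0 in let b i := amul mu x (e2 F) i 0 in
  let d i := amul mu x (e3 F) i 0 in
  specdet c mu x =
  (t - c * a o0) * ((t - c * b o1) * (t - c * d o2) - (c * d o1) * (c * b o2)) -
  (- (c * b o0)) * (- (c * a o1) * (t - c * d o2) - (c * d o1) * (c * a o2)) +
  (- (c * d o0)) * ((c * a o1) * (c * b o2) - (t - c * b o1) * - (c * a o2)).
Proof. by rewrite /specdet det3 !mxE /= -/(e1 F) -/(e2 F) -/(e3 F); ring. Qed.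

End Invariants.

(** * Values of the invariants on the tables *)

Section TableInvariants.
Variable F : numClosedFieldType.
Local Notation half := (2%:R^-1 : F).
Implicit Types (mu K : algstr F 3) (x y z u v w : 'cV[F]_3).

Lemma vec_eta x : x = vec (x o0 0) (x o1 0) (x o2 0).
Proof. exact: vecE. Qed.

Ltac spec_tac := rewrite specdet3 /= tau3; inv_norm.

(** Let t be the e1-coordinate of x. Here t is an eigenvalue and the trace is 3 t. For [tabhalf],
    [tab16] and [J14] below the eigenvalues are t, t/2, 0, then t, t/2, t, then t, t/2, t/2, which
    explains the constants 3, 5/2 and 2. *)
Lemma tabquad_spec n m p x : specdet 3%:R (tabquad n m p) x = 0.
Proof. by rewrite (vec_eta x) /tabquad; spec_tac; ring. Qed.

Lemma tabhalf_spec x : specdet 3%:R (tabhalf F) x = 0.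
Proof. by rewrite (vec_eta x) /tabhalf; spec_tac; field. Qed.

Lemma tab16_spec (b : F) x : specdet (5%:R / 2%:R) (tab16 b) x = 0.
Proof. by rewrite (vec_eta x) /tab16; spec_tac; field. Qed.

Lemma J14_spec x : specdet 2%:R (J14 F) x = 0.
Proof. by rewrite (vec_eta x) /J14; spec_tac; field. Qed.

Lemma J14_rank1 : tau_rank1 (J14 F).
Proof.
by move=> x y; rewrite (vec_eta x) (vec_eta y) /J14 !tau3; inv_norm; field.
Qed.

Lemma tab16_rank1 (b : F) : tau_rank1 (tab16 b).
Proof.
by move=> x y; rewrite (vec_eta x) (vec_eta y) /tab16 !tau3; inv_norm; field.
Qed.

Lemma J19_assoc_line : assoc_line (J19 F).
Proof.
exists (vec 0 0 1) => x y z; rewrite (vec_eta x) (vec_eta y) (vec_eta z) /J19 /assoc.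
exists (assoc (J19 F) x y z o2 0).
rewrite [in RHS](vec_eta x) [in RHS](vec_eta y) [in RHS](vec_eta z) /J19 /assoc.
by inv_norm; congr vec; field.
Qed.

Lemma tab16_assoc_line : assoc_line (tab16 (0 : F)).
Proof.
exists (vec 0 1 0) => x y z; exists (assoc (tab16 0) x y z o1 0).
rewrite (vec_eta x) (vec_eta y) (vec_eta z) /tab16 /assoc.
by inv_norm; congr vec; field.
Qed.

Lemma J07_assoc : associative_alg (J07 F).
Proof.
move=> x y z; rewrite (vec_eta x) (vec_eta y) (vec_eta z) /J07 /assoc.
by inv_norm; congr vec; ring.
Qed.

Lemma afun_amul (x y : algstr F 3 -> 'cV[F]_3) k :
  (forall i, afun (fun mu => x mu i 0)) -> (forall i, afun (fun mu => y mu i 0)) ->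
  afun (fun mu => amul mu (x mu) (y mu) k 0).
Proof.
move=> Hx Hy; apply: (fs_amul (afun_subalg F 3)) => [t|i j|i j].
- exact: afun_coord.
- by rewrite ord1.
- by rewrite ord1.
Qed.

Lemma afun_cst (c : F) : afun (fun _ : algstr F 3 => c).
Proof. exact: (fsC (afun_subalg F 3)). Qed.

Lemma afun_amul_cst x y k : afun (fun mu => amul mu x y k 0).
Proof. by apply: afun_amul => i; apply: afun_cst. Qed.

Lemma afun_assoc x y z k : afun (fun mu => assoc mu x y z k 0).
Proof.
under eq_fun do rewrite /assoc cvDE cvNE.
apply: (fsB (afun_subalg F 3)); apply: afun_amul => i.
- exact: afun_amul_cst.
- exact: afun_cst.
- exact: afun_cst.
- exact: afun_amul_cst.
Qed.

Lemma associative_closed : closed [set mu : algstr F 3 | associative_alg mu].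
Proof.
have := @closed_zeros F 3 ('cV[F]_3 * 'cV[F]_3 * 'cV[F]_3 * 'I_3)
  (fun t mu => assoc mu t.1.1.1 t.1.1.2 t.1.2 t.2 0) (fun t => afun_assoc _ _ _ _).
congr closed; apply/seteqP; split=> mu /= H.
  by move=> x y z; apply/colP => k; rewrite (H (x, y, z, k)) cv0E.
by move=> [[[x y] z] k]; rewrite H cv0E.
Qed.

(** Associativity is a closed and invariant condition, so it is inherited from [J07]. *)
Lemma tabpow_assoc (a b c : F) : associative_alg (tabpow a b c).
Proof.
apply: (tabpow_degeneration associative_closed) => [g mu gu H|]; last exact: J07_assoc.
by apply: (associative_orbit H); exists g.
Qed.

Lemma vec_neq0 (a b c : F) : [|| a != 0, b != 0 | c != 0] -> vec a b c != 0.
Proof.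
move=> H; apply/eqP => E; have V k : vec a b c k 0 = 0 by rewrite E cv0E.
by move: H (V o0) (V o1) (V o2); rewrite !vec_coord => H a0 b0 c0; rewrite a0 b0 c0 eqxx in H.
Qed.

(** The vector x (x - b) (x - c) spans an ideal, and its square is a (a - b) (a - c) times
    itself. *)
Lemma tabpow_null (a b c : F) : a * (a - b) * (a - c) = 0 -> null_ideal (tabpow a b c).
Proof.
move=> E; exists (vec (b * c) (- (b + c)) 1); split.
- by rewrite vec_neq0 // oner_eq0 !orbT.
- rewrite tabpow_eigen !vec_coord.
  suff -> : a * (b * c) + a ^+ 2 * - (b + c) + a ^+ 3 * 1 = 0 by rewrite scale0r.
  by rewrite -[RHS]E; ring.
- by move=> y; rewrite tabpow_eigen; eexists.
Qed.

Lemma tabpow_gram (a b c : F) mu : GLorbit (tabpow a b c) mu -> \det (gram mu) != 0 ->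
  acommutative mu -> GLorbit (J07 F) mu.
Proof.
move=> Kmu d0 muC; apply: GLorbit_trans (Kmu).
have nn : ~ null_ideal (tabpow a b c).
  by move=> N; case/eqP: d0; apply: null_ideal_gram => //; apply: null_ideal_orbit Kmu.
have n1 : a * (a - b) * (a - c) != 0 by apply/eqP => /tabpow_null.
have n2 : b * (b - a) * (b - c) != 0.
  by apply/eqP => /tabpow_null; rewrite tabpow_swap12.
have n3 : c * (c - b) * (c - a) != 0.
  by apply/eqP => /tabpow_null; rewrite tabpow_swap13.
move: n1 n2 n3; rewrite !mulf_eq0 !negb_or !subr_eq0.
move=> /andP[/andP[a0 ab] ac] /andP[/andP[b0 _] bc] /andP[/andP[c0 _] _].
exact: tabpow_distinct.
Qed.

Lemma tabquad_null (n m : F) : m = 0 -> null_ideal (tabquad n m 0).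
Proof.
move=> ->; exists (vec 0 0 1); split.
- by rewrite vec_neq0 // oner_eq0 !orbT.
- by rewrite /tabquad; inv_norm; congr vec; ring.
- move=> y; exists (y o0 0); rewrite [in LHS](vec_eta y) /tabquad; inv_norm.
  by congr vec; ring.
Qed.

(** The bilinear form is diagonalized with n nonzero: directly, after exchanging e2 and e3, or
    through e2 + e3, whose square is 2 p when n = m = 0. A remaining zero on the diagonal would
    produce a null ideal. *)
Lemma tabquad_gram (n m p : F) mu : GLorbit (tabquad n m p) mu -> \det (gram mu) != 0 ->
  acommutative mu -> GLorbit (J12 F) mu.
Proof.
move=> Kmu d0 muC; apply: GLorbit_trans (Kmu).
have nn K : GLorbit K mu -> ~ null_ideal K.
  by move=> KK N; case/eqP: d0; apply: null_ideal_gram => //; apply: null_ideal_orbit KK.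
have main n' m' p' : GLorbit (tabquad n' m' p') mu -> n' != 0 ->
    GLorbit (J12 F) (tabquad n' m' p').
  move=> Kmu' n0; have KS := tabquad_shift m' p' n0.
  apply: GLorbit_trans (KS); apply: tabquad_J12 => //.
  by apply/eqP => E; apply: (nn _ (GLorbit_trans KS Kmu')); apply: tabquad_null.
have [n0|n0] := eqVneq n 0; last exact: main.
have [m0|m0] := eqVneq m 0; last first.
  have fr : free3 (vec 1 0 0) (vec 0 0 1) (vec (0 : F) 1 0).
    apply: free3_vec; rewrite !scal01.
    by rewrite oppr_eq0 oner_eq0.
  have KS : GLorbit (tabquad m n p) (tabquad n m p).
    by apply: (commalg3_orbit fr); rewrite /tabquad; tab_ring.
  by apply: GLorbit_trans (KS); apply: main => //; apply: GLorbit_trans KS Kmu.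
have [p0|p0] := eqVneq p 0.
  by case: (nn _ Kmu); rewrite p0; apply: tabquad_null.
have fr : free3 (vec 1 0 0) (vec 0 1 1) (vec (0 : F) 0 1).
  apply: free3_vec; rewrite !scal01.
  exact: oner_neq0.
have KS : GLorbit (tabquad (2%:R * p) 0 p) (tabquad n m p).
  by rewrite n0 m0; apply: (commalg3_orbit fr);
    rewrite /tabquad; tab_ring.
apply: GLorbit_trans (KS); apply: main; first exact: GLorbit_trans KS Kmu.
by rewrite mulf_neq0 // pnatr_eq0.
Qed.

Ltac null_tac K c := exists (vec 0 0 1); split;
  [ by rewrite vec_neq0 // oner_eq0 !orbT | by rewrite /K; inv_norm; congr vec; ring
  | let y := fresh "y" in move=> y; exists (c y); rewrite [in LHS](vec_eta y) /K; inv_norm;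
    by congr vec; ring ].

Lemma tabhalf_null : null_ideal (tabhalf F).
Proof. null_tac tabhalf (fun y : 'cV[F]_3 => 0 : F). Qed.

Lemma J14_null : null_ideal (J14 F).
Proof. null_tac J14 (fun y : 'cV[F]_3 => half * y o0 0). Qed.

Lemma J19_null : null_ideal (J19 F).
Proof. null_tac J19 (fun y : 'cV[F]_3 => half * y o0 0). Qed.

Lemma tab16_null (b : F) : null_ideal (tab16 b).
Proof. null_tac tab16 (fun y : 'cV[F]_3 => y o0 0). Qed.

End TableInvariants.

(** * Polynomials isolating the orbits of the five Jordan algebras *)

Section Isolation.
Variable F : numClosedFieldType.
Local Notation half := (2%:R^-1 : F).
Local Notation L := (derived_jordan F 3).
Implicit Types (mu K : algstr F 3) (x y z u v w : 'cV[F]_3).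

Lemma det_frame u v w : \det (frame u v w) =
  u o0 0 * (v o1 0 * w o2 0 - w o1 0 * v o2 0) -
  v o0 0 * (u o1 0 * w o2 0 - w o1 0 * u o2 0) +
  w o0 0 * (u o1 0 * v o2 0 - v o1 0 * u o2 0).
Proof. by rewrite det3 !mxE. Qed.

Definition prod_det mu x x' y y' z z' :=
  \det (frame (amul mu x x') (amul mu y y') (amul mu z z')).

Lemma prod_det_full mu x x' y y' z z' : prod_det mu x x' y y' z z' != 0 -> full mu.
Proof.
move=> d0 l lmu; have fu : frame (amul mu x x') (amul mu y y') (amul mu z z') \in unitmx.
  by rewrite unitmxE unitfE.
rewrite -(mulmxK fu l); suff -> : l *m frame (amul mu x x') (amul mu y y') (amul mu z z') = 0.
  by rewrite mul0mx.
apply/rowP => j.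
have -> : (l *m frame (amul mu x x') (amul mu y y') (amul mu z z')) 0 j =
   (l *m (frame (amul mu x x') (amul mu y y') (amul mu z z') *m delta_mx j (0 : 'I_1))) 0 0.
  by rewrite mulmxA -colE [in RHS]mxE.
by elim/ord3P: j; rewrite -/(e1 F) -/(e2 F) -/(e3 F) ?frame_simp lmu !mxE.
Qed.

Lemma afun_prod_det x x' y y' z z' : afun (fun mu => prod_det mu x x' y y' z z').
Proof.
apply: (fs_det (afun_subalg F 3)) => i j; under eq_fun do rewrite mxE.
by elim/ord3P: j; apply: afun_amul_cst.
Qed.

Lemma afun_tau (x : algstr F 3 -> 'cV[F]_3) : (forall i, afun (fun mu => x mu i 0)) ->
  afun (fun mu => tau mu (x mu)).
Proof.
move=> Hx; under eq_fun do rewrite tau3.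
have H := afun_subalg F 3.
by apply: (fsD H); [apply: (fsD H)|]; apply: afun_amul => // i; apply: afun_cst.
Qed.

Lemma afun_gram : afun (fun mu : algstr F 3 => \det (gram mu)).
Proof.
apply: (fs_det (afun_subalg F 3)) => i j; under eq_fun do rewrite mxE.
by apply: afun_tau => k; apply: afun_amul_cst.
Qed.

Lemma afun_specdet c x : afun (fun mu => specdet c mu x).
Proof.
have H := afun_subalg F 3; apply: (fs_det H) => i j.
have E mu : ((tau mu x)%:M - c *: Lmx mu x) i j =
    tau mu x * (i == j)%:R - c * amul mu x (delta_mx j 0) i 0.
  have E1 (t : F) : t%:M i j = t * (i == j)%:R by rewrite mxE mulr_natr.
  have E2 : (c *: Lmx mu x) i j = c * amul mu x (delta_mx j 0) i 0.
    by rewrite mxE; congr (c * _); rewrite mxE.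
  by rewrite mxE E1; congr (_ + _); rewrite mxE E2.
rewrite (funext E); apply: (fsB H); apply: (fsM H); try exact: afun_cst.
  by apply: afun_tau => k; apply: afun_cst.
exact: afun_amul_cst.
Qed.

Definition assoc_minor mu x y z x' y' z' :=
  assoc mu x y z o1 0 * assoc mu x' y' z' o2 0 -
  assoc mu x y z o2 0 * assoc mu x' y' z' o1 0.

Lemma afun_assoc_minor x y z x' y' z' : afun (fun mu => assoc_minor mu x y z x' y' z').
Proof.
have H := afun_subalg F 3.
by apply: (fsB H); apply: (fsM H); apply: afun_assoc.
Qed.

Lemma assoc_line_minor mu x y z x' y' z' : assoc_line mu -> assoc_minor mu x y z x' y' z' = 0.
Proof.
move=> [v H]; have [t tE] := H x y z; have [t' tE'] := H x' y' z'.
by rewrite /assoc_minor tE tE' !cvZE; ring.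
Qed.

(** [K] has a principal open neighbourhood in the variety made of algebras isomorphic to it.
    Translates of this neighbourhood show that the orbit is open, and a subset of the variety whose
    closure contains [K] must meet the orbit. *)
Definition isolated_orbit K := exists f, [/\ afun f, f K != 0 &
  forall mu, L mu -> f mu != 0 -> GLorbit K mu].

Lemma isolatedP K f : afun f -> f K != 0 ->
  (forall mu, acommutative mu -> jordan_type mu -> f mu != 0 -> GLorbit K mu) ->
  (forall mu, f mu != 0 -> full mu) -> isolated_orbit K.
Proof.
move=> fa fK fI fF; exists f; split=> // mu [muC muD] fmu.
apply: fI => //; apply: jordan_classification => //; last exact: fF.
by apply: full_jordan => //; apply: fF.
Qed.

Lemma gram_null_absurd (P : Prop) K mu : acommutative mu -> \det (gram mu) != 0 ->
  null_ideal K -> GLorbit K mu -> P.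
Proof.
move=> muC /eqP g0 NK Kmu; case: g0.
by apply: null_ideal_gram => //; apply: null_ideal_orbit Kmu.
Qed.

Lemma specdet_absurd (P : Prop) K mu c x : specdet c mu x != 0 ->
  (forall x, specdet c K x = 0) -> GLorbit K mu -> P.
Proof. by move=> s0 SK Kmu; rewrite (specdet_orbit SK Kmu) eqxx in s0. Qed.

Lemma assoc_line_absurd (P : Prop) K mu x y z x' y' z' :
  assoc_minor mu x y z x' y' z' != 0 -> assoc_line K -> GLorbit K mu -> P.
Proof.
move=> /eqP a0 AK Kmu; case: a0.
by apply: assoc_line_minor; apply: assoc_line_orbit Kmu.
Qed.

Ltac const_tac c := rewrite /prod_det /assoc_minor /assoc ?det_frame ?specdet3 /= ?tau3; inv_norm;
  match goal with |- is_true (?a != 0) => have -> : a = c by field end.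

Lemma J07_gram : \det (gram (J07 F)) != 0.
Proof.
have tauE a b c : tau (J07 F) (vec a b c) = a + b + c.
  by rewrite tau3 /J07; inv_norm; ring.
have [D11 D22 D33 [[D12 D13 D23] [D21 D31 D32]]] := commalg3E (e1 F) (e2 F) (e3 F) 0 0 0.
rewrite -/(J07 F) in D11 D22 D33 D12 D13 D23 D21 D31 D32.
rewrite det3 !mxE -/(e1 F) -/(e2 F) -/(e3 F).
rewrite D11 D22 D33 D12 D13 D23 D21 D31 D32 !vec_norm !tauE.
match goal with |- is_true (?a != 0) => have -> : a = 1 by ring end.
exact: oner_neq0.
Qed.

(** The determinant of products forces A^2 = A; the trace form excludes [J14], [tab16], [J19] and
    the tables [tabpow] with a null ideal; the spectral factor excludes [tabquad] and [tabhalf]. *)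
Lemma J07_isolated : isolated_orbit (J07 F).
Proof.
have H := afun_subalg F 3.
apply: (@isolatedP _ (fun mu => prod_det mu (e1 F) (e1 F) (e2 F) (e2 F) (e3 F) (e3 F) *
  \det (gram mu) * specdet 3%:R mu (e1 F))).
- by apply: (fsM H); [apply: (fsM H)|]; [apply: afun_prod_det|apply: afun_gram|apply: afun_specdet].
- rewrite !mulf_neq0 //.
  + by rewrite /J07; const_tac (1 : F); rewrite oner_eq0.
  + exact: J07_gram.
  + by rewrite /J07; const_tac (- 2%:R : F); rewrite oppr_eq0 pnatr_eq0.
- move=> mu muC T; rewrite !mulf_eq0 !negb_or => /andP[/andP[_ g0] s0].
  have N K NK Kmu := @gram_null_absurd (GLorbit (J07 F) mu) K mu muC g0 NK Kmu.
  have S K SK Kmu := @specdet_absurd (GLorbit (J07 F) mu) K mu _ _ s0 SK Kmu.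
  case: T => [[a [b [c Kmu]]]|[n [m [p Kmu]]]|Kmu|[Kmu|[b Kmu]|Kmu]].
  + exact: tabpow_gram Kmu g0 muC.
  + exact: S (tabquad_spec n m p) Kmu.
  + exact: S (@tabhalf_spec F) Kmu.
  + exact: N (J14_null F) Kmu.
  + exact: N (tab16_null b) Kmu.
  + exact: N (J19_null F) Kmu.
- by move=> mu; rewrite !mulf_eq0 !negb_or => /andP[/andP[/prod_det_full]].
Qed.

Lemma J12_gram : \det (gram (J12 F)) != 0.
Proof.
have tauE a b c : tau (J12 F) (vec a b c) = 3%:R / 2%:R * (a + b).
  by rewrite tau3 /J12; inv_norm; field.
have [D11 D22 D33 [[D12 D13 D23] [D21 D31 D32]]] :=
  commalg3E (e1 F) (e2 F) (e1 F + e2 F) 0 (half *: e3 F) (half *: e3 F).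
rewrite -/(J12 F) in D11 D22 D33 D12 D13 D23 D21 D31 D32.
rewrite det3 !mxE -/(e1 F) -/(e2 F) -/(e3 F).
rewrite D11 D22 D33 D12 D13 D23 D21 D31 D32 !vec_norm !tauE.
match goal with |- is_true (?a != 0) => have -> : a = 27%:R / 4%:R by field end.
by rewrite mulf_eq0 invr_eq0 !pnatr_eq0.
Qed.

(** Unlike for [J07], the last factor is an associator, which excludes the associative tables
    [tabpow]; the trace form leaves only the nondegenerate [tabquad]. *)
Lemma J12_isolated : isolated_orbit (J12 F).
Proof.
have H := afun_subalg F 3.
apply: (@isolatedP _ (fun mu => prod_det mu (e1 F) (e1 F) (e2 F) (e2 F) (e1 F) (e3 F) *
  \det (gram mu) * assoc mu (e1 F) (e1 F) (e3 F) o2 0)).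
- by apply: (fsM H); [apply: (fsM H)|]; [apply: afun_prod_det|apply: afun_gram|apply: afun_assoc].
- rewrite !mulf_neq0 //.
  + by rewrite /J12; const_tac (2%:R^-1 : F); rewrite invr_eq0 pnatr_eq0.
  + exact: J12_gram.
  + rewrite /J12; const_tac (4%:R^-1 : F); by rewrite invr_eq0 pnatr_eq0.
- move=> mu muC T; rewrite !mulf_eq0 !negb_or => /andP[/andP[_ g0] s0].
  have N K NK Kmu := @gram_null_absurd (GLorbit (J12 F) mu) K mu muC g0 NK Kmu.
  case: T => [[a [b [c Kmu]]]|[n [m [p Kmu]]]|Kmu|[Kmu|[b Kmu]|Kmu]].
  + by case/eqP: s0; rewrite (associative_orbit (@tabpow_assoc F a b c) Kmu) cv0E.
  + exact: tabquad_gram Kmu g0 muC.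
  + exact: N (tabhalf_null F) Kmu.
  + exact: N (J14_null F) Kmu.
  + exact: N (tab16_null b) Kmu.
  + exact: N (J19_null F) Kmu.
- by move=> mu; rewrite !mulf_eq0 !negb_or => /andP[/andP[/prod_det_full]].
Qed.

(** The trace form of [J14] is degenerate. The minor excludes [tabpow] and [J19], whose associators
    lie on a line; the spectral constant 3 excludes [tabquad] and [tabhalf], and 5/2 excludes
    [tab16]. *)
Lemma J14_isolated : isolated_orbit (J14 F).
Proof.
have H := afun_subalg F 3.
apply: (@isolatedP _ (fun mu => prod_det mu (e1 F) (e1 F) (e1 F) (e2 F) (e1 F) (e3 F) *
  assoc_minor mu (e1 F) (e1 F) (e2 F) (e1 F) (e1 F) (e3 F) * specdet 3%:R mu (e1 F) *
  specdet (5%:R / 2%:R) mu (e1 F))).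
- by apply: (fsM H); [apply: (fsM H); [apply: (fsM H)|]|]; [apply: afun_prod_det|apply: afun_assoc_minor|
    apply: afun_specdet|apply: afun_specdet].
- rewrite !mulf_neq0 // /J14.
  + by const_tac (4%:R^-1 : F); rewrite invr_eq0 pnatr_eq0.
  + by const_tac (16%:R^-1 : F); rewrite invr_eq0 pnatr_eq0.
  + by const_tac (- 4%:R^-1 : F); rewrite oppr_eq0 invr_eq0 pnatr_eq0.
  + by const_tac (- (9%:R / 32%:R) : F); rewrite oppr_eq0 mulf_eq0 invr_eq0 !pnatr_eq0.
- move=> mu muC T; rewrite !mulf_eq0 !negb_or => /andP[/andP[/andP[_ a0] s0] t0].
  have S K SK Kmu := @specdet_absurd (GLorbit (J14 F) mu) K mu _ _ s0 SK Kmu.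
  have A K AK Kmu := @assoc_line_absurd (GLorbit (J14 F) mu) K mu _ _ _ _ _ _ a0 AK Kmu.
  case: T => [[a [b [c Kmu]]]|[n [m [p Kmu]]]|Kmu|[Kmu|[b Kmu]|Kmu]] //.
  + exact: A (associative_line (@tabpow_assoc F a b c)) Kmu.
  + exact: S (tabquad_spec n m p) Kmu.
  + exact: S (@tabhalf_spec F) Kmu.
  + by rewrite (specdet_orbit (tab16_spec b) Kmu) eqxx in t0.
  + exact: A (J19_assoc_line F) Kmu.
- by move=> mu; rewrite !mulf_eq0 !negb_or => /andP[/andP[/andP[/prod_det_full]]].
Qed.

(** Compared with [J14], the spectral constant 2 now excludes [J14], and the minor also excludes
    [tab16 0], the only [tab16] not isomorphic to [J16]. *)
Lemma J16_isolated : isolated_orbit (J16 F).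
Proof.
have H := afun_subalg F 3.
apply: (@isolatedP _ (fun mu => prod_det mu (e1 F) (e1 F) (e1 F) (e2 F) (e1 F) (e3 F) *
  assoc_minor mu (e1 F) (e1 F) (e2 F) (e2 F) (e2 F) (e1 F) * specdet 3%:R mu (e1 F) *
  specdet 2%:R mu (e1 F))).
- by apply: (fsM H); [apply: (fsM H); [apply: (fsM H)|]|]; [apply: afun_prod_det|apply: afun_assoc_minor|
    apply: afun_specdet|apply: afun_specdet].
- rewrite !mulf_neq0 // /J16.
  + by const_tac (2%:R^-1 : F); rewrite invr_eq0 pnatr_eq0.
  + by const_tac (8%:R^-1 : F); rewrite invr_eq0 pnatr_eq0.
  + by const_tac (4%:R^-1 : F); rewrite invr_eq0 pnatr_eq0.
  + by const_tac (3%:R / 8%:R : F); rewrite mulf_eq0 invr_eq0 !pnatr_eq0.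
- move=> mu muC T; rewrite !mulf_eq0 !negb_or => /andP[/andP[/andP[_ a0] s0] t0].
  have S K SK Kmu := @specdet_absurd (GLorbit (J16 F) mu) K mu _ _ s0 SK Kmu.
  have A K AK Kmu := @assoc_line_absurd (GLorbit (J16 F) mu) K mu _ _ _ _ _ _ a0 AK Kmu.
  case: T => [[a [b [c Kmu]]]|[n [m [p Kmu]]]|Kmu|[Kmu|[b Kmu]|Kmu]].
  + exact: A (associative_line (@tabpow_assoc F a b c)) Kmu.
  + exact: S (tabquad_spec n m p) Kmu.
  + exact: S (@tabhalf_spec F) Kmu.
  + by rewrite (specdet_orbit (@J14_spec F) Kmu) eqxx in t0.
  + have [b0|b0] := eqVneq b 0; first by apply: A Kmu; rewrite b0; apply: tab16_assoc_line.
    exact: GLorbit_trans (tab16_J16 b0) Kmu.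
  + exact: A (J19_assoc_line F) Kmu.
- by move=> mu; rewrite !mulf_eq0 !negb_or => /andP[/andP[/andP[/prod_det_full]]].
Qed.

Definition tau_minor mu := tau mu (amul mu (e1 F) (e1 F)) * tau mu (amul mu (e2 F) (e2 F)) -
   tau mu (amul mu (e1 F) (e2 F)) ^+ 2.

Lemma J19_isolated : isolated_orbit (J19 F).
Proof.
have H := afun_subalg F 3.
have AT u v : afun (fun mu => tau mu (amul mu u v)).
  by apply: afun_tau => k; apply: afun_amul_cst.
(* At e1 the trace 3/2 is three times the eigenvalue 1/2, so the spectral factor would vanish; at e1
   + 10 e2 it does not. The last factor excludes [J14] and [tab16], whose trace forms have rank
   one. *)
apply: (@isolatedP _ (fun mu => prod_det mu (e1 F) (e1 F) (e2 F) (e2 F) (e1 F) (e3 F) *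
  assoc mu (e1 F) (e1 F) (e3 F) o2 0 * specdet 3%:R mu (vec 1 10%:R 0) *
  tau_minor mu)).
- apply: (fsM H); [apply: (fsM H); [apply: (fsM H)|]|]; [exact: afun_prod_det|exact: afun_assoc|exact: afun_specdet|].
  by apply: (fsB H); [apply: (fsM H)| apply: (fsX H); apply: AT].
- rewrite !mulf_neq0 // /J19.
  + by const_tac (2%:R^-1 : F); rewrite invr_eq0 pnatr_eq0.
  + by const_tac (4%:R^-1 : F); rewrite invr_eq0 pnatr_eq0.
  + by const_tac (- (6290%:R / 4%:R) : F); rewrite oppr_eq0 mulf_eq0 invr_eq0 !pnatr_eq0.
  + by rewrite /tau_minor; const_tac (3%:R / 2%:R : F); rewrite mulf_eq0 invr_eq0 !pnatr_eq0.
- move=> mu muC T; rewrite !mulf_eq0 !negb_or => /andP[/andP[/andP[_ a0] s0] t0].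
  have S K SK Kmu := @specdet_absurd (GLorbit (J19 F) mu) K mu _ _ s0 SK Kmu.
  have R K : tau_rank1 K -> GLorbit K mu -> GLorbit (J19 F) mu.
    move=> RK Kmu; case/eqP: t0.
    by rewrite /tau_minor (tau_rank1_orbit RK Kmu) subrr.
  case: T => [[a [b [c Kmu]]]|[n [m [p Kmu]]]|Kmu|[Kmu|[b Kmu]|Kmu]] //.
  + by case/eqP: a0; rewrite (associative_orbit (@tabpow_assoc F a b c) Kmu) cv0E.
  + exact: S (tabquad_spec n m p) Kmu.
  + exact: S (@tabhalf_spec F) Kmu.
  + exact: R (@J14_rank1 F) Kmu.
  + exact: R (tab16_rank1 b) Kmu.
- by move=> mu; rewrite !mulf_eq0 !negb_or => /andP[/andP[/andP[/prod_det_full]]].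
Qed.

End Isolation.

(** * Closedness of the variety, and isomorphisms inside the two families *)

Section DerivedJordan.
Variable F : numClosedFieldType.
Local Notation half := (2%:R^-1 : F).
Local Notation L := (derived_jordan F 3).
Implicit Types (mu K : algstr F 3) (x y z u v w : 'cV[F]_3).

(** The set A^2 varies with [mu], but its elements are named by data [d] that do not. The Jordan
    identity on A^2 thereby becomes a family of polynomial equations in [mu]. *)
Definition comb (d : {m : nat & ('I_m -> F) * ('I_m -> 'cV[F]_3) * ('I_m -> 'cV[F]_3)}%type)
    mu : 'cV[F]_3 :=
  let: existT m (c, u, v) := d in \sum_t c t *: amul mu (u t) (v t).

Lemma afun_comb d k : afun (fun mu => comb d mu k 0).
Proof.
case: d => m [[c u] v] /=; under eq_fun do rewrite summxE.
apply: (fs_sum (afun_subalg F 3)) => i; under eq_fun do rewrite cvZE.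
apply: (fsM (afun_subalg F 3)); first exact: afun_cst.
by apply: afun_amul => j; apply: afun_cst.
Qed.

Lemma derived_jordan_closed : closed L.
Proof.
have Hs := afun_subalg F 3.
have -> : L = [set mu | forall t : 'cV[F]_3 * 'cV[F]_3 * 'I_3,
      amul mu t.1.1 t.1.2 t.2 0 - amul mu t.1.2 t.1.1 t.2 0 = 0] `&`
    [set mu | forall t : _ * _ * 'I_3,
      amul mu (amul mu (amul mu (comb t.1.1 mu) (comb t.1.1 mu)) (comb t.1.2 mu))
        (comb t.1.1 mu) t.2 0 -
      amul mu (amul mu (comb t.1.1 mu) (comb t.1.1 mu))
        (amul mu (comb t.1.2 mu) (comb t.1.1 mu)) t.2 0 = 0].
  apply/seteqP; split=> mu [muC muD]; split=> /=.
  - by move=> [[x y] k] /=; rewrite muC subrr.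
  - move=> [[d d'] k] /=; rewrite muD ?subrr //.
      by case: d => m [[c u] v]; exists m, c, u, v.
    by case: d' => m [[c u] v]; exists m, c, u, v.
  - move=> x y; apply/colP => k; apply/eqP; rewrite -subr_eq0; apply/eqP.
    exact: (muC (x, y, k)).
  - move=> _ _ [m [c [u [v ->]]]] [m' [c' [u' [v' ->]]]].
    apply/colP => k; apply/eqP; rewrite -subr_eq0; apply/eqP.
    exact: (muD (existT _ m (c, u, v), existT _ m' (c', u', v'), k)).
apply: closedI; apply: closed_zeros => -[[x y] k] /=.
  by apply: (fsB Hs); apply: afun_amul => i; apply: afun_cst.
have P : forall i, afun (fun mu => amul mu (comb x mu) (comb x mu) i 0).
  by move=> i; apply: afun_amul => j; apply: afun_comb.
apply: (fsB Hs); apply: afun_amul => i; try exact: P; try exact: afun_comb.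
  by apply: afun_amul => j; [apply: P | apply: afun_comb].
by apply: afun_amul => j; apply: afun_comb.
Qed.

Lemma derived_jordan_stable : GLstable L.
Proof.
move=> g mu gu [muC muD]; split=> [x y|x y Ax Ay].
  by rewrite !amul_gact muC.
have AA z : asquare (gact g mu) z -> asquare mu (invmx g *m z).
  move=> Az; pattern z; apply: (asquare_ind _ _ _ Az).
  - by rewrite mulmx0 -(scale0r (amul mu 0 0)); apply/asquare_scale/asquare_mul.
  - by move=> p q Ap Aq; rewrite mulmxDr; apply: asquare_add.
  - by move=> c p q; rewrite -scalemxAr amul_gact mulKmx //; apply/asquare_scale/asquare_mul.
by rewrite !amul_gact !mulKmx // muD //; apply: AA.
Qed.

Lemma asquare_plane mu : (forall x y, amul mu x y o2 0 = 0) ->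
  forall z, asquare mu z -> z = vec (z o0 0) (z o1 0) 0.
Proof.
move=> H z Az; suff z2 : z o2 0 = 0 by rewrite {1}(vec_eta z) z2.
move: z Az; apply: asquare_ind.
- by rewrite cv0E.
- by move=> x y x2 y2; rewrite cvDE x2 y2 addr0.
- by move=> c x y; rewrite cvZE H mulr0.
Qed.

Lemma jordan_derived mu : acommutative mu -> jordan mu -> L mu.
Proof. by move=> muC muJ; split=> // x y _ _; apply: muJ. Qed.

Lemma J07_jordan : jordan (J07 F).
Proof.
by move=> x y; rewrite (vec_eta x) (vec_eta y) /J07; inv_norm; congr vec; ring.
Qed.

Lemma J12_jordan : jordan (J12 F).
Proof.
by move=> x y; rewrite (vec_eta x) (vec_eta y) /J12; inv_norm; congr vec; field.
Qed.

Lemma J14_jordan : jordan (J14 F).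
Proof.
by move=> x y; rewrite (vec_eta x) (vec_eta y) /J14; inv_norm; congr vec; field.
Qed.

Lemma J16_jordan : jordan (J16 F).
Proof.
by move=> x y; rewrite (vec_eta x) (vec_eta y) /J16; inv_norm; congr vec; field.
Qed.

Lemma J19_jordan : jordan (J19 F).
Proof.
by move=> x y; rewrite (vec_eta x) (vec_eta y) /J19; inv_norm; congr vec; field.
Qed.

Lemma calJ01_plane (a : F) x y : amul (calJ01 a) x y o2 0 = 0.
Proof. by rewrite (vec_eta x) (vec_eta y) /calJ01; inv_norm; ring. Qed.

Lemma A01_plane (a b c : F) x y : amul (A01 a b c) x y o2 0 = 0.
Proof. by rewrite (vec_eta x) (vec_eta y) /A01; inv_norm; ring. Qed.

Lemma calJ01_derived (a : F) : L (calJ01 a).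
Proof.
split=> [|x y /(asquare_plane (@calJ01_plane a)) -> /(asquare_plane (@calJ01_plane a)) ->].
  exact: commalg3_comm.
by rewrite /calJ01; inv_norm; congr vec; field.
Qed.

Lemma A01_derived (a b c : F) : L (A01 a b c).
Proof.
split=> [|x y /(asquare_plane (@A01_plane a b c)) -> /(asquare_plane (@A01_plane a b c)) ->].
  exact: commalg3_comm.
by rewrite /A01; inv_norm; congr vec; ring.
Qed.

Lemma plane_not_full mu : (forall x y, amul mu x y o2 0 = 0) -> ~ full mu.
Proof.
move=> H; apply: (not_full (free3_std F)) => x y.
exists (amul mu x y o0 0), (amul mu x y o1 0).
by rewrite {1}(vec_eta (amul mu x y)) H /vec scale0r addr0.
Qed.

Lemma full_orbit K mu : full K -> GLorbit K mu -> full mu.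
Proof.
move=> KF [g gu <-] l H; rewrite -(mulmxK gu l).
suff -> : l *m g = 0 by rewrite mul0mx.
apply: KF => x y; have := H (g *m x) (g *m y).
by rewrite amul_gactK // mulmxA.
Qed.

Lemma not_in_closure (S : set (algstr F 3)) mu f : afun f -> f mu != 0 ->
  (forall nu, S nu -> f nu = 0) -> ~ closure S mu.
Proof. by move=> fa f0 fS /in_closureP/(_ f fa fS)/eqP; rewrite (negbTE f0). Qed.

Lemma orbit_morphism K mu : GLorbit K mu -> exists g : 'M[F]_3,
  (forall x y, amul mu (g *m x) (g *m y) = g *m amul K x y) /\
  (forall x, x != 0 -> g *m x != 0).
Proof.
move=> [g gu <-]; exists g; split=> [x y|x]; first by rewrite amul_gactK.
by apply: contraNneq => gx; rewrite -(mulKmx gu x) gx mulmx0.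
Qed.

(** Solving for the images of the basis vectors leaves only e1 to e1, e2 to w e2, e3 to w e3 with
    w^2 = 1. So the family contains infinitely many isomorphism types. *)
Lemma calJ01_iso (a b : F) : GLorbit (calJ01 a) (calJ01 b) -> a ^+ 2 = b ^+ 2.
Proof.
move=> /orbit_morphism[g [T inj]].
have [D11 D22 D33 [[D12 D13 D23] _]] :=
  commalg3E (e1 F) 0 (e1 F + a *: e2 F) (half *: e2 F) 0 (e1 F).
rewrite -/(calJ01 a) in D11 D22 D33 D12 D13 D23.
have T11 := T (e1 F) (e1 F); have T22 := T (e2 F) (e2 F); have T33 := T (e3 F) (e3 F).
have T12 := T (e1 F) (e2 F); have T13 := T (e1 F) (e3 F); have T23 := T (e2 F) (e3 F).
rewrite D11 in T11; rewrite D22 mulmx0 in T22; rewrite D33 mulmxDr -scalemxAr in T33.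
rewrite D12 -scalemxAr in T12; rewrite D13 mulmx0 in T13; rewrite D23 in T23.
have v10 := inj _ (e1_neq0 F).
have v1z : (g *m e1 F) o2 0 = 0 by rewrite -T23 calJ01_plane.
have v2z : (g *m e2 F) o2 0 = 0.
  have := calJ01_plane b (g *m e1 F) (g *m e2 F); rewrite T12 cvZE => /eqP.
  by rewrite mulf_eq0 (negbTE (half_neq0 F)) => /eqP.
move: (g *m e1 F) (g *m e2 F) (g *m e3 F) v10 v1z v2z T11 T22 T33 T12 T13 T23.
move=> v1 v2 v3 + v1z v2z; rewrite (vec_eta v1) (vec_eta v2) (vec_eta v3) v1z v2z.
move: (v1 o0 0) (v1 o1 0) (v2 o0 0) (v2 o1 0) (v3 o0 0) (v3 o1 0) (v3 o2 0).
move=> p q r s u v w v10; rewrite /calJ01; inv_norm.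
move=> /vec_inj[p1 p2 _] /vec_inj[r1 _ _] /vec_inj[w1 w2 _] _ /vec_inj[u1 u2 _] /vec_inj[s1 s2 _].
have {}p1 : p * (p - 1) = 0 by apply: (eq_via_sub p1); ring.
have {}p2 : q * (p - 1) = 0 by apply: (eq_via_sub p2); field.
have pE : p = 1.
  move/eqP: p1; rewrite mulf_eq0 subr_eq0 => /orP[/eqP p0|/eqP //].
  move/eqP: p2; rewrite p0 sub0r mulrN1 oppr_eq0 => /eqP q0.
  by case/negP: v10; rewrite p0 q0 -zero_vec.
have {r1}r0 : r = 0.
  have /eqP : r ^+ 2 = 0 by apply: (eq_via_sub r1); ring.
  by rewrite expf_eq0 => /eqP.
have uE : u = - (q * w) by apply: (eq_via_sub u1); rewrite pE; ring.
have sw : s * w = 1 by apply: (eq_via_sub s1); rewrite pE r0; ring.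
have q0 : q = 0.
  have s2' : s * u = 2%:R * q by apply: (eq_via_sub (congr1 (fun z : F => 2%:R * z) s2)); rewrite r0; field.
  have : - q * (s * w) = 2%:R * q by rewrite -s2' uE; ring.
  rewrite sw mulr1 => E3; have /eqP : 3%:R * q = 0 by apply: (eq_via_sub (esym E3)); ring.
  by rewrite mulf_eq0 pnatr_eq0 => /eqP.
have u0 : u = 0 by rewrite uE q0 mul0r oppr0.
have v0 : v = 0.
  by apply: (eq_via_sub (congr1 (fun z : F => 2%:R * z) u2)); rewrite pE u0; field.
have w21 : w ^+ 2 = 1 by apply: (eq_via_sub w1); rewrite ?pE ?u0 ?v0 ?q0 ?r0; ring.
have wa : w ^+ 2 * b = a * s.
  by apply: (eq_via_sub w2); rewrite ?pE ?u0 ?v0 ?q0 ?r0; field.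
have s21 : s ^+ 2 = 1.
  by have := congr1 (fun z : F => z ^+ 2) sw; rewrite exprMn w21 mulr1 expr1n.
by rewrite -[b]mul1r -w21 wa exprMn s21 mulr1.
Qed.

(** The plane A^2 is F x F, so an isomorphism fixes or exchanges its idempotents e1 and e2; these
    are the two alternatives. For fixed a, b, c each of them leaves at most two values of a'. *)
Lemma A01_iso (a b c a' : F) : GLorbit (A01 a' b c) (A01 a b c) ->
  a' ^+ 2 = a ^+ 2 \/ c != 0 /\ c * a' ^+ 2 = b ^+ 2.
Proof.
move=> /orbit_morphism[g [T inj]].
have [D11 D22 D33 [[D12 D13 D23] _]] :=
  commalg3E (e1 F) (e2 F) (e1 F + c *: e2 F) 0 (a' *: e2 F) (b *: e1 F).
rewrite -/(A01 a' b c) in D11 D22 D33 D12 D13 D23.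
have T11 := T (e1 F) (e1 F); have T22 := T (e2 F) (e2 F); have T33 := T (e3 F) (e3 F).
have T12 := T (e1 F) (e2 F); have T13 := T (e1 F) (e3 F); have T23 := T (e2 F) (e3 F).
rewrite D11 in T11; rewrite D22 in T22; rewrite D33 mulmxDr -scalemxAr in T33.
rewrite D12 mulmx0 in T12; rewrite D13 -scalemxAr in T13; rewrite D23 -scalemxAr in T23.
have v10 := inj _ (e1_neq0 F).
have v20 : g *m e2 F != 0.
  by apply: inj; rewrite e2_vec vec_neq0 // oner_eq0 orbT.
have v1z : (g *m e1 F) o2 0 = 0 by rewrite -T11 A01_plane.
have v2z : (g *m e2 F) o2 0 = 0 by rewrite -T22 A01_plane.
move: (g *m e1 F) (g *m e2 F) (g *m e3 F) v10 v20 v1z v2z T11 T22 T33 T12 T13 T23.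
move=> v1 v2 v3 + + v1z v2z; rewrite (vec_eta v1) (vec_eta v2) (vec_eta v3) v1z v2z.
move: (v1 o0 0) (v1 o1 0) (v2 o0 0) (v2 o1 0) (v3 o0 0) (v3 o1 0) (v3 o2 0).
move=> p q r s u v w v10 v20; rewrite /A01; inv_norm.
move=> /vec_inj[p1 q1 _] /vec_inj[r1 s1 _] /vec_inj[w1 w2 _] /vec_inj[pr qs _].
move=> /vec_inj[u1 u2 _] /vec_inj[t1 t2 _].
have idem (z : F) : z * z = z -> z = 0 \/ z = 1.
  move=> zz; have /eqP : z * (z - 1) = 0 by apply: (eq_via_sub zz); ring.
  by rewrite mulf_eq0 subr_eq0 => /orP[] /eqP; [left | right].
have pI : p = 0 \/ p = 1 by apply: idem; apply: (eq_via_sub p1); ring.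
have qI : q = 0 \/ q = 1 by apply: idem; apply: (eq_via_sub q1); ring.
have rI : r = 0 \/ r = 1 by apply: idem; apply: (eq_via_sub r1); ring.
have sI : s = 0 \/ s = 1 by apply: idem; apply: (eq_via_sub s1); ring.
have {}pr : p * r = 0 by apply: (eq_via_sub pr); ring.
have {}qs : q * s = 0 by apply: (eq_via_sub qs); ring.
have n10 : (1 : F) <> 0 by apply/eqP; rewrite oner_eq0.
have [[pE qE rE sE]|[pE qE rE sE]] : [/\ p = 1, q = 0, r = 0 & s = 1] \/
    [/\ p = 0, q = 1, r = 1 & s = 0].
  case: pI => pE; case: qI => qE; case: rI => rE; case: sI => sE;
    try (by left); try (by right); exfalso; rewrite pE qE rE sE in v10 v20 pr qs;
    try (by apply: n10; rewrite -[RHS]pr mulr1);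
    try (by apply: n10; rewrite -[RHS]qs mulr1);
    by [move: v10; rewrite -zero_vec eqxx | move: v20; rewrite -zero_vec eqxx].
- left.
  have u0 : u = 0 by apply: (eq_via_sub u1); rewrite ?pE ?qE ?sE ?rE; ring.
  have v0 : v = 0 by apply: (eq_via_sub t2); rewrite ?pE ?qE ?sE ?rE; ring.
  have wa : a' = w * a by apply: (eq_via_sub (esym u2)); rewrite ?pE ?qE ?sE ?rE; ring.
  have w21 : w ^+ 2 = 1 by apply: (eq_via_sub w1); rewrite ?u0 ?v0 ?pE ?qE ?sE ?rE; ring.
  by rewrite wa exprMn w21 mul1r.
- right.
  have v0 : v = 0 by apply: (eq_via_sub u2); rewrite ?pE ?qE ?sE ?rE; ring.
  have wb : a' = w * b by apply: (eq_via_sub (esym u1)); rewrite ?pE ?qE ?sE ?rE; ring.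
  have u0 : u = 0 by apply: (eq_via_sub t1); rewrite ?pE ?qE ?sE ?rE; ring.
  have cw : c * w ^+ 2 = 1 by apply: (eq_via_sub w2); rewrite ?u0 ?v0 ?pE ?qE ?sE ?rE; ring.
  split; last by rewrite wb exprMn mulrA cw mul1r.
  by apply/eqP => c0; apply: n10; rewrite -cw c0 mul0r.
Qed.

End DerivedJordan.

(** * A chain of length twelve *)

Section Chain.
Variable F : numClosedFieldType.
Local Notation L := (derived_jordan F 3).
Implicit Types (y : nat -> F).

Definition inplane (u v p q : F) : 'cV[F]_3 := vec p q (u * p + v * q).

(* The products lie in the plane spanned by e1 + u e3 and e2 + v e3, with
   u = y 10 and v = y 11.  The products of e3 with e1, e2, e3 are free; those of
   e1 and e2 are chosen so that, in the basis w1, w2 above of the plane,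
   w1 w1 = a w1 + b w2, w1 w2 = c w1 + l b w2 and
   w2 w2 = l c w1 + (c - l (a - l b)) w2, which is associative. *)
Definition chaintab y : algstr F 3 :=
  let a := y 6 in let b := y 7 in let c := y 8 in let l := y 9 in
  let u := y 10 in let v := y 11 in
  commalg3
    (inplane u v (a - 2%:R * u * y 0 - u ^+ 2 * y 4) (b - 2%:R * u * y 1 - u ^+ 2 * y 5))
    (inplane u v (l * c - 2%:R * v * y 2 - v ^+ 2 * y 4)
       (c - l * (a - l * b) - 2%:R * v * y 3 - v ^+ 2 * y 5))
    (inplane u v (y 4) (y 5))
    (inplane u v (c - v * y 0 - u * y 2 - u * v * y 4) (l * b - v * y 1 - u * y 3 - u * v * y 5))
    (inplane u v (y 0) (y 1)) (inplane u v (y 2) (y 3)).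

Lemma chaintab_mul y p q p' q' :
  let a := y 6 in let b := y 7 in let c := y 8 in let l := y 9 in
  let u := y 10 in let v := y 11 in
  amul (chaintab y) (inplane u v p q) (inplane u v p' q') =
  inplane u v (a * (p * p') + c * (p * q' + q * p') + l * c * (q * q'))
    (b * (p * p') + l * b * (p * q' + q * p') + (c - l * (a - l * b)) * (q * q')).
Proof. by rewrite /chaintab /inplane amul_vec /bil6 /=; congr vec; ring. Qed.

Lemma chaintab_plane y x z : exists p q, amul (chaintab y) x z = inplane (y 10) (y 11) p q.
Proof.
rewrite (vec_eta x) (vec_eta z) /chaintab /inplane amul_vec /bil6.
do 2!eexists; congr vec; rewrite mulrDr; ring.
Qed.

Lemma chaintab_derived y : L (chaintab y).
Proof.
split=> [|x z Ax Az]; first exact: commalg3_comm.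
have P t : asquare (chaintab y) t -> exists p q, t = inplane (y 10) (y 11) p q.
  move=> At; pattern t; apply: (asquare_ind _ _ _ At).
  - by exists 0, 0; rewrite /inplane !mulr0 addr0 -zero_vec.
  - move=> _ _ [p [q ->]] [p' [q' ->]]; exists (p + p'), (q + q').
    by rewrite /inplane add_vec; congr vec; ring.
  - move=> c s t'; have [p [q ->]] := chaintab_plane y s t'; exists (c * p), (c * q).
    by rewrite /inplane scale_vec; congr vec; ring.
have [p [q ->]] := P x Ax; have [p' [q' ->]] := P z Az.
rewrite !chaintab_mul /inplane; congr vec; ring.
Qed.

Definition chainset i : set (algstr F 3) :=
  [set mu | exists y, (forall j, (i <= j)%N -> y j = 0) /\ mu = chaintab y].

Lemma chainset_sub i : chainset i `<=` chainset i.+1.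
Proof. by move=> _ [y [y0 ->]]; exists y; split=> // j ij; apply: y0; apply: ltnW. Qed.

Lemma polymap_commalg3 d (p11 p22 p33 p12 p13 p23 : ('I_d -> F) -> 'cV[F]_3) :
  (forall k, polyfun id (fun t => p11 t k 0)) -> (forall k, polyfun id (fun t => p22 t k 0)) ->
  (forall k, polyfun id (fun t => p33 t k 0)) -> (forall k, polyfun id (fun t => p12 t k 0)) ->
  (forall k, polyfun id (fun t => p13 t k 0)) -> (forall k, polyfun id (fun t => p23 t k 0)) ->
  polymap (fun t => commalg3 (p11 t) (p22 t) (p33 t) (p12 t) (p13 t) (p23 t)).
Proof.
move=> P11 P22 P33 P12 P13 P23 [[i j] k].
have -> : (fun x : 'I_d -> F => (commalg3 (p11 x) (p22 x) (p33 x) (p12 x) (p13 x) (p23 x)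
    : {ffun _ -> F}) (i, j, k)) = fun x =>
    match minn i j, maxn i j with
    | 0, 0 => p11 x | 1, 1 => p22 x | 2, 2 => p33 x | 0, 1 => p12 x
    | 0, 2 => p13 x | 1, 2 => p23 x | _, _ => 0%R end%N k 0.
  by apply/funext => x; rewrite ffunE.
by elim/ord3P: i; elim/ord3P: j => /=.
Qed.

Lemma polyfun_vec d (p q r : ('I_d -> F) -> F) : polyfun id p -> polyfun id q ->
  polyfun id r -> forall k, polyfun id (fun x => vec (p x) (q x) (r x) k 0).
Proof.
move=> P Q R k; elim/ord3P: k.
- by rewrite (_ : (fun x => _) = p) //; apply/funext => x; rewrite vec_coord.
- by rewrite (_ : (fun x => _) = q) //; apply/funext => x; rewrite vec_coord.
- by rewrite (_ : (fun x => _) = r) //; apply/funext => x; rewrite vec_coord.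
Qed.

Lemma chaintab_polymap d (y : ('I_d -> F) -> nat -> F) :
  (forall j, polyfun id (fun x => y x j)) -> polymap (fun x => chaintab (y x)).
Proof.
move=> Hy; have H := polyfun_subalg (@id ('I_d -> F)).
have V p q : polyfun id p -> polyfun id q ->
    forall k, polyfun id (fun x => inplane (y x 10) (y x 11) (p x) (q x) k 0).
  move=> P Q; apply: polyfun_vec => //.
  by apply: (fsD H); apply: (fsM H).
by apply: polymap_commalg3; apply: V;
  repeat first [exact: Hy | exact: (fsC H) | apply: (fsD H) | apply: (fsN H)
    | apply: (fsM H) | apply: (fsX H)].
Qed.

Lemma chainset_irreducible i : irreducible_set (chainset i).
Proof.
pose y (x : 'I_12 -> F) j := if (j < i)%N && (j < 12)%N then x (inord j) else 0.
have -> : chainset i = range (fun x => chaintab (y x)).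
  apply/seteqP; split=> [_ [z [z0 ->]]|_ [x _ <-]].
    exists (fun j : 'I_12 => z j) => //.
    have E (j : nat) : (j < 12)%N -> y (fun j : 'I_12 => z j) j = z j.
      move=> j12; rewrite /y j12 andbT; case: ltnP => [_|/z0 ->] //.
      by rewrite inordK.
    by rewrite /chaintab !E.
  exists (y x); split=> // j ij; by rewrite /y ltnNge ij.
apply: range_irreducible; apply: chaintab_polymap => j.
have H := polyfun_subalg (@id ('I_12 -> F)).
rewrite /y; case: (_ && _); last exact: (fsC H).
exact: (polyfun_var (@id ('I_12 -> F))).
Qed.

(** The i-th function vanishes as long as the parameters from i on are zero. The last one eliminates
    u from two e3-coordinates, leaving v times a minor of the parameters y 0, y 1, y 4, y 5. *)
Definition chain_sep i (mu : algstr F 3) : F :=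
  match i with
  | 0%N => amul mu (e1 F) (e3 F) o0 0
  | 1%N => amul mu (e1 F) (e3 F) o1 0
  | 2%N => amul mu (e2 F) (e3 F) o0 0
  | 3%N => amul mu (e2 F) (e3 F) o1 0
  | 4%N => amul mu (e3 F) (e3 F) o0 0
  | 5%N => amul mu (e3 F) (e3 F) o1 0
  | 6%N => amul mu (e1 F) (e1 F) o0 0
  | 7%N => amul mu (e1 F) (e1 F) o1 0
  | 8%N => amul mu (e1 F) (e2 F) o0 0
  | 9%N => amul mu (e1 F) (e2 F) o1 0
  | 10%N => amul mu (e3 F) (e3 F) o2 0
  | _ => amul mu (e3 F) (e3 F) o0 0 * amul mu (e1 F) (e3 F) o2 0 -
         amul mu (e3 F) (e3 F) o2 0 * amul mu (e1 F) (e3 F) o0 0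
  end.

Lemma chain_sep_afun i : afun (chain_sep i).
Proof.
have H := afun_subalg F 3.
do 11?[case: i => [|i]; first exact: afun_amul_cst].
by apply: (fsB H); apply: (fsM H); apply: afun_amul_cst.
Qed.

(** Besides y i = 1, the cofactors of y i in [chain_sep i] are switched on where needed: y 7 for i =
    9, y 4 for i = 10, y 4 and y 1 for i = 11. Their indices are below i, so the point stays in the
    next set of the chain. *)
Definition chain_point i (j : nat) : F :=
  if i == 9 then ((j == 9) || (j == 7))%:R else
  if i == 10 then ((j == 10) || (j == 4))%:R else
  if i == 11 then [|| j == 11, j == 4 | j == 1]%:R else (j == i)%:R.

Lemma chain_sepE i y : (i < 12)%N -> chain_sep i (chaintab y) =
  nth 0 [:: y 0; y 1; y 2; y 3; y 4; y 5; y 6 - y 10 * (2%:R * y 0 + y 10 * y 4);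
    y 7 - y 10 * (2%:R * y 1 + y 10 * y 5); y 8 - y 11 * y 0 - y 10 * (y 2 + y 11 * y 4);
    y 9 * y 7 - y 11 * y 1 - y 10 * (y 3 + y 11 * y 5); y 10 * y 4 + y 11 * y 5;
    y 11 * (y 4 * y 1 - y 5 * y 0)] i.
Proof.
by do 12?[case: i => [|i]] => // _;
  rewrite /chain_sep /chaintab /inplane ?vec_norm !amul_vec /bil6 !vec_coord /=; ring.
Qed.

Lemma chain_sepP i : (i < 12)%N ->
  (forall mu, chainset i mu -> chain_sep i mu = 0) /\
  exists2 mu, chainset i.+1 mu & chain_sep i mu != 0.
Proof.
move=> i12; split=> [_ [y [y0 ->]]|].
  rewrite chain_sepE //.
  have y11 : y 11 = 0 by apply: y0; rewrite -ltnS.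
  case: (ltnP i 11) => [i11|i11]; last first.
    have -> : i = 11%N by apply/eqP; rewrite eqn_leq i11 -ltnS i12.
    by rewrite /= y11 mul0r.
  have y10 : y 10 = 0 by apply: y0; rewrite -ltnS.
  have yi : y i = 0 by apply: y0.
  move: yi; do 11?[case: i i12 i11 y0 => [|i] i12 i11 y0] => //= yi;
    by rewrite ?y11 ?y10 ?yi; ring.
exists (chaintab (chain_point i)).
  exists (chain_point i); split=> // j ij; rewrite /chain_point.
  by do 12?[case: i i12 ij => [|i] i12 ij] => //; do 12?[case: j ij => [|j] ij].
suff -> : chain_sep i (chaintab (chain_point i)) = 1 by rewrite oner_eq0.
rewrite chain_sepE // /chain_point.
by do 12?[case: i i12 => [|i] i12] => //=; ring.
Qed.

Lemma chain12 : closed L -> irreducible_chain L 12 (fun i => closure (chainset i)).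
Proof.
move=> Lc; split=> i im.
- split; first by apply: closed_sub => // _ [y [_ ->]]; apply: chaintab_derived.
  + exact/closure_irreducible/chainset_irreducible.
  + by apply: closed_subspaceW; apply: closed_closure.
- split; first exact/closureS/chainset_sub.
  have [S0 [mu Smu mu0]] := chain_sepP im => sub.
  have /in_closureP clmu := sub mu (subset_closure Smu).
  by have := clmu _ (chain_sep_afun i) S0; apply/eqP.
Qed.

End Chain.

(** * Components, dimension and rigid algebras *)

Section Components.
Variable T : topologicalType.

Lemma irreducible_cover (I : Type) (C : I -> set T) (s : seq I) (Z : set T) :
  irreducible_set Z -> (forall i, closed (C i)) ->
  (forall x, Z x -> exists i, List.In i s /\ C i x) -> exists i, Z `<=` C i.
Proof.
move=> Zi Cc; elim: s => [|i s IH] ZC.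
  by have [[x Zx] _] := Zi; have [i []] := ZC x Zx.
pose U := \big[setU/set0]_(j <- s) C j.
have cU : closed U.
  rewrite /U; elim: (s) => [|j s' IHs]; first by rewrite big_nil; apply: closed0.
  by rewrite big_cons; apply: closedU.
have [|ZCi|ZU] := Zi.2 (C i) U (Cc i) cU.
- move=> x Zx; have [j [/= [<-|sj] Cj]] := ZC x Zx; [by left | right].
  rewrite /U; elim: (s) sj => // k s' IHs /= [->|sj]; rewrite big_cons; first by left.
  by right; apply: IHs.
- by exists i.
- apply: IH => x /ZU; rewrite /U; elim: (s) => [|j s' IHs]; first by rewrite big_nil.
  rewrite big_cons => -[Cj|/IHs[k [sk Ck]]]; first by exists j; split=> //; left.
  by exists k; split=> //; right.
Qed.

Lemma irreducible_cover_ord n (C : 'I_n -> set T) (Z : set T) :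
  irreducible_set Z -> (forall i, closed (C i)) ->
  (forall x, Z x -> exists i, C i x) -> exists i, Z `<=` C i.
Proof.
move=> Zi Cc ZC; apply: (irreducible_cover (s := enum 'I_n) Zi Cc) => x /ZC[i Ci].
exists i; split=> //; have : i \in enum 'I_n by rewrite mem_enum.
by elim: (enum 'I_n) => //= j s IH; rewrite inE => /orP[/eqP ->|/IH]; [left | right].
Qed.

Lemma irreducible_components_cover n (C : 'I_n -> set T) (A : set T) :
  (forall i, closed (C i)) -> (forall i, irreducible_set (C i)) ->
  (forall i, C i `<=` A) -> (forall x, A x -> exists i, C i x) ->
  (forall i j, C i `<=` C j -> i = j) -> irreducible_components A = range C.
Proof.
move=> Cc Ci CA AC Cinj; apply/seteqP; split=> [Z [ZA Zi Zmax]|_ [i _ <-]].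
  have [i ZC] := irreducible_cover_ord Zi Cc (fun x Zx => AC x (ZA x Zx)).
  by exists i => //; apply: Zmax.
split=> // W WA Wi CW; have [j WC] := irreducible_cover_ord Wi Cc (fun x Wx => AC x (WA x Wx)).
have ij := Cinj i j (subset_trans CW WC); subst j.
by apply/seteqP.
Qed.

End Components.

Lemma card_range_ord (T : Type) n (f : 'I_n -> T) : injective f -> range f #= `I_n.
Proof.
move=> fi; apply: (card_eq_trans (inj_card_eq _)); first by move=> x y _ _; apply: fi.
by rewrite card_eq_sym; apply: card_II.
Qed.

(** * Application to the variety of derived Jordan algebras *)

Section Main.
Variable F : numClosedFieldType.
Local Notation half := (2%:R^-1 : F).
Local Notation L := (derived_jordan F 3).
Implicit Types (mu K : algstr F 3).

(** Large indices default to [J19], here and in [component_family], so that many facts hold for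
    every natural number i. *)
Definition Jalg (i : nat) : algstr F 3 :=
  match i with 0 => J07 F | 1 => J12 F | 2 => J14 F | 3 => J16 F | _ => J19 F end%N.

Definition component_family (i : nat) : set (algstr F 3) :=
  match i with
  | 5 => \bigcup_(a : F) GLorbit (calJ01 a)
  | 6 => [set mu | exists a b c : F, GLorbit (A01 a b c) mu]
  | i => GLorbit (Jalg i)
  end%N.

(** The five orbits become families without parameters. The bound d <= 3 yields the dimension bound
    9 + 3. *)
Lemma component_familyP i : exists d (K : ('I_d -> F) -> algstr F 3),
  [/\ (d <= 3)%N, polymap K & component_family i = GLfamily K].
Proof.
have orb (K : algstr F 3) : exists d (K' : ('I_d -> F) -> algstr F 3),
    [/\ (d <= 3)%N, polymap K' & GLorbit K = GLfamily K'].
  exists 0%N, (fun=> K); split=> // [t|].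
    exact: (fsC (polyfun_subalg (@id ('I_0 -> F)))).
  by apply/seteqP; split=> [mu Kmu|mu [_]] //; exists (fun=> 0).
case: i => [|[|[|[|[|[|[|i]]]]]]]; try exact: orb.
- exists 1%N, (fun x => calJ01 (x ord0)); split=> //.
    have H := polyfun_subalg (@id ('I_1 -> F)).
    under eq_fun do rewrite -tabline_calJ01.
    apply: polymap_commalg3 => k; apply: polyfun_vec;
      repeat first [exact: (polyfun_var (@id ('I_1 -> F))) | exact: (fsC H)
       | apply: (fsD H) | apply: (fsM H)].
  apply/seteqP; split=> [mu [a _ Kmu]|mu [x Kmu]]; first by exists (fun=> a).
  by exists (x ord0).
- exists 3%N, (fun x => A01 (x o0) (x o1) (x o2)); split=> //.
    have H := polyfun_subalg (@id ('I_3 -> F)).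
    under eq_fun do rewrite -tabdiag_A01.
    apply: polymap_commalg3 => k; apply: polyfun_vec;
      repeat first [exact: (polyfun_var (@id ('I_3 -> F))) | exact: (fsC H)
       | apply: (fsD H) | apply: (fsM H)].
  apply/seteqP; split=> [mu [a [b [c Kmu]]]|mu [x Kmu]]; last by exists (x o0), (x o1), (x o2).
  by exists (fun i : 'I_3 => match (i : nat) with 0 => a | 1 => b | _ => c end%N).
Qed.

Lemma component_family_irreducible i : irreducible_set (component_family i).
Proof.
by have [d [K [_ Kp ->]]] := component_familyP i; apply: GLfamily_irreducible.
Qed.

Lemma component_family_stable i : GLstable (component_family i).
Proof. by have [d [K [_ Kp ->]]] := component_familyP i; apply: GLfamily_stable. Qed.

Lemma Jalg_comm i : acommutative (Jalg i).
Proof. by case: i => [|[|[|[|i]]]]; apply: commalg3_comm. Qed.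

Lemma Jalg_jordan i : jordan (Jalg i).
Proof.
by case: i => [|[|[|[|i]]]];
  [apply: J07_jordan|apply: J12_jordan|apply: J14_jordan|apply: J16_jordan|apply: J19_jordan].
Qed.

Lemma Jalg_isolated i : isolated_orbit (Jalg i).
Proof.
by case: i => [|[|[|[|i]]]]; [apply: J07_isolated|apply: J12_isolated|
  apply: J14_isolated|apply: J16_isolated|apply: J19_isolated].
Qed.

Lemma table_full K x x' y y' z z' c : prod_det K x x' y y' z z' = c -> c != 0 -> full K.
Proof. by move=> <-; apply: prod_det_full. Qed.

Lemma Jalg_full i : full (Jalg i).
Proof.
have h0 : half != 0 by apply: half_neq0.
case: i => [|[|[|[|i]]]] /=.
- apply: (@table_full _ (e1 F) (e1 F) (e2 F) (e2 F) (e3 F) (e3 F) 1 _ (oner_neq0 F)).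
  by rewrite /prod_det /J07 det_frame; inv_norm; ring.
- apply: (@table_full _ (e1 F) (e1 F) (e2 F) (e2 F) (e1 F) (e3 F) half _ h0).
  by rewrite /prod_det /J12 det_frame; inv_norm; ring.
- apply: (@table_full _ (e1 F) (e1 F) (e1 F) (e2 F) (e1 F) (e3 F) (half * half) _).
    by rewrite /prod_det /J14 det_frame; inv_norm; ring.
  by rewrite mulf_neq0.
- apply: (@table_full _ (e1 F) (e1 F) (e1 F) (e2 F) (e1 F) (e3 F) half _ h0).
  by rewrite /prod_det /J16 det_frame; inv_norm; ring.
- apply: (@table_full _ (e1 F) (e1 F) (e2 F) (e2 F) (e1 F) (e3 F) half _ h0).
  by rewrite /prod_det /J19 det_frame; inv_norm; ring.
Qed.

Lemma component_family_derived i : component_family i `<=` L.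
Proof.
have orb K : L K -> GLorbit K `<=` L.
  by move=> LK mu; apply: GLstable_orbit LK; apply: derived_jordan_stable.
have J j : GLorbit (Jalg j) `<=` L.
  by apply: orb; apply: jordan_derived; [apply: Jalg_comm | apply: Jalg_jordan].
case: i => [|[|[|[|[|[|[|i]]]]]]]; try exact: J.
- by move=> mu [a _]; apply: orb; apply: calJ01_derived.
- by move=> mu [a [b [c]]]; apply: orb; apply: A01_derived.
Qed.

Lemma component_cover mu : L mu -> exists i : 'I_7, closure (component_family i) mu.
Proof.
move=> [muC muD].
have cC i : closed (closure (component_family i)) by apply: closed_closure.
have sC i : GLstable (closure (component_family i)).
  exact/closure_GLstable/component_family_stable.
have CJ i : (i < 5)%N -> closure (component_family i) (Jalg i).
  move=> i5; apply: subset_closure.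
  by do 5?[case: i i5 => [|i] i5 //]; apply: GLorbit_refl.
have [muF|muF] := pselect (full mu); last first.
  have [] := @not_full_components F mu muC muD (closure (component_family 5))
      (closure (component_family 6)) (cC 5%N) (sC 5%N) _ (cC 6%N) (sC 6%N) _ muF.
  - by move=> a; apply: subset_closure; exists a => //; apply: GLorbit_refl.
  - by move=> a b c; apply: subset_closure; exists a, b, c; apply: GLorbit_refl.
  - by exists (inord 5); rewrite inordK.
  - by exists (inord 6); rewrite inordK.
have : jordan_type mu by apply: jordan_classification => //; apply: full_jordan.
have orb (i : nat) K : (i < 7)%N -> closure (component_family i) K -> GLorbit K mu ->
    exists i : 'I_7, closure (component_family i) mu.
  by move=> i7 CK Kmu; exists (inord i); rewrite inordK //; apply: GLstable_orbit Kmu.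
case=> [[a [b [c]]]|[n [m [p]]]||[|[b]|]].
- by apply: (orb 0%N) => //; apply: tabpow_degeneration => //; apply: (CJ 0%N).
- by apply: (orb 1%N) => //; apply: tabquad_degeneration => //; apply: (CJ 1%N).
- by apply: (orb 1%N) => //; apply: (tabhalf_degeneration (cC 1%N) (sC 1%N)); apply: (CJ 1%N).
- by apply: (orb 2%N) => //; apply: (CJ 2%N).
- by apply: (orb 3%N) => //; apply: tab16_degeneration => //; apply: (CJ 3%N).
- by apply: (orb 4%N) => //; apply: (CJ 4%N).
Qed.

Lemma isolated_closure K (S : set (algstr F 3)) : isolated_orbit K -> S `<=` L ->
  closure S K -> exists nu, S nu /\ GLorbit K nu.
Proof.
move=> [f [fa fK fL]] SL /in_closureP clK; apply: contrapT => /forallNP H.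
case/eqP: fK; apply: clK => // nu Snu; apply/eqP/negPn/negP => fnu.
by apply: (H nu); split=> //; apply: fL => //; apply: SL.
Qed.

Lemma isolated_open K : L K -> isolated_orbit K -> open (GLorbit K : set (subspace L)).
Proof.
move=> LK [f [fa fK fL]]; apply/open_subspaceP.
(* The translates of the isolating principal open set by the group are open and cut out the orbit in
   the variety. *)
exists (\bigcup_(g in [set g : 'M[F]_3 | g \in unitmx])
  [set mu | f (gact (invmx g) mu) != 0]).
  by apply: bigcup_open => g gu; apply: open_afun; apply: afun_gact.
apply/seteqP; split=> mu [] => [[g /= gu fg] Lmu|[g gu <-] _]; split=> //.
- have gu' : invmx g \in unitmx by rewrite unitmx_inv.
  have := fL _ (derived_jordan_stable gu' Lmu) fg.
  move=> /(GLorbit_gact gu); rewrite gactM // mulmxV // gact1 //.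
- by exists g => //=; rewrite gactK.
- by apply: derived_jordan_stable.
Qed.

Lemma assoc_neq0 K x y z k : assoc K x y z k 0 != 0 -> ~ associative_alg K.
Proof. by move=> a0 H; rewrite H cv0E eqxx in a0. Qed.

Lemma eq_neq0 (a b : F) : a = b -> b != 0 -> a != 0. Proof. by move=> ->. Qed.

Lemma quarter_neq0 : half * half != 0.
Proof. by rewrite mulf_neq0 ?half_neq0. Qed.

Lemma Jalg_noniso_lt i j : (i < j < 5)%N -> ~ GLorbit (Jalg i) (Jalg j).
Proof.
have J12J : associative_alg (J12 F) -> False.
  apply: (@assoc_neq0 _ (e1 F) (e1 F) (e3 F) o2); apply: eq_neq0 quarter_neq0.
  by rewrite /assoc /J12; inv_norm; field.
have J14J : associative_alg (J14 F) -> False.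
  apply: (@assoc_neq0 _ (e1 F) (e1 F) (e2 F) o1); apply: eq_neq0 quarter_neq0.
  by rewrite /assoc /J14; inv_norm; field.
have J16J : associative_alg (J16 F) -> False.
  apply: (@assoc_neq0 _ (e1 F) (e1 F) (e2 F) o1); apply: eq_neq0 quarter_neq0.
  by rewrite /assoc /J16; inv_norm; field.
have J19J : associative_alg (J19 F) -> False.
  apply: (@assoc_neq0 _ (e1 F) (e1 F) (e3 F) o2); apply: eq_neq0 quarter_neq0.
  by rewrite /assoc /J19; inv_norm; field.
have N K : null_ideal K -> ~ GLorbit (J12 F) K.
  move=> NK /GLorbit_sym KJ; case/eqP: (J12_gram F); apply: null_ideal_gram.
    exact: (Jalg_comm 1).
  exact: null_ideal_orbit KJ.
have S K x c : specdet 2%:R K x = c -> c != 0 -> ~ GLorbit (J14 F) K.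
  by move=> <- s0 JK; rewrite (specdet_orbit (@J14_spec F) JK) eqxx in s0.
have A K : associative_alg (J07 F) -> (associative_alg K -> False) -> ~ GLorbit (J07 F) K.
  by move=> AJ AK JK; apply: AK; apply: associative_orbit JK.
case: i => [|[|[|[|i]]]]; case: j => [|[|[|[|[|j]]]]] //= ij.
- exact: A (@J07_assoc F) J12J.
- exact: A (@J07_assoc F) J14J.
- exact: A (@J07_assoc F) J16J.
- exact: A (@J07_assoc F) J19J.
- exact: N (J14_null F).
- by have -> : J16 F = tab16 1; [rewrite /J16 /tab16 scale1r | apply: N (tab16_null 1)].
- exact: N (J19_null F).
- apply: (@S _ (e1 F) (3%:R / 8%:R)); last by rewrite mulf_neq0 ?invr_neq0 ?pnatr_eq0.
  by rewrite /J16 specdet3 /= tau3; inv_norm; field.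
- apply: (@S _ (vec 1 10%:R 0) (- (19%:R * 17%:R * 21%:R) / 8%:R)).
    by rewrite /J19 specdet3 /= tau3; inv_norm; field.
  by rewrite mulf_neq0 ?invr_neq0 ?oppr_eq0 ?mulf_neq0 ?pnatr_eq0.
- move=> /GLorbit_sym /(assoc_line_orbit (J19_assoc_line F)).
  move=> /(assoc_line_minor (e1 F) (e1 F) (e2 F) (e2 F) (e2 F) (e1 F))/eqP.
  apply/negP; have n0 : 8%:R^-1 != 0 :> F by rewrite invr_neq0 ?pnatr_eq0.
  by apply: eq_neq0 n0; rewrite /assoc_minor /assoc /J16; inv_norm; field.
- by rewrite !ltnS ltn0 andbF in ij.
Qed.

Lemma Jalg_noniso i j : (i < 5)%N -> (j < 5)%N -> GLorbit (Jalg i) (Jalg j) -> i = j.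
Proof.
move=> i5 j5 ij; have [lij|lji|//] := ltngtP i j.
  by case: (@Jalg_noniso_lt i j) => //; rewrite lij.
by case: (@Jalg_noniso_lt j i) => //; rewrite ?lji //; apply: GLorbit_sym.
Qed.

Lemma component_familyE i : (i < 5)%N -> component_family i = GLorbit (Jalg i).
Proof. by do 5?[case: i => [|i] //]. Qed.

Lemma jordan_closure i mu : (i < 5)%N -> closure (component_family i) mu -> jordan mu.
Proof.
move=> /component_familyE -> /in_closureP H x y; apply/colP => k.
apply/eqP; rewrite -subr_eq0; apply/eqP.
apply: (H (fun mu => amul mu (amul mu (amul mu x x) y) x k 0 -
  amul mu (amul mu x x) (amul mu y x) k 0)) => [|_ [g gu <-]].
  apply: (fsB (afun_subalg F 3)); apply: afun_amul => ?; try exact: afun_cst;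
    apply: afun_amul => ?; try exact: afun_cst.
  by apply: afun_amul => ?; apply: afun_cst.
by rewrite !amul_gact !mulKmx // Jalg_jordan subrr.
Qed.

Lemma plane_family_not_full i mu : (4 < i < 7)%N -> component_family i mu -> ~ full mu.
Proof.
have orb K : (forall x y, amul K x y o2 0 = 0) -> GLorbit K mu -> ~ full mu.
  move=> Kp /GLorbit_sym muK muF; apply: (plane_not_full Kp).
  exact: full_orbit muK.
do 7?[case: i => [|i] //] => _.
- by case=> a _; apply: orb; apply: calJ01_plane.
- by case=> a [b [c]]; apply: orb; apply: A01_plane.
Qed.

Lemma calJ01_not_jordan : ~ jordan (calJ01 (1 : F)).
Proof.
move=> /(_ (e3 F) (e1 F)) /(congr1 (fun z : 'cV_3 => z o0 0)) /eqP.
rewrite /calJ01; inv_norm; rewrite -subr_eq0; apply/negP.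
by apply: eq_neq0 (half_neq0 F); field.
Qed.

Lemma A01_not_jordan : ~ jordan (A01 (1 : F) 0 0).
Proof.
move=> /(_ (e3 F) (e1 F)) /(congr1 (fun z : 'cV_3 => z o1 0)) /eqP.
rewrite /A01; inv_norm; rewrite -subr_eq0; apply/negP.
by apply: eq_neq0 (oner_neq0 F); ring.
Qed.

(** A^2 is associative throughout the family [A01]. The polynomial f is a coordinate of an
    associator of three products, so it tests associativity inside A^2 only. *)
Lemma calJ01_notin_A01 : ~ closure (component_family 6) (calJ01 (0 : F)).
Proof.
pose f mu := assoc mu (amul mu (e1 F) (e1 F)) (amul mu (e1 F) (e1 F)) (amul mu (e1 F) (e2 F)) o1 0.
have fa : afun f.
  rewrite /f; under eq_fun do rewrite /assoc cvDE cvNE.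
  apply: (fsB (afun_subalg F 3)); apply: afun_amul => i; try exact: afun_amul_cst.
    by apply: afun_amul => j; apply: afun_amul_cst.
  by apply: afun_amul => j; apply: afun_amul_cst.
have n0 : half * half * half != 0 by rewrite !mulf_neq0 ?half_neq0.
apply: (not_in_closure fa).
  by apply: eq_neq0 n0; rewrite /f /assoc /calJ01; inv_norm; field.
move=> _ [a [b [c [g gu <-]]]]; rewrite /f !amul_gact assoc_gact // !mulKmx //.
set x := amul _ _ _; set y := amul _ _ (invmx g *m e2 F).
have xE : x = vec (x o0 0) (x o1 0) 0 by rewrite {1}(vec_eta x) A01_plane.
have yE : y = vec (y o0 0) (y o1 0) 0 by rewrite {1}(vec_eta y) A01_plane.
suff -> : assoc (A01 a b c) x x y = 0 by rewrite mulmx0 cv0E.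
rewrite xE yE /assoc /A01; inv_norm; congr vec; ring.
Qed.

(** Throughout [calJ01] the square of an element of A^2 is a multiple of it. In [A01] the element p
    is e1 + 2 e2, with square e1 + 4 e2; the unequal weights in p serve this purpose. *)
Lemma A01_notin_calJ01 : ~ closure (component_family 5) (A01 (0 : F) 0 0).
Proof.
pose p mu := amul mu (e1 F) (e1 F) + 2%:R *: amul mu (e2 F) (e2 F).
pose f mu := amul mu (p mu) (p mu) o0 0 * p mu o1 0 - amul mu (p mu) (p mu) o1 0 * p mu o0 0.
have H := afun_subalg F 3.
have pa i : afun (fun mu => p mu i 0).
  rewrite /p; under eq_fun do rewrite cvDE cvZE.
  by apply: (fsD H); last apply: (fsM H); first [exact: afun_amul_cst | exact: afun_cst].
have fa : afun f by apply: (fsB H); apply: (fsM H) => //; apply: afun_amul.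
have n0 : - 2%:R != 0 :> F by rewrite oppr_eq0 pnatr_eq0.
apply: (not_in_closure fa).
  by apply: eq_neq0 n0; rewrite /f /p /A01; inv_norm; ring.
move=> _ [a _ [g gu <-]].
have [q [q2 pE]] : exists q : 'cV[F]_3, q o2 0 = 0 /\ p (gact g (calJ01 a)) = g *m q.
  exists (amul (calJ01 a) (invmx g *m e1 F) (invmx g *m e1 F) +
    2%:R *: amul (calJ01 a) (invmx g *m e2 F) (invmx g *m e2 F)); split.
    by rewrite cvDE cvZE !calJ01_plane mulr0 addr0.
  by rewrite /p !amul_gact mulmxDr -scalemxAr.
have qq : amul (calJ01 a) q q = q o0 0 *: q.
  by rewrite [in LHS](vec_eta q) [q in RHS](vec_eta q) q2 /calJ01; inv_norm; congr vec; field.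
by rewrite /f pE amul_gactK // qq -scalemxAr !cvZE; ring.
Qed.

(** An isolated J in the closure of a family is isomorphic to a member of it, which A^2 = A forbids
    for the two plane families and non-isomorphism for another J. Conversely the plane families
    contain algebras violating the Jordan identity, which holds on the closures of the orbits of the
    J. *)
Lemma component_inj (i j : 'I_7) :
  closure (component_family i) `<=` closure (component_family j) -> i = j.
Proof.
move=> sub; apply: val_inj => /=; move: (ltn_ord i) (ltn_ord j) sub.
move: (i : nat) (j : nat) => {}i {}j i7 j7 sub.
have [i5|i5] := ltnP i 5.
  have Ji : closure (component_family j) (Jalg i).
    by apply: sub; apply: subset_closure; rewrite component_familyE //; apply: GLorbit_refl.
  have [nu [Sj Oi]] := isolated_closure (Jalg_isolated i) (@component_family_derived j) Ji.
  have [j5|j5] := ltnP j 5.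
    rewrite component_familyE // in Sj; apply: Jalg_noniso => //.
    by apply: GLorbit_trans Oi _; apply: GLorbit_sym.
  case: (@plane_family_not_full j nu) => //; first by rewrite j5.
  exact: full_orbit (@Jalg_full i) Oi.
have mem5 a : closure (component_family 5) (calJ01 (a : F)).
  by apply: subset_closure; exists a => //; apply: GLorbit_refl.
have mem6 a b c : closure (component_family 6) (A01 (a : F) b c).
  by apply: subset_closure; exists a, b, c; apply: GLorbit_refl.
have [iE|iE] : i = 5%N \/ i = 6%N.
- by case: i i5 i7 {sub} => [|[|[|[|[|[|[|i]]]]]]] // _ _; [left | right].
- rewrite iE in sub *; have [j5|j5] := ltnP j 5.
    by case: calJ01_not_jordan; apply: jordan_closure j5 (sub _ (mem5 1)).
  case: j j5 j7 sub => [|[|[|[|[|[|[|j]]]]]]] // _ _ sub.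
  by case: calJ01_notin_A01; apply: sub.
- rewrite iE in sub *; have [j5|j5] := ltnP j 5.
    by case: A01_not_jordan; apply: jordan_closure j5 (sub _ (mem6 1 0 0)).
  case: j j5 j7 sub => [|[|[|[|[|[|[|j]]]]]]] // _ _ sub.
  by case: A01_notin_calJ01; apply: sub.
Qed.

Lemma derived_jordan_components :
  irreducible_components L = range (fun i : 'I_7 => closure (component_family i)).
Proof.
apply: irreducible_components_cover => [i|i|i|mu|i j].
- exact: closed_closure.
- exact/closure_irreducible/component_family_irreducible.
- apply: closed_sub; [exact: derived_jordan_closed | exact: component_family_derived].
- exact: component_cover.
- exact: component_inj.
Qed.

Lemma derived_jordan_dim : has_krull_dim L 12.
Proof.
split; first by eexists; apply: chain12; apply: derived_jordan_closed.
move=> m Z ch; have [ZA _] := ch; have [Zm Zi _] := ZA m (leqnn m).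
have [i ZC] := irreducible_cover_ord (C := fun i : 'I_7 => closure (component_family i)) Zi
  (fun i => @closed_closure _ _) (fun mu Zmu => component_cover (Zm mu Zmu)).
have [d [K [d3 Kp E]]] := component_familyP i.
have [Psi [Psip sub]] := GLfamily_param Kp.
apply: leq_trans (chain_length_le Psip ch _) _.
  by apply: subset_trans ZC _; apply: closureS; rewrite E.
by rewrite (leq_add2l 9 d 3).
Qed.

(** A curve in the variety that meets a relatively open orbit lies in it for almost all t, so the
    nonzero polynomial h would vanish at almost all t. *)
Lemma nonconstant_orbit mu (g : F -> algstr F 3) (h : F -> F) U t0 :
  open U -> U `&` L = GLorbit mu `&` L -> acurve g -> (forall t, L (g t)) ->
  U (g t0) -> upolyfun h -> (exists s, h s != 0) ->
  (forall t, GLorbit mu (g t) -> h t = 0) -> False.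
Proof.
move=> oU UL gc gL Ut0 hu [s hs] gh.
have [f [fa f0 fU]] := open_nbhs_afun oU Ut0.
have [t] := upolyfun_mul_neq0 (acurve_comp fa gc) hu f0 hs.
rewrite mulf_eq0 negb_or => /andP[ft ht].
have : (GLorbit mu `&` L) (g t) by rewrite -UL; split=> //; apply: fU.
by move=> [/gh h0 _]; rewrite h0 eqxx in ht.
Qed.

Lemma sqr_sub_upolyfun (c d : F) : upolyfun (fun t => c * t ^+ 2 - d).
Proof.
have H := upolyfun_subalg F; apply: (fsB H); last exact: (fsC H).
by apply: (fsM H); [apply: (fsC H) | apply: (fsX H); apply: upolyfun_id].
Qed.

Lemma sqr_sub_neq0 (c d : F) : c != 0 -> exists t, c * t ^+ 2 - d != 0.
Proof.
move=> c0; have [s s2] := sqrt_ex ((d + 1) / c); exists s.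
by rewrite s2 mulrC mulfVK // addrAC subrr add0r oner_eq0.
Qed.

Lemma rigid_orbit mu : rigid_in L mu -> exists i : 'I_5, GLorbit mu = GLorbit (Jalg i).
Proof.
move=> [Lmu /open_subspaceP[U oU UL]].
have Umu : U mu.
  have : (GLorbit mu `&` L) mu by split=> //; apply: GLorbit_refl.
  by rewrite -UL => -[].
have [i clmu] := component_cover Lmu.
(* An open orbit inside the closure of a family meets the family itself. *)
have [nu [Snu Unu]] : exists nu, component_family i nu /\ U nu.
  by have [nu] := clmu U (open_nbhs_nbhs (conj oU Umu)); exists nu.
have Onu : GLorbit mu nu.
  have : (U `&` L) nu by split=> //; apply: component_family_derived Snu.
  by rewrite UL => -[].
have inU K : GLorbit K nu -> L K -> U K /\ GLorbit mu K.
  move=> Knu LK; have muK : GLorbit mu K by apply: GLorbit_trans Onu (GLorbit_sym Knu).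
  by split=> //; have : (GLorbit mu `&` L) K by []; rewrite -UL => -[].
have [i5|i5] := ltnP i 5.
  exists (Ordinal i5) => /=; rewrite component_familyE // in Snu.
  by rewrite -(GLorbit_eq Onu) (GLorbit_eq Snu).
exfalso; move: Snu; have [iE|iE] : (i : nat) = 5%N \/ (i : nat) = 6%N.
- by case: i i5 {clmu} => [[|[|[|[|[|[|[|i]]]]]]] i7] //= _; [left | right].
- rewrite iE => -[a _ /inU[|Ua mua]]; first exact: calJ01_derived.
  apply: (nonconstant_orbit oU UL (g := fun t => calJ01 t) (t0 := a)
    (h := fun t => 1 * t ^+ 2 - a ^+ 2)) => //.
  + by rewrite /calJ01; apply: acurve_commalg3 => k; rewrite ?vec_norm;
      under eq_fun do rewrite /vec !cvE; upoly F.
  + by move=> t; apply: calJ01_derived.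
  + exact: sqr_sub_upolyfun.
  + exact/sqr_sub_neq0/oner_neq0.
  + move=> t /GLorbit_sym tmu; have := calJ01_iso (GLorbit_trans tmu mua).
    by rewrite mul1r => ->; rewrite subrr.
- rewrite iE => -[a [b [c /inU[|Ua mua]]]]; first exact: A01_derived.
  (* For c = 0 the second alternative of [A01_iso] cannot occur; the substitutes 1 and 0 merely keep
     the second factor of h a nonzero polynomial. *)
  pose c' := if c == 0 then 1 else c.
  pose d' := if c == 0 then 0 else b ^+ 2.
  have c'0 : c' != 0 by rewrite /c'; case: (eqVneq c 0) => [_|//]; apply: oner_neq0.
  apply: (nonconstant_orbit oU UL (g := fun t => A01 t b c) (t0 := a)
    (h := fun t => (1 * t ^+ 2 - a ^+ 2) * (c' * t ^+ 2 - d'))) => //.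
  + by rewrite /A01; apply: acurve_commalg3 => k; rewrite ?vec_norm;
      under eq_fun do rewrite /vec !cvE; upoly F.
  + by move=> t; apply: A01_derived.
  + by apply: (fsM (upolyfun_subalg F)); apply: sqr_sub_upolyfun.
  + have [s1 h1] := @sqr_sub_neq0 1 (a ^+ 2) (oner_neq0 F).
    have [s2 h2] := @sqr_sub_neq0 c' d' c'0.
    exact: upolyfun_mul_neq0 (sqr_sub_upolyfun _ _) (sqr_sub_upolyfun _ _) h1 h2.
  + move=> t /GLorbit_sym tmu; have [ta|[c0 tb]] := A01_iso (GLorbit_trans tmu mua).
      by rewrite mul1r ta subrr mul0r.
    by rewrite /c' /d' (negbTE c0) tb subrr mulr0.
Qed.

Lemma rigid_orbits : [set GLorbit mu | mu in rigid_in L] =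
  range (fun i : 'I_5 => GLorbit (Jalg i)).
Proof.
apply/seteqP; split=> [_ [mu /rigid_orbit[i ->] <-]|_ [i _ <-]]; first by exists i.
have LJ : L (Jalg i) by apply: jordan_derived; [apply: Jalg_comm | apply: Jalg_jordan].
by exists (Jalg i) => //; split=> //; apply: isolated_open => //; apply: Jalg_isolated.
Qed.

Lemma component_closures : range (fun i : 'I_7 => closure (component_family i)) =
  [set closure (GLorbit (J07 F)); closure (GLorbit (J12 F)); closure (GLorbit (J14 F));
       closure (GLorbit (J16 F)); closure (GLorbit (J19 F));
       closure (\bigcup_(a : F) GLorbit (calJ01 a));
       closure [set mu | exists a b c : F, GLorbit (A01 a b c) mu]].
Proof.
apply/seteqP; split=> [_ [[i i7] _ <-]|C].
  by do 7?[case: i i7 => [|i] i7 //=]; do ?[by right | left].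
have R i : (i < 7)%N -> range (fun i : 'I_7 => closure (component_family i))
    (closure (component_family i)) by move=> i7; exists (Ordinal i7).
by move=> [[[[[[->|->]|->]|->]|->]|->]|->]; [apply: (R 0%N) | apply: (R 1%N) |
  apply: (R 2%N) | apply: (R 3%N) | apply: (R 4%N) | apply: (R 5%N) | apply: (R 6%N)].
Qed.

Theorem derived_jordan_main :
  [/\ has_krull_dim (derived_jordan F 3) 12,
      irreducible_components (derived_jordan F 3) =
        [set closure (GLorbit (J07 F)); closure (GLorbit (J12 F)); closure (GLorbit (J14 F));
             closure (GLorbit (J16 F)); closure (GLorbit (J19 F));
             closure (\bigcup_(a : F) GLorbit (calJ01 a));
             closure [set mu | exists a b c : F, GLorbit (A01 a b c) mu]],
      irreducible_components (derived_jordan F 3) #= `I_7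
    & [set GLorbit mu | mu in rigid_in (derived_jordan F 3)] #= `I_5].
Proof.
split.
- exact: derived_jordan_dim.
- by rewrite derived_jordan_components component_closures.
- rewrite derived_jordan_components; apply: card_range_ord => i j E.
  by apply: component_inj; rewrite E.
- rewrite rigid_orbits; apply: card_range_ord => i j.
  move=> E; have {}E : GLorbit (Jalg i) = GLorbit (Jalg j) := E.
  have ij : GLorbit (Jalg i) (Jalg j) by rewrite E; apply: GLorbit_refl.
  by apply: val_inj; apply: Jalg_noniso ij.
Qed.

End Main.

Local Open Scope complex_scope.

Theorem theoremG3 (R : realType) :
  [/\ has_krull_dim (derived_jordan R[i] 3) 12,
      irreducible_components (derived_jordan R[i] 3) =
        [set closure (GLorbit (J07 R[i]));
             closure (GLorbit (J12 R[i]));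
             closure (GLorbit (J14 R[i]));
             closure (GLorbit (J16 R[i]));
             closure (GLorbit (J19 R[i]));
             closure (\bigcup_(a : R[i]) GLorbit (calJ01 a));
             closure [set mu | exists a b c : R[i], GLorbit (A01 a b c) mu]],
      irreducible_components (derived_jordan R[i] 3) #= `I_7
    & [set GLorbit mu | mu in rigid_in (derived_jordan R[i] 3)] #= `I_5].
Proof. exact: derived_jordan_main. Qed.
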